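(* Let $\mathbf{G}$ be one of the ind-groups $\mathrm{GL}(\infty)$, $\mathrm{O}(\infty)$, $\mathrm{Sp}(\infty)$, and let $\mathbf{P}_1,\mathbf{P}_2\subsetneq\mathbf{G}$ be splitting parabolic subgroups. Then $\mathbf{X}=\mathbf{G}/\mathbf{P}_1\times\mathbf{G}/\mathbf{P}_2$, with the diagonal action of $\mathbf{G}$, has a finite number of $\mathbf{G}$-orbits if and only if one of the subgroups $\mathbf{P}_1,\mathbf{P}_2$ is large and the other one is semilarge.
   Context: The base field is $\mathbb{C}$. $V$ is a vector space of countably infinite dimension. Three types: (A) no additional structure on $V$; (BD) $V$ has a nondegenerate symmetric bilinear form $\omega$; (C) $V$ has a symplectic (nondegenerate alternating) form $\omega$. (BCD) means (BD) or (C). A countable-dimensional subspace $V_*\subset V^*=\mathrm{Hom}(V,\mathbb{C})$ with nondegenerate pairing $V_*\times V\to\mathbb{C}$ is fixed (arbitrary in type (A); $V_*=\{\omega(v,\cdot):v\in V\}$ in type (BCD)). $\mathrm{GL}(\infty)$ is the group of all $g\in\mathrm{GL}(V)$ such that $g(V_* )=V_*$ and $g$ fixes pointwise some finite-codimensional subspaces of $V$ and of $V_*$; $\mathrm{O}(\infty)$ (type (BD)) and $\mathrm{Sp}(\infty)$ (type (C)) are the subgroups of $g\in \mathrm{GL}(\infty)$ preserving $\omega$. A basis $E$ of $V$ is admissible if: in type (A), the dual family $\{\phi_e:e\in E\}$ ($\phi_e(e')=\delta_{e,e'}$) spans $V_*$; in type (BCD), $E$ has an involution $i_E:E\to E$ with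 at most one fixed point such that $\omega(e,e')\neq0$ iff $e'=i_E(e)$. For an admissible basis $E$, let $\mathbf{H}(E)\subset\mathbf{G}$ be the subgroup of elements diagonal in $E$ (a splitting Cartan subgroup). Fix an exhausting increasing filtration $E=\bigcup_{n\ge1}E_n$ by finite subsets ($i_E$-stable in type (BCD)) and put $\mathbf{G}(E_n)=\mathbf{G}\cap\mathrm{GL}(\langle E_n\rangle)$, where $\mathrm{GL}(\langle E_n\rangle)$ acts on $V$ trivially on $E\setminus E_n$; $\langle\cdot\rangle$ is linear span. A splitting parabolic subgroup is a subgroup $\mathbf{P}\subset\mathbf{G}$ containing $\mathbf{H}(E)$ for some admissible $E$ and such that $\mathbf{P}\cap\mathbf{G}(E_n)$ is a parabolic subgroup of $\mathbf{G}(E_n)$ for all $n$. Known description (Dimitrov–Penkov), which may be taken as the definition: these are exactly the stabilizers $\{g\in\mathbf{G}:g\mathcal{F}=\mathcal{F}\}$ of generalized flags $\mathcal{F}$ compatible with some admissible basis $E$ (in particular parabolic subgroups of $\mathrm{O}_m$ are understood as stabilizers of isotropic flags). Here a generalized flag is a set $\mathcal{F}$ of subspaces of $V$, totally ordered by inclusion, such that every $F\in\mathcal{F}$ has an immediate predecessor or immediate successor in $\mathcal{F}$, for every nonzero $v\in V$ there are consecutive $F'\subset F''$ in $\mathcal{F}$ with $v\in F''\setminus F'$, and, in type (BCD), $F\mapsto F^\perp$ is an involution of $\mathcal{F}$; it is $E$-compatible if each $F\in\mathcal{F}$ is spanned by a subset of $E$. A splitting parabolic subgroup $\mathbf{P}$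 is semilarge if it has only finitely many invariant subspaces in $V$; equivalently, it is the stabilizer of a generalized flag that is a finite chain $\{0=F_0\subsetneq F_1\subsetneq\dots\subsetneq F_m=V\}$ (with $F_k^\perp=F_{m-k}$ in type (BCD)). It is large if moreover each $F_k$ is finite dimensional or finite codimensional. *)

(* Defs.v *)
From HB Require Import structures.
From mathcomp Require Import all_boot all_order all_algebra.
From mathcomp Require Import all_classical reals.
From mathcomp Require Import complex.

Set Implicit Arguments.
Unset Strict Implicit.
Unset Printing Implicit Defensive.

Import GRing.Theory.

Local Open Scope classical_set_scope.
Local Open Scope ring_scope.

Section Subspaces.
Variables (K : fieldType) (V : lmodType K).
Implicit Types (A B E W U F : set V) (Fl : set (set V)).

Definition is_subspace W : Prop :=
  [/\ W 0, forall u v, W u -> W v -> W (u + v)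
    & forall (a : K) v, W v -> W (a *: v)].

Definition span A : set V := smallest is_subspace A.

Definition lin_indep B : Prop :=
  forall (s : seq V) (c : V -> K), uniq s -> {in s, forall e, B e} ->
    \sum_(e <- s) c e *: e = 0 -> {in s, forall e, c e = 0}.

Definition basis_of W B : Prop := lin_indep B /\ span B = W.

Definition countable_dim W : Prop := exists2 B, basis_of W B & countable B.

Definition countably_infinite_dim W : Prop :=
  exists B, [/\ basis_of W B, countable B & infinite_set B].

Definition finite_dim W : Prop := exists2 B, basis_of W B & finite_set B.

(* W is a finite-codimensional subspace of U *)
Definition finite_codim_in U W : Prop :=
  [/\ is_subspace W, W `<=` U
    & exists2 A, finite_set A & span (W `|` A) = U].

Definition consecutive Fl F1 F2 : Prop :=
  [/\ Fl F1, Fl F2, F1 `<` F2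
    & forall F, Fl F -> ~ (F1 `<` F /\ F `<` F2)].

Definition compatible E Fl : Prop :=
  forall F, Fl F -> exists2 A, A `<=` E & F = span A.

Definition dual_space : set (V -> K^o) := [set phi | scalar phi].

Definition dual_family E : set (V -> K^o) :=
  [set phi | dual_space phi /\
     exists2 e, E e & forall e', E e' -> phi e' = (e == e')%:R].

End Subspaces.

(* GL(V), for V of arbitrary dimension; the inverse is stored with the map *)
Record gl (K : fieldType) (V : lmodType K) := GL {
  gl_fun :> V -> V;
  gl_inv : V -> V;
  gl_linear : linear gl_fun;
  gl_funK : cancel gl_fun gl_inv;
  gl_invK : cancel gl_inv gl_fun }.

Section GLGroup.
Variables (K : fieldType) (V : lmodType K).
Implicit Types g h : gl V.

Lemma gl_ext g h : g =1 h -> g = h.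
Proof.
case: g => f f' lf fK f'K; case: h => k k' lk kK k'K /= /funext fk.
subst k; have e : f' = k' by apply/funext => x; rewrite -{2}(f'K x) kK.
by subst k'; congr GL; exact: Prop_irrelevance.
Qed.

HB.instance Definition _ := gen_eqMixin (gl V).
HB.instance Definition _ := gen_choiceMixin (gl V).

Definition gl_one : gl V.
Proof. by exists id id. Defined.

Definition gl_mul g h : gl V.
Proof.
exists (g \o h) (gl_inv h \o gl_inv g).
- by move=> a u v /=; rewrite (gl_linear h) (gl_linear g).
- by move=> v /=; rewrite !gl_funK.
- by move=> v /=; rewrite !gl_invK.
Defined.

Definition gl_inverse g : gl V.
Proof.
exists (gl_inv g) (gl_fun g).
- move=> a u v; apply: (can_inj (gl_funK g)).
  by rewrite (gl_linear g) !gl_invK.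
- exact: gl_invK.
- exact: gl_funK.
Defined.

Fact gl_mulA : associative gl_mul.
Proof. by move=> f g h; apply: gl_ext. Qed.

Fact gl_mul1 : left_id gl_one gl_mul.
Proof. by move=> g; apply: gl_ext. Qed.

Fact gl_mulr1 : right_id gl_one gl_mul.
Proof. by move=> g; apply: gl_ext. Qed.

Fact gl_mulV : left_inverse gl_one gl_inverse gl_mul.
Proof. by move=> g; apply: gl_ext => v /=; rewrite gl_funK. Qed.

Fact gl_mulrV : right_inverse gl_one gl_inverse gl_mul.
Proof. by move=> g; apply: gl_ext => v /=; rewrite gl_invK. Qed.

HB.instance Definition _ :=
  isGroup.Build (gl V) gl_mulA gl_mul1 gl_mulr1 gl_mulV gl_mulrV.

(* the contragredient action on V^* *)
Definition dual_act g (phi : V -> K^o) : V -> K^o := phi \o (g^-1)%g.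

End GLGroup.

Section Orbits.
Variable T : groupType.
Implicit Types (G P : set T) (g : T).

Definition translate g (A : set T) : set T := [set (g * a)%g | a in A].

(* G/P as the set of left cosets *)
Definition left_cosets G P : set (set T) := [set translate g P | g in G].

Definition diag_orbit G (x : set T * set T) : set (set T * set T) :=
  [set (translate g x.1, translate g x.2) | g in G].

(* the set of G-orbits on G/P1 x G/P2 *)
Definition diag_orbits G P1 P2 : set (set (set T * set T)) :=
  [set diag_orbit G x | x in left_cosets G P1 `*` left_cosets G P2].

End Orbits.

(* R[i] is the field of complex numbers, all realTypes being isomorphic. *)
Section IndGroups.
Variables (R : realType) (V : lmodType R[i]).
Implicit Types (E F : set V) (Fl : set (set V)).

Inductive vstructure : Type :=
  | TypeA of set (V -> R[i]^o)
  | TypeBD of {biscalar V}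
  | TypeC of {biscalar V}.

Implicit Type S : vstructure.

Definition form_of S : option {biscalar V} :=
  match S with TypeA _ => None | TypeBD w | TypeC w => Some w end.

Definition V_star S : set (V -> R[i]^o) :=
  match S with
  | TypeA Vs => Vs
  | TypeBD w | TypeC w => [set phi | exists v, phi = w v]
  end.

Definition nondegenerate_form (w : {biscalar V}) : Prop :=
  forall v, (forall u, w v u = 0) -> v = 0.

(* For V_* x V -> C, the radical in V_* is zero because V_* consists of
   functions on V; similarly the two radicals of a symmetric or alternating
   form coincide. *)
Definition valid_structure S : Prop :=
  match S with
  | TypeA Vs =>
      [/\ is_subspace Vs, Vs `<=` dual_space (V := V), countable_dim Vs
        & forall v, (forall phi, Vs phi -> phi v = 0) -> v = 0]
  | TypeBD w => (forall u v, w u v = w v u) /\ nondegenerate_form w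
  | TypeC w => (forall v, w v v = 0) /\ nondegenerate_form w
  end.

Definition GL_infty (Vs : set (V -> R[i]^o)) : set (gl V) :=
  [set g | [/\ [set dual_act g phi | phi in Vs] = Vs,
     exists2 W, finite_codim_in setT W & forall v, W v -> g v = v
   & exists2 W, finite_codim_in Vs W
       & forall phi, W phi -> dual_act g phi = phi]].

Definition preserves_form (w : {biscalar V}) : set (gl V) :=
  [set g | forall u v, w (g u) (g v) = w u v].

(* GL(oo), O(oo) or Sp(oo) *)
Definition ind_group S : set (gl V) :=
  match form_of S with
  | None => GL_infty (V_star S)
  | Some w => GL_infty (V_star S) `&` preserves_form w
  end.

Definition admissible S E : Prop :=
  basis_of setT E /\
  match form_of S with
  | None => span (dual_family E) = V_star S
  | Some w => exists i : V -> V,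
      [/\ forall e, E e -> E (i e) /\ i (i e) = e,
          forall e e', E e -> E e' -> i e = e -> i e' = e' -> e = e'
        & forall e e', E e -> E e' -> (w e e' <> 0 <-> e' = i e)]
  end.

Definition perp (w : {biscalar V}) F : set V :=
  [set v | forall u, F u -> w u v = 0].

Definition generalized_flag S Fl : Prop :=
  [/\ forall F, Fl F -> is_subspace F,
      forall F1 F2, Fl F1 -> Fl F2 -> F1 `<=` F2 \/ F2 `<=` F1,
      forall F, Fl F ->
        exists F', consecutive Fl F' F \/ consecutive Fl F F',
      forall v, v <> 0 ->
        exists F1 F2, consecutive Fl F1 F2 /\ (F2 `\` F1) v
    & match form_of S with
      | None => True
      | Some w =>
          forall F, Fl F -> Fl (perp w F) /\ perp w (perp w F) = F
      end].

Definition stabilizer S Fl : set (gl V) :=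
  [set g | ind_group S g /\ [set g @` F | F in Fl] = Fl].

Definition is_stabilizer_of S (P : set (gl V)) Fl : Prop :=
  [/\ generalized_flag S Fl,
      exists2 E, admissible S E & compatible E Fl
    & P = stabilizer S Fl].

(* The Dimitrov-Penkov description of the splitting parabolic subgroups, taken
   as the definition. *)
Definition splitting_parabolic S (P : set (gl V)) : Prop :=
  exists Fl, is_stabilizer_of S P Fl.

Definition invariant_subspace (P : set (gl V)) (W : set V) : Prop :=
  is_subspace W /\ forall g, P g -> g @` W `<=` W.

Definition semilarge S (P : set (gl V)) : Prop :=
  splitting_parabolic S P /\ finite_set (invariant_subspace P).

Definition large S (P : set (gl V)) : Prop :=
  semilarge S P /\
  exists Fl, [/\ is_stabilizer_of S P Fl, finite_set Fl
    & forall F, Fl F -> finite_dim F \/ finite_codim_in setT F].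

End IndGroups.

(* Main.v *)
From Pilot Require Import Defs.
From HB Require Import structures.
From mathcomp Require Import all_boot all_order all_algebra.
From mathcomp Require Import all_classical reals.
From mathcomp Require Import complex.
From mathcomp Require Import ring.

Set Implicit Arguments.
Unset Strict Implicit.
Unset Printing Implicit Defensive.

Import GRing.Theory Num.Theory.
Import Pilot.Defs.

Local Open Scope classical_set_scope.
Local Open Scope ring_scope.

(** Let G be the ind-group. Cosets g P correspond to translates g Fl of the
flag defining P, so the orbits to be counted are the relative positions of
pairs of flags. Everything rests on one rigidity property: an element of G is
the identity on a subspace of finite codimension, hence cannot map a subspace
strictly into itself (finitary_surj, GL_im_sub). So the stabilizer of a flag
fixes every member, an element preserving the members up to inclusion is in
the stabilizer, and sizes of intersections g F2 ∩ F1, suitably compared, are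
invariants of the relative position of g Fl2 and Fl1.

The flags may be compatible with two bases that have nothing to do with each
other. What replaces a common basis is closedness: a member F of a flag is cut
out by functionals of V_star, so that vectors outside F can be separated from
it by transvections. The basic move (exchange) replaces F by H + K u, with H a
hyperplane of F and u a vector outside F. It is a transvection in type A; with
a form, F and u have to be isotropic and one or two reflections or symplectic
transvections do it.

Finitely many orbits force both flags to be finite. If Fl1 is infinite, pick a
proper nonzero member F of Fl2 and, for infinitely many layers of Fl1, an
exchange on F adapted to the layer. Against each member F' of Fl1 the
intersection F ∩ F' loses or gains at most one dimension; the pattern of losses
and gains is an invariant, and it remembers the layer (kind_infinite).
They also force one flag to consist of members of finite dimension or
codimension. If F1 and F2 violate this, exchanges on F2 make F1 ∩ g F2
increase, or decrease, indefinitely (medium_members_infinite).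

A finite flag gives finitely many invariant subspaces, since these are spanned
by basis vectors and the stabilizer moves basis vectors within a layer
(finite_invariant); conversely members of the flag are invariant subspaces.

Suppose finally that Fl2 is finite and that the members of Fl1 have finite
dimension or codimension. Then Fl1 is encoded by a finite tuple of vectors,
and of functionals in type A. Gaussian elimination by elements of the
stabilizer of Fl2 brings each translate of the tuple, up to a triangular
change, to a tuple of basis vectors (normal_form). Each of these is determined
by its layer up to finitely many choices, because basis vectors of one layer
can be exchanged while the previous ones are kept (vector_step, covector_step).
So there are finitely many normal forms, and finitely many orbits. *)

(** * Linear algebra relative to a subspace *)
Section Functionals.
Variables (K : fieldType) (V : lmodType K) (f : V -> K).
Hypothesis lf : scalar f.

Lemma sc0 : f 0 = 0.
Proof. by have := lf (-1) 0 0; rewrite scaler0 addr0 mulN1r addNr. Qed.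
Lemma scD u v : f (u + v) = f u + f v.
Proof. by have := lf 1 u v; rewrite scale1r mul1r. Qed.
Lemma scZ a u : f (a *: u) = a * f u.
Proof. by have := lf a u 0; rewrite !addr0 sc0 addr0. Qed.
Lemma scN u : f (- u) = - f u.
Proof. by rewrite -scaleN1r scZ mulN1r. Qed.
Lemma scB u v : f (u - v) = f u - f v.
Proof. by rewrite scD scN. Qed.
Lemma subspace_ker : is_subspace [set x | f x = 0].
Proof.
split=> [|u v fu fv|a u fu] /=; first exact: sc0.
- by rewrite scD fu fv addr0.
- by rewrite scZ fu mulr0.
Qed.
End Functionals.

Section Subspace.
Variables (K : fieldType) (V : lmodType K).
Implicit Types (A B E U W X Y : set V) (u v x y : V) (s t : seq V).

Lemma subs0 W : is_subspace W -> W 0. Proof. by case. Qed.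
Lemma subsD W u v : is_subspace W -> W u -> W v -> W (u + v).
Proof. by case=> _ h _; exact: h. Qed.
Lemma subsZ W a v : is_subspace W -> W v -> W (a *: v).
Proof. by case=> _ _; exact. Qed.
Lemma subsN W v : is_subspace W -> W v -> W (- v).
Proof. by move=> sW Wv; rewrite -scaleN1r; exact: subsZ. Qed.
Lemma subsB W u v : is_subspace W -> W u -> W v -> W (u - v).
Proof. by move=> sW Wu Wv; apply: subsD => //; exact: subsN. Qed.
Lemma subsDr W u v : is_subspace W -> W v -> W (u + v) -> W u.
Proof. by move=> sW Wv Wuv; rewrite -(addrK v u); exact: subsB. Qed.
Lemma subs_sum W (I : eqType) (r : seq I) (f : I -> V) : is_subspace W ->
  {in r, forall i, W (f i)} -> W (\sum_(i <- r) f i).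
Proof.
move=> sW h; rewrite big_seq; elim/big_ind: _ => //; first exact: subs0.
by move=> x y; exact: subsD.
Qed.
Lemma subsZE W a v : is_subspace W -> a != 0 -> W (a *: v) -> W v.
Proof.
by move=> sW a0 /(subsZ a^-1 sW); rewrite scalerA mulVf // scale1r.
Qed.

Lemma subspaceT : is_subspace [set: V]. Proof. by []. Qed.
Lemma subspace0 : is_subspace [set (0 : V)].
Proof. by split=> // [u v -> ->|a v ->] /=; rewrite ?addr0 ?scaler0. Qed.
Lemma subspaceI X Y : is_subspace X -> is_subspace Y -> is_subspace (X `&` Y).
Proof.
move=> sX sY; split; first by split; exact: subs0.
- by move=> u v [? ?] [? ?]; split; exact: subsD.
- by move=> a v [? ?]; split; exact: subsZ.
Qed.

Lemma subspace_span A : is_subspace (span A).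
Proof.
split=> [W [sW _]|u v hu hv W hW|a v hv W hW]; first exact: subs0.
- by apply: subsD; [case: hW|apply: hu|apply: hv].
- by apply: subsZ; [case: hW|apply: hv].
Qed.

Lemma span_incl A : A `<=` span A. Proof. exact: sub_gen_smallest. Qed.
Lemma span_min A W : is_subspace W -> A `<=` W -> span A `<=` W.
Proof. exact: smallest_sub. Qed.
Lemma spanS A B : A `<=` B -> span A `<=` span B.
Proof.
by move=> h; apply: span_min; [exact: subspace_span|apply: subset_trans h (@span_incl B)].
Qed.
Lemma span0 : span (set0 : set V) = [set 0].
Proof.
apply/seteqP; split; first by apply: span_min => //; exact: subspace0.
by move=> _ ->; exact: subs0 (subspace_span _).
Qed.

(** X + K u; the coefficient along u is explicit because most arguments below
come down to showing that it vanishes. *)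
Definition adj X u : set V := [set y | exists c : K, X (y - c *: u)].

Lemma subspace_adj X u : is_subspace X -> is_subspace (adj X u).
Proof.
move=> sX; split=> [|x y [c hc] [d hd]|a x [c hc]].
- by exists 0; rewrite scale0r subr0; exact: subs0.
- by exists (c + d); rewrite scalerDl opprD addrACA; exact: subsD.
- by exists (a * c); rewrite -scalerA -scalerBr; exact: subsZ.
Qed.
Lemma adj_sub X u : X `<=` adj X u.
Proof. by move=> x Xx; exists 0; rewrite scale0r subr0. Qed.
Lemma adj_in X u : is_subspace X -> adj X u u.
Proof. by move=> sX; exists 1; rewrite scale1r subrr; exact: subs0. Qed.
Lemma adj_min X u W : is_subspace W -> X `<=` W -> W u -> adj X u `<=` W.
Proof.
move=> sW XW Wu y [c /XW h]; rewrite -(subrK (c *: u) y).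
by apply: subsD => //; exact: subsZ.
Qed.
Lemma adjS X Y u : X `<=` Y -> adj X u `<=` adj Y u.
Proof. by move=> h x [c hc]; exists c; exact: h. Qed.

(** X plus the span of s, arranged for inductions on s. *)
Definition adjs X s : set V := foldr (fun u Y => adj Y u) X s.
Lemma subspace_adjs X s : is_subspace X -> is_subspace (adjs X s).
Proof. by move=> sX; elim: s => //= u s IH; exact: subspace_adj. Qed.
Lemma adjs_sub X s : X `<=` adjs X s.
Proof. by elim: s => //= u s IH; apply: subset_trans IH (@adj_sub _ _). Qed.
Lemma adjs_in X s : is_subspace X -> {in s, forall u, adjs X s u}.
Proof.
move=> sX; elim: s => //= u s IH x; rewrite inE => /orP[/eqP->|/IH].
  by apply: adj_in; exact: subspace_adjs.
exact: adj_sub.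
Qed.
Lemma adjs_min X s W : is_subspace W -> X `<=` W -> {in s, forall u, W u} ->
  adjs X s `<=` W.
Proof.
move=> sW XW; elim: s => //= u s IH h; apply: adj_min => //.
  by apply: IH => x xs; apply: h; rewrite inE xs orbT.
by apply: h; rewrite inE eqxx.
Qed.
Lemma adjsS X Y s : X `<=` Y -> adjs X s `<=` adjs Y s.
Proof. by move=> h; elim: s => //= u s IH; exact: adjS. Qed.

Lemma span_adjs X s : is_subspace X -> span (X `|` [set` s]) = adjs X s.
Proof.
move=> sX; apply/seteqP; split.
  apply: span_min; first exact: subspace_adjs.
  by move=> x [/adjs_sub//|/= xs]; exact: adjs_in.
apply: adjs_min; first exact: subspace_span.
  by move=> x Xx; apply: span_incl; left.
by move=> x xs; apply: span_incl; right.
Qed.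

Lemma span_seq s : span [set` s] = adjs [set 0] s.
Proof.
rewrite -span_adjs; last exact: subspace0.
apply/seteqP; split; first by apply: spanS => x; right.
apply: span_min; first exact: subspace_span.
by move=> x [->|/= xs]; [exact: subs0 (subspace_span _)|exact: span_incl].
Qed.

Lemma adjs_coef X s x : adjs X s x ->
  exists c : nat -> K, X (x - \sum_(k < size s) c k *: s`_k).
Proof.
elim: s x => [|u s IH] x /=; first by exists (fun=> 0); rewrite big_ord0 subr0.
case=> a /IH[c hc]; exists (fun k => if k is k'.+1 then c k' else a).
by rewrite big_ord_recl /= opprD addrA.
Qed.

(** Finite dimension, in a form that makes sense for any subset and passes to
smaller ones without choosing bases. *)
Definition fin X : Prop := exists s : seq V, X `<=` span [set` s].

Lemma finS X Y : X `<=` Y -> fin Y -> fin X.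
Proof. by move=> h [s hs]; exists s; apply: subset_trans hs. Qed.
Lemma fin_adj X u : fin X -> fin (adj X u).
Proof.
move=> [s hs]; exists (u :: s); apply: adj_min.
- exact: subspace_span.
- by apply: subset_trans hs _; apply: spanS => x /= xs; rewrite inE xs orbT.
- by apply: span_incl; rewrite /= inE eqxx.
Qed.
Lemma fin_finite_dim X : finite_dim X -> fin X.
Proof. by case=> B [_ <-] /finite_seqP[s ->]; exists s. Qed.

Lemma codimP U W :
  finite_codim_in U W <->
  [/\ is_subspace W, W `<=` U & exists s, U = adjs W s].
Proof.
split.
- case=> sW WU [A /finite_seqP[s ->] <-]; split=> //.
    by move=> x Wx; apply: span_incl; left.
  by exists s; rewrite span_adjs.
- case=> sW WU [s Us]; split=> //; exists [set` s]; last by rewrite span_adjs.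
  by apply/finite_seqP; exists s.
Qed.

Lemma codim_refl U : is_subspace U -> finite_codim_in U U.
Proof. by move=> sU; apply/codimP; split=> //; exists [::]. Qed.

Lemma codim_trans U W X :
  finite_codim_in U W -> finite_codim_in W X -> finite_codim_in U X.
Proof.
move=> /codimP[sW WU [s Us]] /codimP[sX XW [t Wt]]; apply/codimP; split=> //.
  exact: subset_trans WU.
by exists (s ++ t); rewrite Us Wt /adjs foldr_cat.
Qed.

Lemma codim_kernel U (f : V -> K) : is_subspace U -> scalar f ->
  finite_codim_in U (U `&` [set x | f x = 0]).
Proof.
move=> sU lf; have sk := subspaceI sU (subspace_ker lf).
apply/codimP; split=> //.
have [[v [Uv fv]]|h] := pselect (exists v, U v /\ f v != 0); last first.
  exists [::] => /=; apply/seteqP; split=> [x Ux|x [] //]; split=> //=.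
  by apply: contrapT => /eqP fx; apply: h; exists x.
exists [:: v]; apply/seteqP; split => /= [x Ux|]; last first.
  by apply: adj_min => // x [].
exists (f x / f v); split; first by apply: subsB => //; exact: subsZ.
by rewrite /= (scB lf) (scZ lf) divfK // subrr.
Qed.

(** Codimension is removed one vector at a time: if U = W + K a and some w of X
is not in W, then a can be replaced by w and X = (W ∩ X) + K w. *)
Lemma codimI U W X : finite_codim_in U W -> is_subspace X -> X `<=` U ->
  finite_codim_in X (W `&` X).
Proof.
move=> /codimP[sW WU [s ->]] {WU U}.
elim: s W X sW => [|a s IH] W X sW sX /= XU.
  by rewrite (_ : W `&` X = X); [exact: codim_refl|apply/seteqP; split=> [x []//|x Xx]; split=> //; exact: XU].
have sWs := subspace_adjs s sW.
have h1 : finite_codim_in X (adjs W s `&` X).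
  have [XW|] := pselect (X `<=` adjs W s).
    rewrite (_ : _ `&` X = X); first exact: codim_refl.
    by apply/seteqP; split=> [x []//|x Xx]; split=> //; exact: XW.
  move=> /existsNP[w /not_implyP[Xw nw]].
  apply/codimP; split; [exact: subspaceI|by move=> x []|].
  exists [:: w]; apply/seteqP; split=> [x Xx|] /=; last first.
    by apply: adj_min => // x [].
  have [c hc] := XU _ Xw; have [d hd] := XU _ Xx.
  have c0 : c != 0.
    by apply: contra_notN nw => /eqP c0; rewrite c0 scale0r subr0 in hc.
  exists (d / c); split; last by apply: subsB => //; exact: subsZ.
  rewrite (_ : _ - _ = (x - d *: a) - (d / c) *: (w - c *: a)).
    by apply: subsB => //; exact: subsZ.
  by rewrite scalerBr scalerA divfK // opprB addrA subrK.
apply: codim_trans h1 _.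
have -> : W `&` X = W `&` (adjs W s `&` X).
  by apply/seteqP; split=> x; [case=> Wx Xx; split=> //; split=> //; exact: adjs_sub|case=> ? []].
by apply: IH => //; exact: subspaceI.
Qed.

Lemma codim_inter U W X : finite_codim_in U W -> finite_codim_in U X ->
  finite_codim_in U (W `&` X).
Proof.
move=> hW hX; apply: codim_trans (hX) _.
by case/codimP: hX => sX XU _; exact: codimI hW sX XU.
Qed.

(** A polynomial in f, with list of coefficients r, applied to x. *)
Fixpoint peval (f : V -> V) (r : seq K) (x : V) : V :=
  if r is c :: r' then c *: x + f (peval f r' x) else 0.

Lemma pevalE (f : {linear V -> V}) r x :
  peval f r x = \sum_(k < size r) r`_k *: iter k f x.
Proof.
elim: r => [|c r IH] /=; first by rewrite big_ord0.
rewrite big_ord_recl /= IH linear_sum; congr (_ + _).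
by apply: eq_bigr => i _; rewrite linearZ.
Qed.

(** A matrix with more rows than columns has a nonzero left kernel. *)
Lemma dependent_mod X s (x : nat -> V) : (forall k, adjs X s (x k)) ->
  is_subspace X ->
  exists r : seq K, has (predC1 0) r /\ X (\sum_(k < size r) r`_k *: x k).
Proof.
move=> hx sX; set n := size s.
have /choice[c hc] : forall k, exists c : nat -> K,
    X (x k - \sum_(j < n) c j *: s`_j) by move=> k; exact: adjs_coef.
pose M : 'M[K]_(n.+1, n) := \matrix_(i, j) c i j.
have : kermx M != 0.
  rewrite kermx_eq0 /row_free; apply/negP => /eqP h.
  by have := rank_leq_col M; rewrite h ltnn.
case/rowV0Pn => v /sub_kermxP vM v0.
exists [seq v 0 i | i <- enum 'I_n.+1]; split.
  have [i vi] : exists i, v 0 i != 0.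
    apply: contrapT => h; move/eqP: v0; apply; apply/rowP => i.
    by rewrite mxE; apply: contrapT => /eqP vi; apply: h; exists i.
  by apply/hasP; exists (v 0 i) => //; apply: map_f; rewrite mem_enum.
rewrite size_map size_enum_ord.
under eq_bigr => i _.
  rewrite (nth_map ord0) ?size_enum_ord // nth_ord_enum.
  over.
rewrite (_ : \sum_i _ = \sum_(i < n.+1) v 0 i *: (x i - \sum_(j < n) c i j *: s`_j)).
  by apply: subs_sum => // i _; exact: subsZ.
have h0 : \sum_(i < n.+1) v 0 i *: (\sum_(j < n) c i j *: s`_j) = 0.
  under eq_bigr => i _ do rewrite scaler_sumr.
  rewrite exchange_big /=; apply: big1 => j _.
  under eq_bigr => i _ do rewrite scalerA.
  rewrite -scaler_suml; have /matrixP/(_ 0 j) := vM; rewrite !mxE => h.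
  rewrite [X in X *: _](_ : _ = 0) ?scale0r // -[RHS]h.
  by apply: eq_bigr => i _; rewrite mxE.
under [RHS]eq_bigr => i _ do rewrite scalerBr.
by rewrite sumrB h0 subr0.
Qed.

(** For x in Y the vectors x, f x, f (f x), ... are dependent modulo X, so that
q(f) x lies in X for a nonzero polynomial q. Since f is injective and the
identity on X, a factor T of q can be cancelled; once q has a nonzero constant
term the relation solves for x as a value of f on Y. *)
Lemma finitary_surj X Y (f : {linear V -> V}) : injective f ->
  is_subspace Y -> finite_codim_in Y X -> (forall x, X x -> f x = x) ->
  f @` Y `<=` Y -> f @` Y = Y.
Proof.
move=> injf sY /codimP[sX XY [s Ys]] fix_ fY; apply/seteqP; split=> // x Yx.
have hit k : Y (iter k f x) by elim: k => //= k IH; apply: fY; exists (iter k f x).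
have [||r [nz]] := @dependent_mod X s (fun k => iter k f x) => //.
  by move=> k; rewrite -Ys.
rewrite -pevalE.
have Yev r' : Y (peval f r' x).
  elim: r' => [|c r' IH] /=; first exact: subs0.
  by apply: subsD => //; [exact: subsZ|apply: fY; exists (peval f r' x)].
elim: r nz => //= c r IH; case: eqP => /= [->|/eqP c0] nz.
  rewrite scale0r add0r => h; apply: IH => //.
  by have := fix_ _ h => /injf fx; rewrite fx in h.
move=> h; exists (c^-1 *: (c *: x + f (peval f r x) - peval f r x)).
  by apply: subsZ => //; apply: subsB => //; exact: XY.
by rewrite linearZ linearB /= (fix_ _ h) addrK scalerA mulVf // scale1r.
Qed.

Lemma sum_restrict (s t : seq V) (c : V -> K) : uniq s -> uniq t ->
  {subset s <= t} ->
  \sum_(e <- t) (if e \in s then c e else 0) *: e = \sum_(e <- s) c e *: e.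
Proof.
move=> us ut st.
rewrite (eq_bigr (fun e => if e \in s then c e *: e else 0)); last first.
  by move=> e _; case: ifP => // _; rewrite scale0r.
rewrite -big_mkcond -big_filter; apply: perm_big; apply: uniq_perm => //.
  exact: filter_uniq.
by move=> e; rewrite mem_filter; case es: (e \in s) => //=; exact: st.
Qed.

Definition expands E x s (c : V -> K) :=
  [/\ uniq s, {in s, forall e, E e} & x = \sum_(e <- s) c e *: e].

Lemma expands_wide E x s c t : expands E x s c -> uniq t ->
  {in t, forall e, E e} -> {subset s <= t} ->
  x = \sum_(e <- t) (if e \in s then c e else 0) *: e.
Proof. by move=> [us sE ->] ut tE st; rewrite sum_restrict. Qed.

Lemma spanP E x : span E x <-> exists s c, expands E x s c.
Proof.
split; last first.
  case=> s [c [us sE ->]]; apply: subs_sum; first exact: subspace_span.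
  by move=> e /sE Ee; exact: subsZ (subspace_span E) (span_incl Ee).
move: x; apply: (@span_min E [set x | exists s c, expands E x s c]); last first.
  move=> e Ee; exists [:: e], (fun=> 1); split=> //.
    by move=> x; rewrite inE => /eqP->.
  by rewrite big_seq1 scale1r.
split.
- by exists [::], (fun=> 0); split=> //; rewrite big_nil.
- move=> u v [s [c h]] [t [d k]]; pose r := undup (s ++ t).
  have ur : uniq r by exact: undup_uniq.
  have rE : {in r, forall e, E e}.
    move=> e; rewrite mem_undup mem_cat => /orP[|]; first by case: h => _ + _; exact.
    by case: k => _ + _; exact.
  exists r, (fun e => (if e \in s then c e else 0) + (if e \in t then d e else 0)).
  split=> //; under eq_bigr do rewrite scalerDl.
  rewrite big_split /= -(expands_wide h) -?(expands_wide k) //.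
    by move=> e et; rewrite mem_undup mem_cat et orbT.
  by move=> e et; rewrite mem_undup mem_cat et.
- move=> a v [s [c [us sE ->]]]; exists s, (fun e => a * c e); split=> //.
  by rewrite scaler_sumr; apply: eq_bigr => e _; rewrite scalerA.
Qed.

(** When E is a basis the set below is a singleton; the coordinate is 0 for e
outside the support of x. *)
Definition coord E e x : K :=
  xget 0 [set a | exists s c, expands E x s c /\ a = if e \in s then c e else 0].

Lemma expands_inj E x s c t d e : lin_indep E -> expands E x s c ->
  expands E x t d ->
  (if e \in s then c e else 0) = (if e \in t then d e else 0).
Proof.
move=> li h k; pose r := undup (s ++ t).
have ur : uniq r by exact: undup_uniq.
have rE : {in r, forall e, E e}.
  move=> f; rewrite mem_undup mem_cat => /orP[|]; first by case: h => _ + _; exact.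
  by case: k => _ + _; exact.
have sr : {subset s <= r} by move=> f fs; rewrite mem_undup mem_cat fs.
have tr : {subset t <= r} by move=> f fs; rewrite mem_undup mem_cat fs orbT.
have [er|] := boolP (e \in r); last first.
  by rewrite mem_undup mem_cat negb_or => /andP[/negbTE-> /negbTE->].
have := li r (fun e => (if e \in s then c e else 0) - (if e \in t then d e else 0)) ur rE.
under eq_bigr do rewrite scalerBl.
rewrite sumrB -(expands_wide h) // -(expands_wide k) // subrr => /(_ erefl e er).
by move/eqP; rewrite subr_eq0 => /eqP.
Qed.

Section Coord.
Variable E : set V.
Hypothesis bE : basis_of setT E.

Lemma coordE x s c e : expands E x s c ->
  coord E e x = if e \in s then c e else 0.
Proof.
move=> h; rewrite /coord; case: xgetP => [a _ [t [d [k ->]]]|].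
  by rewrite (expands_inj _ bE.1 k h).
by move/(_ (if e \in s then c e else 0)) => /=; case; exists s, c.
Qed.

Lemma has_expand x : exists s c, expands E x s c.
Proof. by apply/spanP; rewrite bE.2. Qed.

Lemma coord_expand x : exists s, expands E x s (coord E ^~ x) /\
  (forall e, coord E e x != 0 -> e \in s).
Proof.
have [s [c h]] := has_expand x; exists s; split.
  case: (h) => us sE hx; split=> //; rewrite {1}hx.
  by apply: eq_big_seq => e es; rewrite (coordE _ h) es.
by move=> e; rewrite (coordE _ h); case: (e \in s) => //; rewrite eqxx.
Qed.

Lemma coord_scalar e : scalar (coord E e : V -> K).
Proof.
move=> a u v; have [s [c h]] := has_expand u; have [t [d k]] := has_expand v.
pose r := undup (s ++ t).
have ur : uniq r by exact: undup_uniq.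
have rE : {in r, forall e, E e}.
  move=> f; rewrite mem_undup mem_cat => /orP[|]; first by case: h => _ + _; exact.
  by case: k => _ + _; exact.
have sr : {subset s <= r} by move=> f fs; rewrite mem_undup mem_cat fs.
have tr : {subset t <= r} by move=> f fs; rewrite mem_undup mem_cat fs orbT.
rewrite (coordE e h) (coordE e k).
rewrite (@coordE _ r (fun e => a * (if e \in s then c e else 0) + (if e \in t then d e else 0))).
  case: ifPn => //; rewrite mem_undup mem_cat negb_or => /andP[/negbTE-> /negbTE->].
  by rewrite mulr0 addr0.
split=> //; under eq_bigr do rewrite scalerDl -scalerA.
by rewrite big_split /= -scaler_sumr -(expands_wide h) // -(expands_wide k).
Qed.

Lemma coord_basis e f : E f -> coord E e f = (e == f)%:R.
Proof.
move=> Ef; rewrite (@coordE f [:: f] (fun=> 1)) ?inE; first by case: (e == f).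
by split=> //; [move=> x; rewrite inE => /eqP->|rewrite big_seq1 scale1r].
Qed.

Lemma coord_span A e x : A `<=` E -> span A x -> coord E e x != 0 -> A e.
Proof.
move=> AE /spanP[s [c [us sA hx]]].
rewrite (@coordE _ s c) //; last by split=> // f /sA /AE.
by case: ifP => [/sA //|]; rewrite eqxx.
Qed.

Lemma span_coord W x : is_subspace W ->
  (forall e, E e -> coord E e x != 0 -> W e) -> W x.
Proof.
move=> sW h; have [s [[us sE ->] _]] := coord_expand x.
apply: subs_sum => // e es; have [->|/eqP c0] := pselect (coord E e x = 0).
  by rewrite scale0r; exact: subs0.
by apply: subsZ => //; apply: h => //; exact: sE.
Qed.

End Coord.

(** The coordinate along a basis vector e outside A vanishes on A. If e occurs in
none of the finitely many expansions of the vectors of s, it vanishes on s too. *)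
Lemma finite_new_basis E A s : basis_of setT E -> A `<=` E ->
  finite_set [set e | [/\ E e, ~ A e & adjs (span A) s e]].
Proof.
move=> bE AE; have /choice[t ht] := coord_expand bE.
apply: (@sub_finite_set _ _ [set` flatten (map t s)]); last exact: finite_seq.
move=> e [Ee nAe] /= he; apply: contrapT => ne.
have sk := subspace_ker (coord_scalar bE e).
have : adjs (span A) s `<=` [set x | coord E e x = 0].
  apply: adjs_min => //.
    by move=> x Ax /=; apply: contrapT => /eqP /(coord_span bE AE Ax).
  move=> x /= xs; apply: contrapT => /eqP /((ht x).2) h; apply: ne.
  by apply/flattenP; exists (t x) => //; exact: map_f.
move=> /(_ e he) /eqP /=; rewrite coord_basis // eqxx.
by rewrite oner_eq0.
Qed.

Lemma fin_span_finite E A : basis_of setT E -> A `<=` E -> fin (span A) ->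
  finite_set A.
Proof.
move=> bE AE [s hs]; apply: sub_finite_set (finite_new_basis s bE (@sub0set _ E)).
move=> e Ae; split=> //; first exact: AE.
by rewrite span0 -span_seq; apply: hs; exact: span_incl.
Qed.

Lemma span_finite_dim E A : basis_of setT E -> A `<=` E -> finite_set A ->
  finite_dim (span A).
Proof.
move=> bE AE fA; exists A => //; split=> // r c ur rA; apply: bE.1 => // e /rA.
exact: AE.
Qed.
End Subspace.

Section LinearImages.
Variables (K : fieldType) (M N : lmodType K) (f : M -> N).
Hypothesis lf : linear f.
Implicit Types (A X : set M) (u v : M).

Lemma lin0 : f 0 = 0.
Proof. by have := lf (-1) 0 0; rewrite scaler0 addr0 scaleN1r addNr. Qed.
Lemma linD u v : f (u + v) = f u + f v.
Proof. by have := lf 1 u v; rewrite !scale1r. Qed.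
Lemma linZ a u : f (a *: u) = a *: f u.
Proof. by have := lf a u 0; rewrite lin0 !addr0. Qed.
Lemma linB u v : f (u - v) = f u - f v.
Proof. by rewrite -scaleN1r linD linZ scaleN1r. Qed.

Lemma linear_im_subspace X : is_subspace X -> is_subspace (f @` X).
Proof.
move=> sX; split; first by exists 0; [exact: subs0|exact: lin0].
- by move=> _ _ [x Xx <-] [y Xy <-]; exists (x + y); [exact: subsD|exact: linD].
- by move=> a _ [x Xx <-]; exists (a *: x); [exact: subsZ|exact: linZ].
Qed.

Lemma linear_im_adj X u : f @` (adj X u) = adj (f @` X) (f u).
Proof.
apply/seteqP; split=> [_ [x [c Xc] <-]|x [c [y Xy yE]]].
  by exists c; exists (x - c *: u); rewrite // linB linZ.
exists (y + c *: u); first by exists c; rewrite addrK.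
by rewrite linD linZ yE subrK.
Qed.

Lemma linear_im_span A : f @` span A = span (f @` A).
Proof.
apply/seteqP; split.
  move=> _ [x + <-]; move: x.
  apply: (@span_min _ _ A [set x | span (f @` A) (f x)]).
    have sfA := subspace_span (f @` A).
    split=> /= [|u v|a u]; rewrite ?lin0 ?linD ?linZ; first exact: subs0.
      exact: subsD.
    exact: subsZ.
  by move=> x Ax; apply: span_incl; exists x.
apply: span_min; first exact: linear_im_subspace (subspace_span A).
by move=> _ [x Ax <-]; exists x => //; exact: (@span_incl _ _ A x Ax).
Qed.
End LinearImages.

Section Adjoin.
Variables (K : fieldType) (M : lmodType K).
Implicit Types (X : set M) (s : seq M) (u r : M).

Lemma span_rcons s u : span [set` rcons s u] = adj (span [set` s]) u.
Proof.
apply/seteqP; split.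
  apply: span_min; first exact: subspace_adj (subspace_span _).
  move=> x /=; rewrite mem_rcons inE => /orP[/eqP->|xs].
    exact: adj_in (subspace_span _).
  by apply: adj_sub; exact: span_incl.
apply: adj_min; first exact: subspace_span.
  by apply: spanS => x /= xs; rewrite mem_rcons inE xs orbT.
by apply: span_incl; rewrite /= mem_rcons inE eqxx.
Qed.

Lemma adj_eq X u r (c : K) : is_subspace X -> c != 0 -> X (u - c *: r) ->
  adj X u = adj X r.
Proof.
move=> sX c0 h; apply/seteqP; split; apply: adj_min => //;
  try exact: subspace_adj; try exact: adj_sub.
  by exists c.
exists c^-1; rewrite -opprB; apply: subsN => //.
rewrite (_ : _ - r = c^-1 *: (u - c *: r)); first exact: subsZ.
by rewrite scalerBr scalerA mulVf // scale1r.
Qed.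

Lemma linear_fix_span (f : M -> M) s : linear f -> {in s, forall x, f x = x} ->
  forall x, span [set` s] x -> f x = x.
Proof.
move=> lf h; apply: (@span_min _ _ [set` s] [set x | f x = x]) => //.
split=> /= [|u v hu hv|a u hu]; first exact: lin0.
- by rewrite linD // hu hv.
- by rewrite linZ // hu.
Qed.

Lemma seq_im_span (f : M -> M) s : linear f ->
  f @` span [set` s] = span [set` map f s].
Proof.
move=> lf; rewrite linear_im_span //; congr span; apply/seteqP; split.
  by move=> _ [x xs <-]; exact: map_f.
by move=> _ /= /mapP[x xs ->]; exists x.
Qed.
End Adjoin.

HB.instance Definition _ (K : fieldType) (V : lmodType K) (g : gl V) :=
  GRing.isLinear.Build K V V *:%R (gl_fun g) (gl_linear g).

(** * Finitary groups and stabilizers of flags *)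
Section GlAction.
Variables (K : fieldType) (V : lmodType K).
Implicit Types (g h : gl V) (X Y : set V).

Lemma glM g h x : (g * h)%g x = g (h x). Proof. by []. Qed.
Lemma glK g x : (g^-1)%g (g x) = x. Proof. exact: gl_funK. Qed.
Lemma glVK g x : g ((g^-1)%g x) = x. Proof. exact: gl_invK. Qed.
Lemma gl_inj g : injective g. Proof. exact: can_inj (gl_funK g). Qed.
Lemma im_glM g h X : (g * h)%g @` X = g @` (h @` X).
Proof.
apply/seteqP; split=> [_ [x Xx <-]|_ [_ [y Xy <-] <-]]; last by exists y.
by exists (h x) => //; exists x.
Qed.
Lemma im_gl1 X : (1%g : gl V) @` X = X.
Proof. by apply/seteqP; split=> [y [x Xx <-]//|x Xx]; exists x. Qed.
Lemma im_glK g X : (g^-1)%g @` (g @` X) = X.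
Proof. by rewrite -im_glM mulVg im_gl1. Qed.
Lemma im_glVK g X : g @` ((g^-1)%g @` X) = X.
Proof. by rewrite -im_glM mulgV im_gl1. Qed.
Lemma im_glI g X Y : g @` (X `&` Y) = g @` X `&` g @` Y.
Proof.
apply/seteqP; split=> [_ [x [Xx Yx] <-]|_ [[x Xx <-] [y Yy] /gl_inj yx]].
  by split; exists x.
by exists x => //; split=> //; rewrite -yx.
Qed.
Lemma im_glE g X x : (g @` X) (g x) <-> X x.
Proof. by split=> [[y Xy /gl_inj <-]|Xx] //; exists x. Qed.
Lemma im_glVE g X x : (g @` X) x <-> X ((g^-1)%g x).
Proof. by rewrite -{1}(glVK g x) im_glE. Qed.
Lemma subspace_im g X : is_subspace X -> is_subspace (g @` X).
Proof. exact: linear_im_subspace (gl_linear g) _. Qed.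
Lemma fin_im g X : fin X -> fin (g @` X).
Proof.
move=> [s Xs]; exists (map g s) => _ [x /Xs xs <-].
by rewrite -(seq_im_span s (gl_linear g)); exists x.
Qed.
End GlAction.

Section Group.
Variables (R : realType) (V : lmodType R[i]).
Local Notation K := (R[i]).
Implicit Types (g h k : gl V) (S : vstructure V) (X Y F : set V) (Fl : set (set V)).
Implicit Types (Vs : set (V -> K^o)) (w : {biscalar V}).

Lemma dual_actM g h (phi : V -> K^o) :
  dual_act (g * h)%g phi = dual_act g (dual_act h phi).
Proof. by []. Qed.
Lemma dual_act1 (phi : V -> K^o) : dual_act 1%g phi = phi.
Proof. by []. Qed.
Lemma dual_actVK g (phi : V -> K^o) : dual_act (g^-1)%g (dual_act g phi) = phi.
Proof. by rewrite -dual_actM mulVg dual_act1. Qed.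

Lemma GL_inftyM Vs g h : GL_infty Vs g -> GL_infty Vs h -> GL_infty Vs (g * h)%g.
Proof.
move=> [g1 [W hW fW] [Z hZ fZ]] [h1 [W' hW' fW'] [Z' hZ' fZ']]; split.
- apply/seteqP; split=> [_ [phi Vphi <-]|phi].
    rewrite dual_actM -g1; exists (dual_act h phi) => //.
    by rewrite -h1; exists phi.
  rewrite -{1}g1 => -[psi]; rewrite -{1}h1 => -[chi Vchi <-] <-.
  by exists chi.
- exists (W `&` W'); first exact: codim_inter.
  by move=> v [Wv W'v]; rewrite glM fW' ?fW.
- exists (Z `&` Z'); first exact: codim_inter.
  by move=> v [Wv W'v]; rewrite dual_actM fZ' ?fZ.
Qed.

Lemma GL_inftyV Vs g : GL_infty Vs g -> GL_infty Vs (g^-1)%g.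
Proof.
move=> [g1 [W hW fW] [Z hZ fZ]]; split.
- apply/seteqP; split=> [_ [phi + <-]|phi Vphi].
    by rewrite -{1}g1 => -[psi Vpsi <-]; rewrite dual_actVK.
  exists (dual_act g phi); last by rewrite dual_actVK.
  by rewrite -g1; exists phi.
- by exists W => // v /fW gv; rewrite -{1}gv glK.
- by exists Z => // v /fZ gv; rewrite -{1}gv dual_actVK.
Qed.

Lemma GL_infty1 Vs : is_subspace Vs -> GL_infty Vs 1%g.
Proof.
move=> sV; split.
- by apply/seteqP; split=> [_ [phi Vp <-]//|phi Vp]; exists phi.
- by exists setT => //; exact: codim_refl.
- by exists Vs => //; exact: codim_refl.
Qed.

Lemma ind_group_GL S g : ind_group S g -> GL_infty (V_star S) g.
Proof. by case: S => [Vs|w|w] // []. Qed.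

Lemma ind_groupM S g h : ind_group S g -> ind_group S h -> ind_group S (g * h)%g.
Proof.
case: S => [Vs|w|w]; rewrite /ind_group /=; first exact: GL_inftyM.
- move=> [g1 g2] [h1 h2]; split; first exact: GL_inftyM.
  by move=> u v; rewrite !glM g2 h2.
- move=> [g1 g2] [h1 h2]; split; first exact: GL_inftyM.
  by move=> u v; rewrite !glM g2 h2.
Qed.

Lemma ind_groupV S g : ind_group S g -> ind_group S (g^-1)%g.
Proof.
case: S => [Vs|w|w]; rewrite /ind_group /=; first exact: GL_inftyV.
- move=> [g1 g2]; split; first exact: GL_inftyV.
  by move=> u v; rewrite -g2 !glVK.
- move=> [g1 g2]; split; first exact: GL_inftyV.
  by move=> u v; rewrite -g2 !glVK.
Qed.

Lemma V_star_subspace S : valid_structure S -> is_subspace (V_star S).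
Proof.
have h w : is_subspace [set phi : V -> K^o | exists v, phi = w v].
  split=> [|_ _ [u ->] [v ->]|a _ [u ->]].
  - by exists 0; apply/funext => x; rewrite linear0l.
  - by exists (u + v); apply/funext => x; rewrite linearDl.
  - by exists (a *: u); apply/funext => x; rewrite linearZl_LR.
by case: S => [Vs|w|w]; [case|move=> _; exact: h|move=> _; exact: h].
Qed.

Lemma V_star_scalar S (phi : V -> K) : valid_structure S -> V_star S phi -> scalar phi.
Proof.
case: S => [Vs|w|w] /=; first by case=> _ h _ _ /h.
- by move=> _ [v ->] a x y; rewrite linearPr.
- by move=> _ [v ->] a x y; rewrite linearPr.
Qed.

Lemma ind_group1 S : valid_structure S -> ind_group S 1%g.
Proof.
move=> /V_star_subspace sV; have := GL_infty1 sV.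
by case: S {sV} => [Vs|w|w] //= h; split.
Qed.

(** The inverse is id - psi a / (1 + psi a), and the map induced on V_star is
again a transvection, so a subspace of codimension at most one is fixed in both. *)
Lemma transvection S a (psi : V -> K) : valid_structure S -> V_star S psi ->
  1 + psi a != 0 ->
  exists2 g, GL_infty (V_star S) g & forall x, g x = x + psi x *: a.
Proof.
move=> vS Vpsi c0; have lp := V_star_scalar vS Vpsi.
have sV := V_star_subspace vS.
pose c := 1 + psi a.
pose f x := x + psi x *: a; pose f' x := x - (psi x / c) *: a.
have lf : linear f.
  by move=> b u v; rewrite /f lp scalerDl -scalerA scalerDr addrACA.
have fK : cancel f f'.
  move=> x; rewrite /f' /f (scD lp) (scZ lp) -addrA -scalerBl.
  by rewrite (_ : _ - _ = 0) ?scale0r ?addr0 //; rewrite /c; field; exact: c0.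
have f'K : cancel f' f.
  move=> x; rewrite /f' /f (scB lp) (scZ lp) -addrA -scaleNr -scalerDl.
  by rewrite (_ : - (psi x / c) + _ = 0) ?scale0r ?addr0 //; rewrite /c; field; exact: c0.
pose g := GL lf fK f'K.
have dE (phi : V -> K) x : scalar phi ->
    dual_act g phi x = phi x - phi a * (psi x / c).
  by move=> l; rewrite /dual_act /= /f' (scB l) (scZ l) mulrC.
exists g => //; split.
- apply/seteqP; split=> [_ [phi Vphi <-]|phi Vphi].
    have -> : dual_act g phi = phi - (phi a / c) *: (psi : V -> K^o).
      apply/funext => x; rewrite (dE phi); last exact: V_star_scalar vS Vphi.
      by rewrite mulrA (mulrAC (phi a) (psi x) c^-1).
    by apply: (subsB sV) => //; exact: (subsZ _ sV).
  exists ((phi : V -> K^o) + phi a *: (psi : V -> K^o)).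
    by apply: (subsD sV) => //; exact: (subsZ _ sV).
  apply/funext => x; rewrite dE; last first.
    by apply: (V_star_scalar vS); apply: (subsD sV) => //; exact: (subsZ _ sV).
  rewrite [LHS](_ : _ = phi x + phi a * psi x - (phi a + phi a * psi a) * (psi x / c)) //.
  by rewrite /c; field; exact: c0.
- exists (setT `&` [set x | psi x = 0]).
    by apply: codim_kernel => //; exact: subspaceT.
  by move=> v [_ /= h]; rewrite /f h scale0r addr0.
- exists (V_star S `&` [set phi | phi a = 0]).
    exact: codim_kernel.
  move=> phi [Vphi /= h]; apply/funext => x.
  by rewrite dE ?h ?mul0r ?subr0 //; exact: V_star_scalar vS Vphi.
Qed.

(** A part of finite codimension of Y is fixed pointwise, whence rigidity. *)
Lemma GL_im_sub S g Y : GL_infty (V_star S) g -> is_subspace Y ->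
  g @` Y `<=` Y -> g @` Y = Y.
Proof.
move=> [_ [W hW fW] _] sY; apply: (@finitary_surj _ _ (W `&` Y)) => //.
- exact: gl_inj.
- exact: codimI hW sY _.
- by move=> x [/fW].
Qed.

Lemma GL_im_sup S g Y : GL_infty (V_star S) g -> is_subspace Y ->
  Y `<=` g @` Y -> g @` Y = Y.
Proof.
move=> hg sY h; rewrite -[RHS](im_glVK g); congr (_ @` _); apply/esym.
apply: (GL_im_sub (GL_inftyV hg)) => //.
by rewrite -[X in _ `<=` X](im_glK g) => _ [x /h Yx <-]; exists x.
Qed.

Definition chain Fl :=
  forall F1 F2 : set V, Fl F1 -> Fl F2 -> F1 `<=` F2 \/ F2 `<=` F1.

(** Members of a flag are comparable, so an element permuting them nontrivially
would move some member to a strictly larger or smaller one. *)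
Lemma stabilizerP S Fl g : generalized_flag S Fl ->
  stabilizer S Fl g <-> ind_group S g /\ forall F, Fl F -> g @` F = F.
Proof.
move=> [sF cF _ _ _]; split; last first.
  move=> [Gg gF]; split=> //; apply/seteqP; split=> [_ [F FF <-]|F FF] /=.
    by rewrite gF.
  by exists F => //; exact: gF.
move=> [Gg gFl]; split=> // F FF.
have FgF : Fl (g @` F) by rewrite -gFl; exists F.
have hg := ind_group_GL Gg.
have [h|h] := cF _ _ FF FgF; first by apply: (GL_im_sup hg) => //; exact: sF.
by apply: (GL_im_sub hg) => //; exact: sF.
Qed.

Lemma stabilizer_in S Fl g : generalized_flag S Fl -> ind_group S g ->
  (forall F x, Fl F -> F x -> F (g x)) -> stabilizer S Fl g.
Proof.
move=> gF Gg h; apply/stabilizerP => //; split=> // F FF.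
apply: (GL_im_sub (ind_group_GL Gg)); first by case: gF => + _ _ _ _; exact.
by move=> _ [x Fx <-]; exact: h.
Qed.

Lemma stabilizerM S Fl g h : generalized_flag S Fl ->
  stabilizer S Fl g -> stabilizer S Fl h -> stabilizer S Fl (g * h)%g.
Proof.
move=> gF /(stabilizerP _ gF)[g1 g2] /(stabilizerP _ gF)[h1 h2].
apply/stabilizerP => //; split; first exact: ind_groupM.
by move=> F FF; rewrite im_glM h2 ?g2.
Qed.

Lemma stabilizerV S Fl g : generalized_flag S Fl ->
  stabilizer S Fl g -> stabilizer S Fl (g^-1)%g.
Proof.
move=> gF /(stabilizerP _ gF)[g1 g2].
apply/stabilizerP => //; split; first exact: ind_groupV.
by move=> F FF; rewrite -{1}(g2 F FF) im_glK.
Qed.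

Lemma stabilizer1 S Fl : valid_structure S -> generalized_flag S Fl ->
  stabilizer S Fl 1%g.
Proof.
move=> vS gF; apply/stabilizerP => //; split; first exact: ind_group1.
by move=> F _; rewrite im_gl1.
Qed.
End Group.

(** * Orbits and double cosets *)
Section DoubleCosets.
Variable T : groupType.
Implicit Types (G P : set T) (g h : T).

Lemma translateM g h P : translate g (translate h P) = translate (g * h)%g P.
Proof.
apply/seteqP; split=> [_ [_ [x Px <-] <-]|_ [x Px <-]] /=.
  by exists x => //; rewrite mulgA.
by exists (h * x)%g; [exists x|rewrite mulgA].
Qed.
Lemma translate1 P : translate 1%g P = P.
Proof.
by apply/seteqP; split=> [_ [x Px <-]|x Px]; [rewrite mul1g|exists x; rewrite ?mul1g].
Qed.

Record subgrp G : Prop := Subgrp {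
  sg1 : G 1%g; sgM : forall g h, G g -> G h -> G (g * h)%g;
  sgV : forall g, G g -> G (g^-1)%g }.

Lemma translate_id P g : subgrp P -> P g -> translate g P = P.
Proof.
move=> sP Pg; apply/seteqP; split=> [_ [x Px <-]|x Px]; first exact: sgM.
exists (g^-1 * x)%g; last by rewrite mulVKg.
by apply: sgM => //; exact: sgV.
Qed.

Lemma translate_mem P g h : subgrp P -> translate g P = translate h P ->
  exists2 p, P p & g = (h * p)%g.
Proof.
move=> sP e; have : translate g P g by exists 1%g; [exact: sg1|rewrite mulg1].
by rewrite e => -[p Pp <-]; exists p.
Qed.

(** Two of the pairs (P1, f i P2) lie in one orbit, and the element relating them
stabilizes the coset P1. *)
Lemma finite_orbits_pigeonhole G P1 P2 (I : Type) (J : set I) (f : I -> T) :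
  subgrp G -> subgrp P1 -> subgrp P2 ->
  (forall i, J i -> G (f i)) -> infinite_set J ->
  finite_set (diag_orbits G P1 P2) ->
  exists i j h p, [/\ J i, J j, i <> j, P1 h & P2 p /\ (h * f i = f j * p)%g].
Proof.
move=> sG s1 s2 Gf Jinf fin; apply: contrapT => hno; apply: Jinf.
pose o i := diag_orbit G (P1, translate (f i) P2).
have oJ : o @` J `<=` diag_orbits G P1 P2.
  move=> _ [i Ji <-]; exists (P1, translate (f i) P2) => //; split=> /=.
    by exists 1%g; [exact: sg1|exact: translate1].
  by exists (f i) => //; exact: Gf.
have oi : {in J &, injective o}.
  move=> i j; rewrite !inE => Ji Jj oij; apply: contrapT => nij; apply: hno.
  have : o i (P1, translate (f i) P2).
    by exists 1%g; [exact: sg1|rewrite /= !translate1].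
  rewrite oij => -[h Gh [/= h1 h2]].
  have [k Pk] : exists2 p, P1 p & h = p.
    by have := @translate_mem P1 h 1%g s1; rewrite translate1 => /(_ h1)[p Pp ->]; exists p; rewrite ?mul1g.
  move=> ?; subst k; rewrite translateM in h2.
  have [p Pp hp] := translate_mem s2 h2.
  by exists j, i, h, p; split=> //; exact/nesym.
by have := sub_finite_set oJ fin; rewrite (eq_finite_set (inj_card_eq oi)).
Qed.

(** The orbit of (g1 P1, g2 P2) depends only on the double coset of g1^-1 g2. *)
Lemma finite_orbits_intro G P1 P2 (N : set T) : subgrp G -> subgrp P1 ->
  subgrp P2 -> N `<=` G -> P1 `<=` G -> finite_set N ->
  (forall g, G g -> exists p n q, [/\ P1 p, N n, P2 q & g = (p * n * q)%g]) ->
  finite_set (diag_orbits G P1 P2).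
Proof.
move=> sG s1 s2 NG P1G fN h.
apply: (@sub_finite_set _ _ ((fun n => diag_orbit G (P1, translate n P2)) @` N)); last first.
  exact: finite_image.
move=> _ [[_ _] [/= [g1 G1 <-] [g2 G2 <-]] <-].
have [p [n [q [Pp Nn Qq gE]]]] := h (g1^-1 * g2)%g (sgM sG (sgV sG G1) G2).
exists n => //.
have e1 : translate g1 P1 = translate (g1 * p)%g P1.
  by rewrite -translateM (translate_id s1 Pp).
have e2 : translate g2 P2 = translate (g1 * p * n)%g P2.
  have -> : g2 = (g1 * p * n * q)%g by rewrite -!mulgA (mulgA p) -gE mulVKg.
  by rewrite -translateM (translate_id s2 Qq).
have Gk : G (g1 * p)%g by apply: sgM => //; exact: P1G.
rewrite e1 e2; move: (g1 * p)%g Gk => l Gl.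
apply/seteqP; split=> [_ [k Hk <-]|_ [k Hk <-]] /=.
  exists (k * l^-1)%g; first by apply: sgM => //; exact: sgV.
  by rewrite /= !translateM mulgVK !mulgA mulgVK.
exists (k * l)%g; first exact: sgM.
by rewrite /= !translateM !mulgA.
Qed.

Lemma finite_orbits_sym G P1 P2 :
  finite_set (diag_orbits G P1 P2) -> finite_set (diag_orbits G P2 P1).
Proof.
pose sw (x : set T * set T) := (x.2, x.1).
move=> /(finite_image (fun O => sw @` O)); apply: sub_finite_set.
move=> _ [[a b] [/= ha hb] <-].
exists (diag_orbit G (b, a)); first by exists (b, a).
apply/seteqP; split=> [_ [_ [g Gg <-] <-]|_ [g Gg <-]]; first by exists g.
by exists (translate g b, translate g a) => //; exists g.
Qed.
End DoubleCosets.

(** * Closed subspaces and exchanges *)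
Section Forms.
Variables (R : realType) (V : lmodType R[i]).
Local Notation K := (R[i]).
Implicit Types (g h k : gl V) (S : vstructure V) (A C E X Y F : set V) (Fl : set (set V)).
Implicit Types (w : {biscalar V}) (psi : V -> K) (u v x y : V).

Lemma wDl w u v x : w (u + v) x = w u x + w v x. Proof. exact: linearDl. Qed.
Lemma wDr w x u v : w x (u + v) = w x u + w x v. Proof. exact: linearDr. Qed.
Lemma wBl w u v x : w (u - v) x = w u x - w v x. Proof. exact: linearBl. Qed.
Lemma wBr w x u v : w x (u - v) = w x u - w x v. Proof. exact: linearBr. Qed.
Lemma wZl w a u x : w (a *: u) x = a * w u x. Proof. exact: linearZl_LR. Qed.
Lemma wZr w a x u : w x (a *: u) = a * w x u. Proof. exact: linearZr_LR. Qed.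
Lemma w0l w x : w 0 x = 0. Proof. exact: linear0l. Qed.
Lemma w0r w x : w x 0 = 0. Proof. exact: linear0r. Qed.
Definition form_linE := (wBl, wBr, wDl, wDr, wZl, wZr, w0l, w0r).

Lemma form_scalar w u : scalar (w u). Proof. by move=> a x y; rewrite !form_linE. Qed.

(** Symmetric and alternating forms are treated together; only the sign differs. *)
Definition eps_form w (eps : K) :=
  (eps = 1 \/ eps = -1) /\ forall u v, w u v = eps * w v u.

Lemma valid_eps S w : valid_structure S -> form_of S = Some w ->
  (exists eps, eps_form w eps) /\ nondegenerate_form w.
Proof.
case: S => [Vs|w'|w'] //= [h1 h2] [<-]; split=> //.
  by exists 1; split; [left|move=> u v; rewrite mul1r].
exists (-1); split; first by right.
move=> u v; have := h1 (u + v); rewrite !form_linE !h1 add0r addr0 mulN1r.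
by move/eqP; rewrite addr_eq0 => /eqP.
Qed.

Lemma V_star_form S w : form_of S = Some w ->
  V_star S = [set phi | exists v, phi = w v].
Proof. by case: S => [Vs|w'|w'] //= [<-]. Qed.

Lemma ind_group_form S w g : form_of S = Some w ->
  ind_group S g <-> GL_infty (V_star S) g /\ preserves_form w g.
Proof. by move=> hw; rewrite /ind_group hw. Qed.

Lemma ind_group_typeA S g : form_of S = None ->
  ind_group S g <-> GL_infty (V_star S) g.
Proof. by move=> hw; rewrite /ind_group hw. Qed.

Lemma eps_neq0 w eps : eps_form w eps -> eps != 0.
Proof. by move=> [[->|->] _]; rewrite ?oppr_eq0 oner_eq0. Qed.

Lemma eps_sqr w eps : eps_form w eps -> eps * eps = 1.
Proof. by move=> [[->|->] _]; rewrite ?mulrNN mulr1. Qed.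

Lemma orthC w eps u v : eps_form w eps -> w u v = 0 -> w v u = 0.
Proof. by move=> [_ h] uv; rewrite h uv mulr0. Qed.

Lemma subspace_perp w F : is_subspace (perp w F).
Proof.
split=> [u _|x y hx hy u Fu|a x hx u Fu]; first by rewrite w0r.
- by rewrite wDr hx ?hy ?addr0.
- by rewrite wZr hx ?mulr0.
Qed.

Lemma perpS w F X : F `<=` X -> perp w X `<=` perp w F.
Proof. by move=> FX x hx u /FX; exact: hx. Qed.

(** Subspaces cut out by functionals of V_star. Members of a flag with a compatible
basis are closed, but the sum of two closed subspaces need not be. *)
Definition closed S C : Prop := is_subspace C /\
  forall x, ~ C x -> exists phi : V -> K,
    [/\ V_star S phi, forall c, C c -> phi c = 0 & phi x = 1].

Lemma closedI S C F : closed S C -> closed S F -> closed S (C `&` F).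
Proof.
move=> [sC hC] [sF hF]; split; first exact: subspaceI.
move=> x /not_andP[/hC|/hF] [phi [Vp p0 px]]; exists phi; split=> // c [].
- by move=> + _; exact: p0.
- by move=> _; exact: p0.
Qed.

(** The functionals of V_star vanishing on C separate the points of V / C, hence
induce all linear functionals on the plane spanned there by v and u. *)
Lemma closed_separate2 S C v u : valid_structure S -> closed S C ->
  ~ C v -> ~ adj C v u -> exists psi, [/\ V_star S psi,
    forall c, C c -> psi c = 0, psi v = 1 & psi u = 1].
Proof.
move=> vS [sC hC] /hC[p [Vp p0 pv]] nu.
have : ~ C (u - p u *: v) by move=> h; apply: nu; exists (p u).
move=> /hC[q [Vq q0 qu]].
have lq := V_star_scalar vS Vq; have lp := V_star_scalar vS Vp.
rewrite (scB lq) (scZ lq) in qu.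
have sV := V_star_subspace vS.
pose b := 1 - p u; pose a := 1 - b * q v.
exists (a *: (p : V -> K^o) + b *: (q : V -> K^o)); split.
- by apply: (subsD sV); exact: (subsZ _ sV).
- by move=> c Cc; rewrite [LHS](_ : _ = a * p c + b * q c) // p0 // q0 // !mulr0 addr0.
- rewrite [LHS](_ : _ = a * p v + b * q v) // pv /a; ring.
- rewrite [LHS](_ : _ = a * p u + b * q u) // -[q u](subrK (p u * q v)) qu /a /b; ring.
Qed.

Lemma scalar_ext E psi phi : span E = setT -> scalar psi -> scalar phi ->
  (forall e, E e -> psi e = phi e) -> psi = phi.
Proof.
move=> sE lp lq h; apply/funext => x.
have : span E x by rewrite sE.
move: x; apply: (@span_min _ _ E [set x | psi x = phi x]) => //.
split=> /= [|u v hu hv|a u hu]; first by rewrite !sc0.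
- by rewrite !scD // hu hv.
- by rewrite !scZ // hu.
Qed.

Lemma coord_form E w (i : V -> V) e : basis_of setT E ->
  (forall e, E e -> E (i e) /\ i (i e) = e) ->
  (forall e e', E e -> E e' -> (w e e' <> 0 <-> e' = i e)) -> E e ->
  coord E e = w ((w (i e) e)^-1 *: i e).
Proof.
move=> bE iE wi Ee; have [Eie iie] := iE e Ee.
apply: (scalar_ext bE.2); [exact: coord_scalar|exact: form_scalar|].
move=> f Ef; rewrite coord_basis // wZl; case: eqP => [<-|ef].
  by rewrite mulVf //; apply/eqP; apply/wi.
rewrite [w (i e) f](_ : _ = 0) ?mulr0 //.
by apply: contrapT => /(wi _ _ Eie Ef) fe; apply: ef; rewrite fe iie.
Qed.

Lemma coord_V_star S E e : valid_structure S -> admissible S E -> E e ->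
  V_star S (coord E e).
Proof.
move=> vS [bE]; case hw : (form_of S) => [w|] h Ee.
  have [i [iE _ wi]] := h; rewrite (V_star_form hw).
  by eexists; exact: (coord_form bE iE wi).
rewrite -h; apply: span_incl; split; first exact: coord_scalar.
by exists e => // e' Ee'; exact: coord_basis.
Qed.

(** A vector outside the span of A has a nonzero coordinate along some basis
vector outside A. *)
Lemma closed_span S E A : valid_structure S -> admissible S E -> A `<=` E ->
  closed S (span A).
Proof.
move=> vS aE AE; split; first exact: subspace_span.
move=> x nx; have bE := aE.1.
have [e [Ee cx Ae]] : exists e, [/\ E e, coord E e x != 0 & ~ A e].
  apply: contrapT => h; apply: nx; apply: (span_coord bE); first exact: subspace_span.
  move=> e Ee cx; apply: contrapT => nAe; apply: h; exists e; split=> // Ae.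
  by apply: nAe; exact: span_incl.
exists ((coord E e x)^-1 *: (coord E e : V -> K^o)); split.
- by apply: (subsZ _ (V_star_subspace vS)); exact: coord_V_star.
- move=> c hc; rewrite [LHS](_ : _ = (coord E e x)^-1 * coord E e c) //.
  rewrite [coord E e c](_ : _ = 0) ?mulr0 //.
  by apply: contrapT => /eqP /(coord_span bE AE hc).
- by rewrite [LHS](_ : _ = (coord E e x)^-1 * coord E e x) // mulVf.
Qed.

Lemma closed_flag S E Fl F : valid_structure S -> admissible S E ->
  compatible E Fl -> Fl F -> closed S F.
Proof. by move=> vS aE cE /cE[A AE ->]; exact: closed_span vS aE AE. Qed.

(** The element g trades the vector v of F for u and keeps a hyperplane of F
containing C. The value psi u = 1 makes it possible to compare sizes later by a
transvection with the same psi. *)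
Definition exchange S F C v u := exists g psi,
  [/\ ind_group S g, V_star S psi, g @` F = adj (F `&` [set x | psi x = 0]) u,
      forall x, C x -> psi x = 0 & psi v = 1 /\ psi u = 1].

Lemma transvection_image S g psi F v u : V_star S psi -> valid_structure S ->
  is_subspace F -> F v -> psi v = 1 ->
  (forall x, F x -> g x = x + psi x *: (u - v)) ->
  g @` F = adj (F `&` [set x | psi x = 0]) u.
Proof.
move=> Vp vS sF Fv pv gE; have lp := V_star_scalar vS Vp.
apply/seteqP; split=> [_ [x Fx <-]|y [c [Fy /= py]]].
  exists (psi x); rewrite gE // scalerBr addrA addrAC addrK; split=> /=.
    by apply: subsB => //; exact: subsZ.
  by rewrite (scB lp) (scZ lp) pv mulr1 subrr.
exists (y - c *: u + c *: v); first by apply: subsD => //; exact: subsZ.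
rewrite gE; last by apply: subsD => //; exact: subsZ.
rewrite (scD lp) py add0r (scZ lp) pv mulr1 scalerBr addrA.
by rewrite -(addrA (y - _)) (addrC (c *: v)) addrA subrK addrK.
Qed.

Lemma exchange_typeA S F C v u : valid_structure S -> form_of S = None ->
  is_subspace F -> closed S C -> C `<=` F -> F v -> ~ C v -> ~ F u ->
  exchange S F C v u.
Proof.
move=> vS hw sF cC CF Fv nCv nFu.
have nu : ~ adj C v u by move=> /(adj_min sF CF Fv).
have [psi [Vp p0 pv pu]] := closed_separate2 vS cC nCv nu.
have lp := V_star_scalar vS Vp.
have [|g Gg gE] := @transvection _ _ S (u - v) psi vS Vp.
  by rewrite (scB lp) pv pu subrr addr0 oner_eq0.
exists g, psi; split=> //; first exact/ind_group_typeA.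
exact: (transvection_image Vp vS sF Fv pv).
Qed.

Definition isotropic w F := forall x y, F x -> F y -> w x y = 0.

(** The reflection, or symplectic transvection, along u - v that maps v to u. *)
Lemma form_swap S w v u : valid_structure S -> form_of S = Some w ->
  w v v = 0 -> w u u = 0 -> w u v != 0 ->
  exists g psi, [/\ ind_group S g, V_star S psi,
    forall x, psi x = w x (u - v) / w v u
    & forall x, g x = x + psi x *: (u - v)].
Proof.
move=> vS hw vv uu uv.
have [[eps heps] _] := valid_eps vS hw; have symw := heps.2.
have e0 := eps_neq0 heps; have ee := eps_sqr heps.
pose c := w v u; have c0 : c != 0.
  by apply: contra_neq uv => c0; rewrite symw -/c c0 mulr0.
have uvE : w u v = eps * c by rewrite symw.
pose a := u - v; pose b := (eps / c) *: a.
have bE x : w b x = w x a / c.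
  by rewrite wZl symw mulrAC mulrA ee mul1r.
have waa : w a a = - (1 + eps) * c.
  by rewrite /a !form_linE uu vv uvE -/c; ring.
have Vb : V_star S (w b) by rewrite (V_star_form hw); exists b.
have [|g Gg gE] := @transvection _ _ S a (w b) vS Vb.
  rewrite bE waa mulfK // (_ : 1 + _ = - eps) ?oppr_eq0 //; ring.
exists g, (w b); split=> //.
clearbody b a c.
apply/(ind_group_form _ hw); split=> // x y; rewrite !gE !bE !form_linE waa.
rewrite (symw a y).
by field.
Qed.

(** F ∩ u^perp is the only hyperplane of F which, together with u, spans an
isotropic subspace. *)
Lemma form_step S w F v u : valid_structure S -> form_of S = Some w ->
  is_subspace F -> isotropic w F -> F v -> w u u = 0 -> w u v != 0 ->
  exists2 g, ind_group S g & g @` F = adj (F `&` [set x | w u x = 0]) u.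
Proof.
move=> vS hw sF iF Fv uu uv.
have [[eps heps] _] := valid_eps vS hw.
have c0 : w v u != 0 by apply: contra_neq uv => c0; exact: orthC heps c0.
have [g [psi [Gg Vp pE gE]]] := form_swap vS hw (iF v v Fv Fv) uu uv.
have pF x : F x -> psi x = w x u / w v u.
  by move=> Fx; rewrite pE wBr (iF x v) // subr0.
exists g => //; rewrite (@transvection_image S g psi F v u) //; last first.
  by rewrite pF // divff.
congr adj; apply/seteqP; split=> x [Fx /= hx]; split=> //=.
  move: hx; rewrite pF // => /eqP; rewrite mulf_eq0 invr_eq0 (negbTE c0) orbF.
  by move=> /eqP /(orthC heps).
by rewrite pF // (orthC heps hx) mul0r.
Qed.

Lemma isotropic_im S w g F : form_of S = Some w -> ind_group S g ->
  isotropic w F -> isotropic w (g @` F).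
Proof.
by move=> hw /(ind_group_form _ hw)[_ pg] iF _ _ [x Fx <-] [y Fy <-]; rewrite pg iF.
Qed.

(** For a symmetric form w takes at u - c v a value that is affine in c with slope
- 2 w u v, so it vanishes for one c; for an alternating form c = 0 will do. *)
Lemma make_isotropic w eps u v : eps_form w eps -> w v v = 0 -> w u v != 0 ->
  exists c, w (u - c *: v) (u - c *: v) = 0.
Proof.
move=> [he symw] vv uv.

case: he => he; subst eps.
  exists (w u u / (2 * w u v)); rewrite !form_linE vv (symw v u).
  by field.
exists 0; rewrite scale0r subr0.
have /eqP := symw u u; rewrite mulN1r -subr_eq0 opprK -mulr2n.
by rewrite mulrn_eq0 => /eqP.
Qed.

(** If u is not orthogonal to v, one swap suffices, and psi is corrected by a
functional vanishing on F. If u is orthogonal to F, the vector v is first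
exchanged for an auxiliary isotropic z, orthogonal to C but neither to v nor to
u, and then z for u; what remains of F is F ∩ z^perp. *)
Lemma exchange_form S w F C v u : valid_structure S -> form_of S = Some w ->
  isotropic w F -> closed S F -> closed S C -> C `<=` F -> F v -> ~ C v ->
  ~ F u -> w u u = 0 -> (forall x, C x -> w u x = 0) ->
  (forall x, F x -> w u x = 0) \/ w u v != 0 ->
  exchange S F C v u.
Proof.
move=> vS hw iF cF cC CF Fv nCv nFu uu uC; have sF := cF.1.
have [[eps heps] _] := valid_eps vS hw.
have sV := V_star_subspace vS.
have [uv _|/negPn/eqP uv] := boolP (w u v != 0).
  have [g Gg gF] := form_step vS hw sF iF Fv uu uv.
  have [th [Vth th0 thu]] := cF.2 u nFu.
  (* th vanishes on F and only serves to make psi u equal to 1. *)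
  pose psi : V -> K := w ((w u v)^-1 *: u) + (th : V -> K^o).
  have pE x : psi x = (w u v)^-1 * w u x + th x by rewrite -wZl.
  exists g, psi; split=> //.
  - apply: (subsD sV) => //; rewrite (V_star_form hw).
    by exists ((w u v)^-1 *: u).
  - rewrite gF; congr adj; apply/seteqP; split=> x [Fx /= hx]; split=> //=.
      by rewrite pE hx mulr0 th0 // addr0.
    move: hx; rewrite pE th0 // addr0 => /eqP.
    by rewrite mulf_eq0 invr_eq0 (negbTE uv) => /eqP.
  - by move=> x Cx; rewrite pE (uC x) // mulr0 th0 ?addr0 //; exact: CF.
  - by rewrite !pE uu mulVf // th0 // thu mulr0 addr0 add0r.
case=> [uF|//].
have nu : ~ adj C v u by move=> /(adj_min sF CF Fv).
have [psi [Vp p0 pv pu]] := closed_separate2 vS cC nCv nu.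
move: Vp; rewrite (V_star_form hw) => -[z0 pE]; subst psi.
have [|c] := make_isotropic heps (iF v v Fv Fv) (u := z0).
  by rewrite pv oner_eq0.
set z := z0 - _ => zz.
have zF x : F x -> w z x = w z0 x.
  by move=> Fx; rewrite wBl wZl (iF v x) // mulr0 subr0.
have zu : w z u = 1 by rewrite wBl wZl (orthC heps uv) mulr0 subr0.
have [|g Gg gF] := form_step vS hw sF iF Fv zz.
  by rewrite zF // pv oner_eq0.
set F1 := g @` F in gF.
have [||||k Gk kF] := @form_step S w F1 z u vS hw _ _ _ uu.
- exact: subspace_im.
- exact: isotropic_im hw Gg iF.
- by rewrite gF; apply: adj_in; apply: subspaceI => //; exact: subspace_ker (form_scalar w z).
- by rewrite heps.2 zu mulr1; exact: eps_neq0 heps.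
exists (k * g)%g, (w z); split.
- exact: ind_groupM.
- by rewrite (V_star_form hw); exists z.
- rewrite im_glM -/F1 kF; congr adj; apply/seteqP; split=> x.
    rewrite gF => -[[d [Fx /= zx]] /= ux].
    have d0 : d = 0.
      have : w u (x - d *: z) = 0 by exact: uF.
      rewrite wBr ux wZr heps.2 zu mulr1 sub0r => /eqP.
      by rewrite oppr_eq0 mulf_eq0 (negbTE (eps_neq0 heps)) orbF => /eqP.
    by move: Fx zx; rewrite d0 scale0r subr0.
  move=> [Fx /= zx]; split=> /=; last exact: uF.
  by rewrite gF; apply: adj_sub.
- by move=> x Cx; rewrite zF ?p0 //; exact: CF.
- by rewrite zF // pv zu.
Qed.
End Forms.

(** * Members of infinite dimension and codimension *)
Section InfiniteOrbits.
Variables (R : realType) (V : lmodType R[i]).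
Local Notation K := (R[i]).
Implicit Types (g h k : gl V) (S : vstructure V) (A C E X Y F : set V) (Fl : set (set V)).
Implicit Types (w : {biscalar V}) (psi : V -> K) (u v x y : V).

Lemma subgrp_ind S : valid_structure S -> subgrp (ind_group S).
Proof.
by move=> vS; split; [exact: ind_group1|exact: ind_groupM|exact: ind_groupV].
Qed.
Lemma subgrp_stab S Fl : valid_structure S -> generalized_flag S Fl ->
  subgrp (stabilizer S Fl).
Proof.
move=> vS gF; split; first exact: stabilizer1.
- by move=> g h; exact: stabilizerM.
- by move=> g; exact: stabilizerV.
Qed.

Lemma pigeonhole_flags S Fl1 Fl2 (I : Type) (J : set I) (f : I -> gl V) :
  valid_structure S -> generalized_flag S Fl1 -> generalized_flag S Fl2 ->
  (forall i, J i -> ind_group S (f i)) -> infinite_set J ->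
  finite_set (diag_orbits (ind_group S) (stabilizer S Fl1) (stabilizer S Fl2)) ->
  exists i j h, [/\ J i, J j, i <> j, ind_group S h &
    forall F1 F2, Fl1 F1 -> Fl2 F2 ->
      h @` (f i @` F2 `&` F1) = f j @` F2 `&` F1].
Proof.
move=> vS gf1 gf2 Gf Jinf fin.
have [i [j [h [p [Ji Jj ij h1 [p2 hp]]]]]] := finite_orbits_pigeonhole
  (subgrp_ind vS) (subgrp_stab vS gf1) (subgrp_stab vS gf2) Gf Jinf fin.
move/(stabilizerP _ gf1): h1 => [Gh hF]; move/(stabilizerP _ gf2): p2 => [_ pF].
exists i, j, h; split=> // F1 F2 FF1 FF2.
by rewrite im_glI (hF _ FF1) -im_glM hp im_glM pF.
Qed.

Lemma proper_trans X Y Z : X `<` Y -> Y `<` Z -> X `<` Z.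
Proof.
move=> [XY _] [YZ nZY]; split; first exact: subset_trans XY YZ.
by move=> ZX; apply: nZY; exact: subset_trans ZX XY.
Qed.

(** Elements of P1 can only map g_i F2 ∩ F1 to g_j F2 ∩ F1 if the two are not
strictly comparable, so the terms of a strictly monotone sequence of such
intersections belong to different orbits. *)
Lemma strict_sequence_infinite S Fl1 Fl2 F1 F2 (lt : set V -> set V -> Prop)
    (Inv : gl V -> Prop) :
  valid_structure S -> generalized_flag S Fl1 -> generalized_flag S Fl2 ->
  Fl1 F1 -> Fl2 F2 -> (forall X Y Z, lt X Y -> lt Y Z -> lt X Z) ->
  (forall h X, ind_group S h -> is_subspace X ->
     ~ lt X (h @` X) /\ ~ lt (h @` X) X) ->
  Inv 1%g ->
  (forall g, ind_group S g -> Inv g -> exists k, [/\ ind_group S k, Inv k &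
     lt (g @` F2 `&` F1) (k @` F2 `&` F1)]) ->
  infinite_set (diag_orbits (ind_group S) (stabilizer S Fl1) (stabilizer S Fl2)).
Proof.
move=> vS gf1 gf2 FF1 FF2 lt_tr lt_rigid I1 step fin.
have /choice[s hs] : forall g, exists k, ind_group S g /\ Inv g ->
    [/\ ind_group S k, Inv k & lt (g @` F2 `&` F1) (k @` F2 `&` F1)].
  move=> g; have [[Gg Ig]|n] := pselect (ind_group S g /\ Inv g).
    by have [k hk] := step g Gg Ig; exists k.
  by exists g.
pose f n := iter n s (1%g : gl V).
have fI n : ind_group S (f n) /\ Inv (f n).
  elim: n => [|n IH]; first by split; [exact: ind_group1|].
  by have [? ? _] := hs _ IH; split.
pose X n := f n @` F2 `&` F1.
have XS n : lt (X n) (X n.+1) by have [_ _] := hs _ (fI n).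
have Xlt m n : (m < n)%N -> lt (X m) (X n).
  elim: n => // n IH; rewrite ltnS leq_eqVlt => /orP[/eqP->//|/IH h].
  exact: lt_tr h (XS n).
have [|i [j [h [_ _ ij Gh hX]]]] :=
  pigeonhole_flags vS gf1 gf2 (fun n (_ : setT n) => (fI n).1) _ fin.
  exact: infinite_nat.
have hXij : h @` X i = X j by exact: hX.
have sX : is_subspace (X i).
  have s1 : is_subspace F1 by case: gf1 => + _ _ _ _; exact.
  have s2 : is_subspace F2 by case: gf2 => + _ _ _ _; exact.
  by apply: subspaceI => //; exact: subspace_im.
have [n1 n2] := lt_rigid h (X i) Gh sX; rewrite hXij in n1 n2.
by have [l|l|//] := ltngtP i j; [apply: n1|apply: n2]; exact: Xlt.
Qed.

Lemma proper_rigid S h X : ind_group S h -> is_subspace X ->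
  ~ X `<` h @` X /\ ~ h @` X `<` X.
Proof.
move=> /ind_group_GL hh sX; split=> -[sub n]; apply: n.
  by rewrite (GL_im_sup hh).
by rewrite (GL_im_sub hh).
Qed.

(** The sum X + Y. *)
Definition adds X Y : set V := [set x | exists2 y, X y & Y (x - y)].
Definition cofin X := exists s, setT `<=` adjs X s.

(** The subspaces on which exchanges are performed. *)
Definition exchangeable S F := closed S F /\
  match form_of S with None => True | Some w => isotropic w F end.

Lemma closed_im S g F : GL_infty (V_star S) g -> closed S F -> closed S (g @` F).
Proof.
move=> [Vg _ _] [sF cF]; split; first exact: subspace_im.
move=> x nx; have : ~ F ((g^-1)%g x) by move=> h; apply: nx; exact/im_glVE.
move=> /cF[p [Vp p0 px]]; exists (dual_act g p); split=> //.
- by rewrite -Vg; exists p.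
- by move=> _ [y Fy <-]; rewrite /dual_act /= gl_funK p0.
Qed.

Lemma exchangeable_im S g F : ind_group S g -> exchangeable S F -> exchangeable S (g @` F).
Proof.
move=> Gg [cF iF]; split; first exact: closed_im (ind_group_GL Gg) cF.
by move: iF; case hw : (form_of S) => [w|] //; exact: isotropic_im hw Gg.
Qed.

Lemma closed0 S : valid_structure S -> closed S [set 0].
Proof.
move=> vS; split; first exact: subspace0.
move=> x /eqP x0.
have [phi Vphi px] : exists2 phi : V -> K, V_star S phi & phi x != 0.
  apply: contrapT => h; move/eqP: x0; apply.
  case: S vS h => [Vs|w|w] /=.
  - move=> [_ _ _ nd] h; apply: nd => phi Vphi; apply: contrapT => /eqP p0.
    by apply: h; exists phi.
  - move=> [sy nd] h; apply: nd => u; apply: contrapT => /eqP p0.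
    by apply: h; exists (w u); [exists u|rewrite sy].
  - move=> vS; have [[eps heps] nd] := @valid_eps _ _ (TypeC w) w vS erefl.
    move=> h; apply: nd => u; apply: contrapT => /eqP p0; apply: h.
    exists (w u); first by exists u.
    by apply: contra_neq p0 => h; exact: orthC heps h.
exists ((phi x)^-1 *: (phi : V -> K^o)); split.
- exact: (subsZ _ (V_star_subspace vS)).
- move=> _ ->; rewrite [LHS](_ : _ = (phi x)^-1 * phi 0) //.
  by rewrite (sc0 (V_star_scalar vS Vphi)) mulr0.
- by rewrite [LHS](_ : _ = (phi x)^-1 * phi x) // mulVf.
Qed.

Lemma nondeg_ex S w v : valid_structure S -> form_of S = Some w -> v != 0 ->
  exists u, w u v != 0.
Proof.
move=> vS hw /eqP v0; have [p [+ _ pv]] := (closed0 vS).2 v v0.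
by rewrite (V_star_form hw) => -[u pu]; exists u; rewrite -pu pv oner_eq0.
Qed.

(** As u is outside F + F1, a vector f + c u of g F is in F1 only for c = 0. *)
Lemma down_image S F F1 g psi v u : valid_structure S -> V_star S psi ->
  is_subspace F -> is_subspace F1 ->
  g @` F = adj (F `&` [set x | psi x = 0]) u -> F v -> F1 v -> psi v = 1 ->
  (forall f, F f -> ~ F1 (u + f)) ->
  [/\ g @` F `&` F1 `<` F `&` F1, F `&` F1 `<=` adj (g @` F `&` F1) v
    & g @` F `<=` adj F u].
Proof.
move=> vS Vp sF s1 gF Fv F1v pv nu; have lp := V_star_scalar vS Vp.
have sub x : g @` F `&` F1 `<=` F `&` F1 `&` [set x | psi x = 0].
  rewrite gF => y [[c [Fy /= py]] F1y].
  have c0 : c = 0.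
    apply: contrapT => /eqP c0; apply: (nu (c^-1 *: (y - c *: u))).
      exact: subsZ.
    by rewrite scalerBr scalerA mulVf // scale1r addrC subrK; exact: subsZ.
  by move: Fy py; rewrite c0 scale0r subr0; split.
split.
- split; first by move=> y /(sub 0)[].
  move=> h; have /(sub 0)[_ /=] := h v (conj Fv F1v).
  by rewrite pv => /eqP; rewrite oner_eq0.
- move=> x [Fx F1x]; exists (psi x); split; last by apply: subsB => //; exact: subsZ.
  rewrite gF; apply: adj_sub; split; first by apply: subsB => //; exact: subsZ.
  by rewrite /= (scB lp) (scZ lp) pv mulr1 subrr.
- by rewrite gF; apply: adjS => x [].
Qed.

(** Nothing is lost because psi vanishes on F ∩ F1, and u is new. *)
Lemma up_image S F F1 g psi v u : valid_structure S -> V_star S psi ->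
  is_subspace F -> is_subspace F1 ->
  g @` F = adj (F `&` [set x | psi x = 0]) u -> F v -> psi v = 1 ->
  (forall x, (F `&` F1) x -> psi x = 0) -> F1 u -> ~ F u ->
  [/\ F `&` F1 `<` g @` F `&` F1, g @` F `&` F1 `<=` adj (F `&` F1) u
    & F `<=` adj (g @` F) v].
Proof.
move=> vS Vp sF s1 gF Fv pv p0 F1u nFu; have lp := V_star_scalar vS Vp.
have sk : is_subspace (F `&` [set x | psi x = 0]).
  by apply: subspaceI => //; exact: subspace_ker.
split.
- split; first by move=> x Fx; split; [rewrite gF; apply: adj_sub; split; [case: Fx|exact: p0]|case: Fx].
  move=> h; apply: nFu; suff [] : (F `&` F1) u by [].
  by apply: h; split=> //; rewrite gF; exact: adj_in.
- rewrite gF => x [[c [Fx _]] F1x]; exists c; split=> //.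
  by apply: subsB => //; exact: subsZ.
- move=> x Fx; exists (psi x); rewrite gF; apply: adj_sub; split=> /=.
    by apply: subsB => //; exact: subsZ.
  by rewrite (scB lp) (scZ lp) pv mulr1 subrr.
Qed.

(** With a form, v is orthogonal to F + F1, so any isotropic u that is not
orthogonal to v is outside F + F1. *)
Lemma down_step S F F1 v : valid_structure S -> exchangeable S F -> exchangeable S F1 ->
  F v -> F1 v -> v != 0 ->
  (form_of S = None -> exists u, ~ adds F F1 u) ->
  exists g v u, [/\ ind_group S g, g @` F `&` F1 `<` F `&` F1,
    F `&` F1 `<=` adj (g @` F `&` F1) v & g @` F `<=` adj F u].
Proof.
move=> vS [cF iF] [c1 i1] Fv F1v v0 hA.
have C0F : [set 0] `<=` F by move=> _ ->; exact: subs0 cF.1.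
have nCv : ~ [set (0 : V)] v by move=> h; rewrite h eqxx in v0.
have [u [nu [g [psi [Gg Vp gF _ [pv _]]]]]] : exists u,
    (forall f, F f -> ~ F1 (u + f)) /\ exchange S F [set 0] v u.
  case hw : (form_of S) iF i1 => [w|] iF i1.
    have [u0 u0v] := nondeg_ex vS hw v0.
    have [[eps heps] _] := valid_eps vS hw.
    have [c] := make_isotropic heps (iF v v Fv Fv) u0v.
    set u := u0 - _ => uu.
    have uv : w u v != 0 by rewrite !form_linE (iF v v) // mulr0 subr0.
    have nu : forall f, F f -> ~ F1 (u + f).
      move=> f Ff F1uf; move/eqP: uv; apply.
      by have := i1 _ _ F1uf F1v; rewrite wDl (iF f v) // addr0.
    exists u; split=> //; apply: (exchange_form vS hw) => //.
    - exact: closed0.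
    - move=> Fu; move: (nu 0 (subs0 cF.1)); apply; rewrite addr0.
      by move/eqP: uv; case; exact: iF.
    - by move=> x ->; rewrite w0r.
    - by right.
  have [u nu] := hA hw; exists u; split.
    move=> f Ff F1uf; apply: nu; exists (- f); first exact: (subsN cF.1).
    by rewrite opprK.
  apply: exchange_typeA => //; [exact: cF.1|exact: closed0|].
  by move=> Fu; apply: nu; exists u => //; rewrite subrr; exact: subs0 c1.1.
have [h1 h2 h3] := down_image vS Vp cF.1 c1.1 gF Fv F1v pv nu.
by exists g, v, u.
Qed.

(** The whole of F ∩ F1 is kept while a vector of F outside F1 is exchanged for a
vector of F1 outside F. *)
Lemma up_step S F F1 : valid_structure S -> exchangeable S F -> exchangeable S F1 ->
  ~ F `<=` F1 -> ~ F1 `<=` F ->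
  exists g v u, [/\ ind_group S g, F `&` F1 `<` g @` F `&` F1,
    g @` F `&` F1 `<=` adj (F `&` F1) u & F `<=` adj (g @` F) v].
Proof.
move=> vS [cF iF] [c1 i1] /existsNP[v0 /not_implyP[Fv0 nv0]].
move=> /existsNP[u /not_implyP[F1u nu]].
have cI := closedI cF c1.
have [v [Fv [g [psi [Gg Vp gF pC [pv _]]]]]] : exists v,
    F v /\ exchange S F (F `&` F1) v u.
  case hw : (form_of S) iF i1 => [w|] iF i1.
    have [[v [Fv uv]]|hv] := pselect (exists v, F v /\ w u v != 0).
      exists v; split=> //; apply: (exchange_form vS hw) => //.
      - by move=> [_ F1v]; rewrite (i1 u v) ?eqxx in uv.
      - exact: i1.
      - by move=> x [_ F1x]; exact: i1.
      - by right.
    exists v0; split=> //; apply: (exchange_form vS hw) => //.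
    - by move=> [].
    - exact: i1.
    - by move=> x [_ F1x]; exact: i1.
    - left=> x Fx; apply: contrapT => /eqP ux; apply: hv; by exists x.
  exists v0; split=> //; apply: exchange_typeA => //; first exact: cF.1.
  by move=> [].
have [h1 h2 h3] := up_image vS Vp cF.1 c1.1 gF Fv pv pC F1u nu.
by exists g, v, u.
Qed.

Lemma cofin_adj X v : cofin (adj X v) -> cofin X.
Proof.
move=> [s hs]; exists (s ++ [:: v]).
by rewrite /adjs foldr_cat.
Qed.
Lemma cofinS X Y : X `<=` Y -> cofin X -> cofin Y.
Proof.
move=> XY [s hs]; exists s; exact: subset_trans hs (adjsS XY).
Qed.
Lemma addsS X X' Y : X `<=` X' -> adds X Y `<=` adds X' Y.
Proof. by move=> h x [y /h]; exists y. Qed.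
Lemma adds_adj X Y u : adds (adj X u) Y `<=` adj (adds X Y) u.
Proof.
move=> x [y [c Xy] Yxy]; exists c; exists (y - c *: u) => //.
by rewrite opprB addrA subrK.
Qed.
Lemma adds_sub X Y : is_subspace Y -> X `<=` Y -> adds X Y `<=` Y.
Proof. by move=> sY XY x [y /XY Yy h]; rewrite -(subrK y x); exact: subsD. Qed.
Lemma adds_subl X Y : is_subspace X -> Y `<=` X -> adds X Y `<=` X.
Proof. by move=> sX YX x [y Xy /YX h]; rewrite -(subrK y x); exact: subsD. Qed.

Lemma fin0 : fin [set (0 : V)].
Proof.
exists [::] => _ ->; exact: subs0 (subspace_span _).
Qed.

(** If the intersection of F1 and F2 has finite dimension or, in type A, their sum
has finite codimension, then neither contains the other; this persists under
exchanges, so the intersection can be enlarged forever. Otherwise there is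
always a common vector, and room outside the sum, to shrink it forever. *)
Lemma medium_members_infinite S Fl1 Fl2 F1 F2 : valid_structure S ->
  generalized_flag S Fl1 -> generalized_flag S Fl2 -> Fl1 F1 -> Fl2 F2 ->
  exchangeable S F1 -> exchangeable S F2 -> ~ fin F1 -> ~ fin F2 ->
  (form_of S = None -> ~ cofin F1 /\ ~ cofin F2) ->
  infinite_set (diag_orbits (ind_group S) (stabilizer S Fl1) (stabilizer S Fl2)).
Proof.
move=> vS gf1 gf2 FF1 FF2 g1 g2 nf1 nf2 hA.
have s1 := g1.1.1.
pose small g := fin (g @` F2 `&` F1) \/
   form_of S = None /\ cofin (adds (g @` F2) F1).
have [I1|I1] := pselect (small 1%g).
  apply: (@strict_sequence_infinite S Fl1 Fl2 F1 F2 (fun X Y => X `<` Y) small) => //;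
    [exact: proper_trans|exact: proper_rigid|move=> g Gg Ig].
  have gg := exchangeable_im Gg g2; have sg := gg.1.1.
  have [||k [v [u [Gk k1 k2 k3]]]] := up_step vS gg g1.
  - move=> h; case: Ig => [f|[hw]].
      apply: nf2; rewrite -(im_glK g F2); apply: fin_im; apply: finS f => x gx.
      by split=> //; exact: h.
    by move=> /(cofinS (adds_sub s1 h)); case: (hA hw).
  - move=> h; case: Ig => [f|[hw]].
      by apply: nf1; apply: finS f => x F1x; split=> //; exact: h.
    move=> /(cofinS (adds_subl sg h)) [s hs]; case: (hA hw) => _; apply.
    exists (map (g^-1)%g s) => x _; have := hs (g x) I.
    elim: s x {hs} => [x /im_glE//|a s IH x /=].
    move=> [c hc]; exists c; apply: IH.
    by rewrite linearB linearZ /= glVK.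
  exists (k * g)%g; split; first exact: ind_groupM.
    rewrite /small im_glM; case: Ig => [f|[hw f]].
      by left; apply: finS k2 _; exact: fin_adj.
    right; split=> //; apply: (@cofin_adj _ v).
    by apply: cofinS f; apply: subset_trans (addsS k3) _; exact: adds_adj.
  by rewrite im_glM.
apply: (@strict_sequence_infinite S Fl1 Fl2 F1 F2 (fun X Y => Y `<` X)
  (fun g => ~ small g)) => //.
  by move=> X Y Z XY YZ; exact: proper_trans YZ XY.
  by move=> h X Gh sX; have [] := proper_rigid Gh sX.
move=> g Gg Ig.
have gg := exchangeable_im Gg g2; have sg := gg.1.1.
have [v [[Fv F1v] v0]] : exists v, (g @` F2 `&` F1) v /\ v != 0.
  apply: contrapT => h; apply: Ig; left; apply: (@finS _ _ _ [set 0] _ fin0) => x Fx.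
  by apply: contrapT => nx; apply: h; exists x; split=> //; apply/eqP.
have [|k [v' [u [Gk k1 k2 k3]]]] := down_step vS gg g1 Fv F1v v0.
  move=> hw; apply: contrapT => h; apply: Ig; right; split=> //.
  by exists [::] => x _ /=; apply: contrapT => nx; apply: h; exists x.
exists (k * g)%g; split; [exact: ind_groupM| |by rewrite im_glM].
rewrite /small im_glM => -[f|[hw f]]; apply: Ig.
  by left; apply: finS k2 _; exact: fin_adj.
right; split=> //; apply: (@cofin_adj _ u).
by apply: cofinS f; apply: subset_trans (addsS k3) _; exact: adds_adj.
Qed.
End InfiniteOrbits.

(** * Layers of an infinite flag *)
Section InfiniteFlag.
Variables (R : realType) (V : lmodType R[i]).
Local Notation K := (R[i]).
Implicit Types (g h k : gl V) (S : vstructure V) (A C E X Y F : set V) (Fl : set (set V)).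
Implicit Types (w : {biscalar V}) (psi : V -> K) (u v x y : V).

(** After an exchange with data psi and u, the intersection with F' has lost a
dimension, respectively gained one: the difference gain - loss is the relative
dimension of g F ∩ F' and F ∩ F'. *)
Definition loss F F' psi := exists2 x, (F `&` F') x & psi x != 0.
Definition gain F F' psi u :=
  exists2 f, (F `&` [set x | psi x = 0]) f & F' (u + f).

Section Compare.
Variables (S : vstructure V) (vS : valid_structure S).
(** Comparison of sizes modulo the finitary group, which makes sense in infinite
dimension and is antisymmetric by rigidity. *)
Definition below X Y := exists2 k, GL_infty (V_star S) k & k @` X `<` Y.
Definition level X Y := exists2 k, GL_infty (V_star S) k & k @` X = Y.

Lemma level_refl X : level X X.
Proof. by exists 1%g; [exact: GL_infty1 (V_star_subspace vS)|exact: im_gl1]. Qed.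
Lemma level_sym X Y : level X Y -> level Y X.
Proof.
move=> [k hk <-]; exists (k^-1)%g; [exact: GL_inftyV|exact: im_glK].
Qed.
Lemma level_below X Y Z : level X Y -> below Y Z -> below X Z.
Proof.
move=> [k hk <-] [l hl lt]; exists (l * k)%g; first exact: GL_inftyM.
by rewrite im_glM.
Qed.
Lemma below_level X Y Z : below X Y -> level Y Z -> below X Z.
Proof.
move=> [k hk [h1 h2]] [l hl <-]; exists (l * k)%g; first exact: GL_inftyM.
rewrite im_glM; split; first exact: image_subset.
move=> h; apply: h2 => y Yy; have [|x Xx /gl_inj <- //] := h (l y).
by exists y.
Qed.
Lemma below_trans X Y Z : below X Y -> below Y Z -> below X Z.
Proof.
move=> hXY [l hl [h1 h2]].
have [k hk [h3 h4]] := below_level hXY (ex_intro2 _ _ l hl erefl).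
exists k => //; split; first exact: subset_trans h3 h1.
by move=> h; apply: h2; exact: subset_trans h h3.
Qed.
Lemma below_irrefl X : is_subspace X -> ~ below X X.
Proof.
move=> sX [k hk [h1 h2]]; apply: h2.
by rewrite (GL_im_sub hk).
Qed.

Variables (F F' : set V) (sF : is_subspace F) (sF' : is_subspace F').
Let X := F `&` F'.

(** When one vector is lost and u + f is gained, the transvection trading the two
carries one intersection to the other. *)
Lemma exchange_cases g psi u : V_star S psi ->
  g @` F = adj (F `&` [set x | psi x = 0]) u -> psi u = 1 -> ~ F u ->
  let Y := g @` F `&` F' in
  [/\ ~ loss F F' psi -> ~ gain F F' psi u -> level Y X,
      loss F F' psi -> ~ gain F F' psi u -> below Y X,
      ~ loss F F' psi -> gain F F' psi u -> below X Y
    & loss F F' psi -> gain F F' psi u -> level Y X].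
Proof.
move=> Vp gF pu nFu Y; have lp := V_star_scalar vS Vp.
have id1 Z Z' : Z `<` Z' -> below Z Z'.
  by exists 1%g; [exact: GL_infty1 (V_star_subspace vS)|rewrite im_gl1].
have sk : is_subspace (F `&` [set x | psi x = 0]).
  by apply: subspaceI => //; exact: subspace_ker.
have noloss : ~ loss F F' psi -> X `<=` Y.
  move=> nl x [Fx F'x]; split=> //; rewrite gF; apply: adj_sub; split=> //=.
  by apply: contrapT => /eqP px; apply: nl; exists x.
have nogain : ~ gain F F' psi u -> Y `<=` F `&` F' `&` [set x | psi x = 0].
  move=> ng x []; rewrite gF => -[c [Fx /= px]] F'x.
  suff c0 : c = 0 by move: Fx px; rewrite c0 scale0r subr0; split.
  apply: contrapT => /eqP c0; apply: ng; exists (c^-1 *: (x - c *: u)).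
    by split; [exact: subsZ|rewrite /= (scZ lp) px mulr0].
  by rewrite scalerBr scalerA mulVf // scale1r addrC subrK; exact: subsZ.
split.
- move=> nl ng; suff -> : Y = X by exact: level_refl.
  by apply/seteqP; split; [move=> x /(nogain ng)[]|exact: noloss].
- move=> [x Xx px] ng; apply: id1; split; first by move=> y /(nogain ng)[].
  by move=> h; have /(nogain ng)[_ /eqP] := h x Xx; exact/negP.
- move=> nl [f [Ff pf] F'uf]; apply: id1; split; first exact: noloss.
  move=> h; apply: nFu; rewrite -(addrK f u); apply: subsB => //.
  have [] // : X (u + f); apply: h; split=> //.
  by rewrite gF; apply: subsD; [exact: subspace_adj|exact: adj_in|exact: adj_sub].
- move=> [x [Fx F'x] px] [f [Ff /= pf] F'uf].
  pose v := (psi x)^-1 *: x; have pv : psi v = 1 by rewrite (scZ lp) mulVf.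
  have Xv : X v by split; exact: subsZ.
  have [|k hk kE] := @transvection _ _ S (u + f - v) psi vS Vp.
    by rewrite (scB lp) (scD lp) pv pu pf addr0 subrr addr0 oner_eq0.
  apply: level_sym; exists k => //.
  rewrite (@transvection_image _ _ S k psi X v (u + f) Vp vS) //; last exact: subspaceI.
  apply/seteqP; split=> y.
    move=> [c [[Fy F'y] /= py]]; split.
      rewrite gF; exists c; split=> /=.
        rewrite (_ : y - c *: u = y - c *: (u + f) + c *: f).
          by apply: subsD => //; exact: subsZ.
        by rewrite scalerDr opprD addrA subrK.
      move: py; rewrite (scB lp) (scZ lp) (scD lp) pf addr0.
      by rewrite (scB lp) (scZ lp).
    by rewrite -(subrK (c *: (u + f)) y); apply: subsD => //; exact: subsZ.
  rewrite /Y gF => -[[c [Fy /= py]] F'y]; exists c; split=> /=; first split.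
  + rewrite scalerDr opprD addrA; apply: subsB => //; exact: subsZ.
  + by apply: subsB => //; exact: subsZ.
  + by rewrite scalerDr opprD addrA (scB lp) (scZ lp c f) pf mulr0 subr0.
Qed.

Lemma exchange_invariant g psi u g' psi' u' : V_star S psi -> V_star S psi' ->
  g @` F = adj (F `&` [set x | psi x = 0]) u ->
  g' @` F = adj (F `&` [set x | psi' x = 0]) u' ->
  psi u = 1 -> psi' u' = 1 -> ~ F u -> ~ F u' ->
  level (g @` F `&` F') (g' @` F `&` F') ->
  (loss F F' psi -> ~ gain F F' psi u -> loss F F' psi' /\ ~ gain F F' psi' u') /\
  (~ loss F F' psi -> gain F F' psi u -> ~ loss F F' psi' /\ gain F F' psi' u').
Proof.
move=> Vp Vp' gF gF' pu pu' nu nu' lev.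
have [a1 a2 a3 a4] := exchange_cases Vp gF pu nu.
have [b1 b2 b3 b4] := exchange_cases Vp' gF' pu' nu'.
have sX : is_subspace X by exact: subspaceI.
have irr := below_irrefl sX.
split=> [l ng|nl ga].
  have h1 : below (g' @` F `&` F') X.
    by apply: level_below (level_sym lev) (a2 l ng).
  have [l'|nl'] := pselect (loss F F' psi');
    have [g1|ng1] := pselect (gain F F' psi' u'); split=> //; exfalso; apply: irr.
  - exact: level_below (level_sym (b4 l' g1)) h1.
  - exact: below_trans (b3 nl' g1) h1.
  - exact: below_trans (b3 nl' g1) h1.
  - exact: level_below (level_sym (b1 nl' ng1)) h1.
have h1 : below X (g' @` F `&` F') by exact: below_level (a3 nl ga) lev.
have [l'|nl'] := pselect (loss F F' psi');
  have [g1|ng1] := pselect (gain F F' psi' u'); split=> //; exfalso; apply: irr.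
- exact: below_level h1 (b4 l' g1).
- exact: below_trans h1 (b2 l' ng1).
- exact: below_trans h1 (b2 l' ng1).
- exact: below_level h1 (b1 nl' ng1).
Qed.
End Compare.

Definition cpair Fl (p : set V * set V) := consecutive Fl p.1 p.2.

Lemma cpair_total Fl p q : chain Fl -> cpair Fl p -> cpair Fl q -> p <> q ->
  p.2 `<=` q.1 \/ q.2 `<=` p.1.
Proof.
case: p q => [a b] [c d] /= ch [/= Fa Fb ab hab] [/= Fc Fd cd hcd] pq.
have strict (X Y : set V) : X `<=` Y -> X <> Y -> X `<` Y.
  by move=> XY n; split=> // YX; apply: n; exact/seteqP.
have [bc|cb] := ch _ _ Fb Fc; first by left.
have [da|ad] := ch _ _ Fd Fa; first by right.
have [ac|nac] := pselect (a = c).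
  subst c; exfalso; apply: pq; congr pair; apply: contrapT => bd.
  have [h|h] := ch _ _ Fb Fd.
    by apply: (hcd b Fb); split=> //; exact: strict.
  by apply: (hab d Fd); split=> //; apply: strict => // e; apply: bd.
have [h|h] := ch _ _ Fa Fc.
  have [cb'|ncb] := pselect (c = b); first by left; rewrite cb'.
  by exfalso; apply: (hab c Fc); split; exact: strict.
have [da'|nda] := pselect (a = d); first by right; rewrite da'.
exfalso; apply: (hcd a Fa); split; last exact: strict.
by apply: strict => // e; apply: nac.
Qed.

Lemma infinite_cpair S Fl : generalized_flag S Fl -> infinite_set Fl ->
  infinite_set [set p | cpair Fl p].
Proof.
move=> [_ _ hF _ _] inf fin; apply: inf.
apply: (@sub_finite_set _ _ ((fst @` [set p | cpair Fl p]) `|` (snd @` [set p | cpair Fl p]))).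
  move=> F /hF[F' [c|c]]; first by right; exists (F', F).
  by left; exists (F, F').
by rewrite finite_setU; split; exact: finite_image.
Qed.

Section Kinds.
Variables (S : vstructure V) (Fl : set (set V)) (F : set V).

Definition exchanged g psi u :=
  [/\ ind_group S g, V_star S psi, g @` F = adj (F `&` [set x | psi x = 0]) u,
      psi u = 1 & ~ F u].

(** The loss sets in exactly at the layer p. *)
Definition loss_at (p : set V * set V) psi :=
  (forall x, (F `&` p.1) x -> psi x = 0) /\ exists2 v, (F `&` p.2) v & psi v != 0.

(** The gain sets in exactly at p, a layer in which F has no share. *)
Definition kind_fresh (p : set V * set V) g psi u :=
  [/\ p.2 u, ~ p.1 u & F `&` p.2 `<=` p.1].
(** A dimension is gained below p, and the loss sets in at p. *)
Definition kind_up (p : set V * set V) g psi u := p.1 u /\ loss_at p psi.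
(** The loss sets in at p, and is not yet compensated by a gain at p. *)
Definition kind_down (p : set V * set V) g psi u :=
  (forall f, F f -> ~ p.2 (u + f)) /\ loss_at p psi.

Definition of_kind (k : set V * set V -> gl V -> (V -> K) -> V -> Prop) p :=
  exists g psi u, exchanged g psi u /\ k p g psi u.
End Kinds.

Lemma kind_fresh_nogain F F' p g psi u : is_subspace p.1 -> is_subspace p.2 ->
  p.1 `<=` p.2 -> F' `<=` p.1 -> kind_fresh F p g psi u -> ~ gain F F' psi u.
Proof.
move=> s1 s2 p12 F'p [up2 nup1 hp] [f [Ff _] /F'p uf]; apply: nup1.
apply: (subsDr s1 _ uf); apply: hp; split=> //.
by apply: (subsDr s2 up2); rewrite addrC; exact: p12.
Qed.

(** Let p lie below q. For the kind kind_up, the intersection with q.1 has grown in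
the exchange for q, but not in the one for p, which has already lost. For the
kind kind_down, the intersection with p.2 has shrunk for p and lost nothing for
q. For the kind kind_fresh, equal patterns at p.2 would need a loss for p at
p.2; as F has no share in the layer p, it occurs already at p.1, where it is
not compensated for p and does not occur for q. *)
Lemma kind_infinite S Fl Fl2 F kd : valid_structure S ->
  generalized_flag S Fl -> generalized_flag S Fl2 -> Fl2 F ->
  kd = kind_fresh F \/ kd = kind_up F \/ kd = kind_down F ->
  infinite_set [set p | cpair Fl p /\ of_kind S F kd p] ->
  infinite_set (diag_orbits (ind_group S) (stabilizer S Fl) (stabilizer S Fl2)).
Proof.
move=> vS gf1 gf2 FF hk inf fin.
have /choice[d hd] : forall p, exists d : gl V * (V -> K) * V,
    of_kind S F kd p -> exchanged S F d.1.1 d.1.2 d.2 /\ kd p d.1.1 d.1.2 d.2.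
  move=> p; have [[g [psi [u h]]]|n] := pselect (of_kind S F kd p).
    by exists (g, psi, u).
  by exists (1%g, (fun=> 0), 0).
have [|i [j [h [[ci oi] [cj oj] ij Gh hX]]]] := pigeonhole_flags vS gf1 gf2
    (f := fun p => (d p).1.1) _ inf fin.
  by move=> p [_ /hd[[]]].
have sF : is_subspace F by case: gf2 => + _ _ _ _; exact.
have sFl F' : Fl F' -> is_subspace F' by case: gf1 => + _ _ _ _; exact.
have hX' F' : Fl F' -> level S ((d i).1.1 @` F `&` F') ((d j).1.1 @` F `&` F').
  by move=> FF'; exists h; [exact: ind_group_GL Gh|exact: hX].
have ch : chain Fl by case: gf1.
have : i.2 `<=` j.1 \/ j.2 `<=` i.1 by exact: cpair_total ch ci cj ij.
have key (p q : set V * set V) : cpair Fl p -> cpair Fl q -> of_kind S F kd p ->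
   of_kind S F kd q -> (forall F', Fl F' ->
      level S ((d p).1.1 @` F `&` F') ((d q).1.1 @` F `&` F')) ->
   p.2 `<=` q.1 -> False.
  move=> [a1 a2 [a3 _] _] [b1 b2 [b3 _] _] /hd[[_ Vp gF pu nu] kp].
  move=> /hd[[_ Vq gF' qu nu'] kq] lev pq.
  have I F' FF' := exchange_invariant vS sF (sFl F' FF') Vp Vq gF gF' pu qu nu nu' (lev F' FF').
  have I' F' FF' := exchange_invariant vS sF (sFl F' FF') Vq Vp gF' gF qu pu nu' nu (level_sym (lev F' FF')).
  case: hk kp kq => [->|[->|->]].
  - move=> kp kq; have [pu2 npu1 hp] := kp.
    have gp2 : gain F p.2 (d p).1.2 (d p).2.
      by exists 0; [split; [exact: subs0|exact: sc0 (V_star_scalar vS Vp)]|rewrite addr0].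
    have ngp1 := kind_fresh_nogain (sFl _ a1) (sFl _ a2) a3 (@subset_refl _ _) kp.
    have ngq F' : F' `<=` p.2 -> ~ gain F F' (d q).1.2 (d q).2.
      by move=> h1; apply: (kind_fresh_nogain (sFl _ b1) (sFl _ b2) b3 _ kq); exact: subset_trans h1 pq.
    have lp2 : loss F p.2 (d p).1.2.
      by apply: contrapT => nl; have [_ /(_ nl gp2)[_ /ngq]] := I _ a2; apply.
    have nlq2 : ~ loss F p.2 (d q).1.2.
      move=> l; have [/(_ l (ngq _ (@subset_refl _ _)))[_]] := I' _ a2; exact.
    have nlq1 : ~ loss F p.1 (d q).1.2.
      by move=> [x [Fx px] hx]; apply: nlq2; exists x => //; split=> //; exact: a3.
    have [x [Fx px] hx] := lp2.
    have lp1 : loss F p.1 (d p).1.2 by exists x => //; split=> //; apply: hp.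
    by have [/(_ lp1 ngp1)[]] := I _ a1.
  - move=> [_ [_ [v [Fv pv] lv]]] [qu1 [nl _]].
    have [_ [||]] := I' _ b1.
    + by move=> [x Fx /eqP]; rewrite nl.
    + by exists 0; [split; [exact: subs0|exact: sc0 (V_star_scalar vS Vq)]|rewrite addr0].
    by move=> hn _; apply: hn; exists v => //; split=> //; exact: pq.
  - move=> [ng [_ [v Fv lv]]] [_ [nl _]].
    have [[||]] := I _ a2.
    + by exists v.
    + by move=> [f [Ff _]]; exact: ng.
    by move=> [x [Fx px]]; rewrite nl ?eqxx //; split=> //; exact: pq.
case=> [h1|h1]; first by apply: key h1.
apply: (key j i) h1 => // F' FF'; exact: level_sym (hX' F' FF').
Qed.
End InfiniteFlag.

(** * Finitely many orbits force finite flags *)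
Section Necessity.
Variables (R : realType) (V : lmodType R[i]).
Local Notation K := (R[i]).
Implicit Types (g h : gl V) (S : vstructure V) (A C E X Y F : set V) (Fl : set (set V)).
Implicit Types (w : {biscalar V}) (psi : V -> K) (u v x y : V) (p q : set V * set V).

Lemma exchange_exchanged S F C v u : exchange S F C v u -> ~ F u ->
  exists g psi, [/\ exchanged S F g psi u, forall x, C x -> psi x = 0 & psi v = 1].
Proof. by move=> [g [psi [Gg Vp gF p0 [pv pu]]]] nu; exists g, psi. Qed.

Lemma exchange_loss S F p v u : exchange S F (F `&` p.1) v u -> ~ F u ->
  F v -> p.2 v -> exists g psi, exchanged S F g psi u /\ loss_at F p psi.
Proof.
move=> /exchange_exchanged h /h [g [psi [ex p0 pv]]] Fv pv2; exists g, psi.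
by split=> //; split=> //; exists v => //; rewrite pv oner_eq0.
Qed.

(** If F has a share in the layer p, its loss can be made to set in at p; then u is
taken in p.1 if p.1 has vectors outside F, and anywhere outside F if p.2 is
contained in F. A single layer can escape: the one at which the flag leaves F. *)
Lemma layer_kinds_typeA S E Fl F v0 x0 : valid_structure S -> form_of S = None ->
  generalized_flag S Fl -> admissible S E -> compatible E Fl -> closed S F ->
  F v0 -> v0 != 0 -> ~ F x0 ->
  exists bad : set (set V * set V),
   (forall p q, cpair Fl p -> cpair Fl q -> bad p -> bad q -> p.2 `<=` q.1 -> False) /\
   forall p, cpair Fl p -> [\/ of_kind S F (kind_fresh F) p, of_kind S F (kind_up F) p,
     of_kind S F (kind_down F) p | bad p].
Proof.
move=> vS hw gF aE cE cF Fv0 v00 nx0; have sF := cF.1.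
exists [set p | p.1 `<=` F /\ ~ p.2 `<=` F]; split.
  by move=> p q _ _ [_ h] [h' _] pq; apply: h; exact: subset_trans pq h'.
move=> p [F1 F2 [p12 np12] _].
have c1 : closed S p.1 by exact: closed_flag vS aE cE F1.
have [h|] := pselect (F `&` p.2 `<=` p.1).
  move/existsNP: np12 => [u /not_implyP[up nup]].
  have nFu : ~ F u by move=> Fu; apply: nup; exact: h.
  have [||g [psi [ex _ _]]] := exchange_exchanged (exchange_typeA vS hw sF (closed0 vS) _ Fv0 _ nFu) nFu.
  - by move=> _ ->; exact: subs0.
  - by move=> v0E; rewrite v0E eqxx in v00.
  by constructor 1; exists g, psi, u; split.
move=> /existsNP[v /not_implyP[[Fv p2v] nv]].
have cC := closedI cF c1.
have nCv : ~ (F `&` p.1) v by case.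
have CF : F `&` p.1 `<=` F by move=> x [].
have [h|] := pselect (p.1 `<=` F); last first.
  move=> /existsNP[u /not_implyP[p1u nu]].
  have [g [psi [ex l]]] := exchange_loss (exchange_typeA vS hw sF cC CF Fv nCv nu) nu Fv p2v.
  by constructor 2; exists g, psi, u; split.
have [h2|h2] := pselect (p.2 `<=` F); last by constructor 4.
have [g [psi [ex l]]] := exchange_loss (exchange_typeA vS hw sF cC CF Fv nCv nx0) nx0 Fv p2v.
constructor 3; exists g, psi, x0; split=> //; split=> // f Ff /h2 h'.
by apply: nx0; exact: subsDr sF Ff h'.
Qed.

(** Orthogonality pairs the layers of a self-dual flag; only the middle layer, where
p.1^perp = p.2, is its own partner. *)
Lemma layer_cases S w Fl p : generalized_flag S Fl -> form_of S = Some w ->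
  cpair Fl p -> perp w p.1 <> p.2 ->
  perp w p.1 `<=` p.1 \/ p.2 `<=` perp w p.2.
Proof.
move=> [_ ch _ _ +] hw; rewrite hw => hperp [F1 F2 [p12 np12] hp] nbad.
have [P1 pp1] := hperp _ F1; have [P2 pp2] := hperp _ F2.
have [h|h] := ch _ _ P1 F1; first by left.
have [h'|h'] := ch _ _ P2 F2; last by right.
have [h1|h1] := ch _ _ P2 F1.
  have h2 : perp w p.1 `<=` p.2 by rewrite -pp2; exact: perpS.
  have [h3|h3] := pselect (perp w p.1 `<=` p.1); first by left.
  have [h4|h4] := pselect (p.2 `<=` perp w p.1).
    by exfalso; apply: nbad; exact/seteqP.
  by exfalso; apply: (hp _ P1).
have [h2|h2] := pselect (perp w p.2 `<=` p.1); last first.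
  have [h3|h3] := pselect (p.2 `<=` perp w p.2); first by right.
  by exfalso; apply: (hp _ P2).
have e : perp w p.2 = p.1 by exact/seteqP.
by exfalso; apply: nbad; rewrite -e pp2.
Qed.

Definition involution_for w E (i : V -> V) :=
  [/\ forall e, E e -> E (i e) /\ i (i e) = e,
      forall e e', E e -> E e' -> i e = e -> i e' = e' -> e = e'
    & forall e e', E e -> E e' -> (w e e' <> 0 <-> e' = i e)].

Lemma admissible_form S w E : form_of S = Some w -> admissible S E ->
  exists i, involution_for w E i.
Proof. by move=> hw [_]; rewrite hw. Qed.

Lemma compat_orth w E i A e : involution_for w E i -> A `<=` E -> E e ->
  ~ A (i e) -> forall x, span A x -> w e x = 0.
Proof.
move=> [_ _ wi] AE Ee nA; apply: span_min; first exact: subspace_ker (form_scalar w e).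
move=> f Af; apply: contrapT => /(wi _ _ Ee (AE _ Af)) fE.
by apply: nA; rewrite -fE.
Qed.

(** In the upper half of the flag, a basis vector e of the layer which is not
isotropic would be orthogonal to p.1, hence belong to p.1^perp and so to p.1. *)
Lemma layer_isotropic S w E Fl p : valid_structure S -> generalized_flag S Fl ->
  form_of S = Some w -> admissible S E -> compatible E Fl ->
  cpair Fl p -> perp w p.1 `<=` p.1 \/ p.2 `<=` perp w p.2 ->
  exists u, [/\ p.2 u, ~ p.1 u & w u u = 0].
Proof.
move=> vS gF hw aE cE [F1 F2 [p12 np12] _] [coiso|iso]; last first.
  move/existsNP: np12 => [u /not_implyP[pu nu]]; exists u; split=> //.
  exact: (iso _ pu).
have [[eps heps] _] := valid_eps vS hw.
have [A1 A1E p1E] := cE _ F1; have [A2 A2E p2E] := cE _ F2.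
have [e [Ae ne]] : exists e, A2 e /\ ~ p.1 e.
  apply: contrapT => h; apply: np12; rewrite p2E; apply: span_min.
    by case: gF => + _ _ _ _; exact.
  by move=> e Ae; apply: contrapT => ne; apply: h; exists e.
have Ee := A2E _ Ae; have [i hi] := admissible_form hw aE; have [iE _ wi] := hi.
exists e; split=> //; first by rewrite p2E; exact: span_incl.
apply: contrapT => /(wi _ _ Ee Ee) eie; apply: (ne); apply: coiso => x p1x.
apply: (orthC heps); apply: (compat_orth hi A1E Ee); last by rewrite -p1E.
by rewrite -eie => A1e; apply: ne; rewrite p1E; exact: span_incl.
Qed.

Lemma exchange0_form S w F v0 u : valid_structure S -> form_of S = Some w ->
  isotropic w F -> closed S F -> F v0 -> v0 != 0 -> ~ F u -> w u u = 0 ->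
  exists v, exchange S F [set 0] v u.
Proof.
move=> vS hw iF cF Fv0 v00 nu uu; have sF := cF.1.
have C0F : [set 0] `<=` F by move=> _ ->; exact: subs0.
have [[v [Fv uv]]|hv] := pselect (exists v, F v /\ w u v != 0).
  exists v; apply: (exchange_form vS hw) => //.
  - exact: closed0.
  - by move=> v0E; rewrite v0E w0r eqxx in uv.
  - by move=> x ->; rewrite w0r.
  - by right.
exists v0; apply: (exchange_form vS hw) => //.
- exact: closed0.
- by move=> v0E; rewrite v0E eqxx in v00.
- by move=> x ->; rewrite w0r.
- by left=> x Fx; apply: contrapT => /eqP ux; apply: hv; exists x.
Qed.

(** If F has a share in the layer, u is taken in p.1^perp and not orthogonal to v.
In the upper half p.1^perp lies in p.1, so u is gained below the layer. In the
lower half v is orthogonal to p.2 and to F, so u is not in their sum. *)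
Lemma layer_kinds_form S w E Fl F v0 : valid_structure S -> form_of S = Some w ->
  generalized_flag S Fl -> admissible S E -> compatible E Fl -> closed S F ->
  isotropic w F -> F v0 -> v0 != 0 ->
  exists bad : set (set V * set V),
   (forall p q, cpair Fl p -> cpair Fl q -> bad p -> bad q -> p.2 `<=` q.1 -> False) /\
   forall p, cpair Fl p -> [\/ of_kind S F (kind_fresh F) p, of_kind S F (kind_up F) p,
     of_kind S F (kind_down F) p | bad p].
Proof.
move=> vS hw gF aE cE cF iF Fv0 v00; have sF := cF.1.
have [[eps heps] _] := valid_eps vS hw.
have hperp F' : Fl F' -> Fl (perp w F') /\ perp w (perp w F') = F'.
  by case: gF => _ _ _ _; rewrite hw; exact.
exists [set p | perp w p.1 = p.2]; split.
  move=> p q [p1 _ [p12 np12] _] [_ _ [q12 nq12] _] bp bq pq; apply: np12.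
  have := @perpS _ _ w p.2 q.1 pq; rewrite bq -bp (hperp _ p1).2 bp => h.
  by apply: subset_trans pq _; apply: subset_trans q12 h.
move=> p cp; have [F1 F2 [p12 np12] hp] := cp.
have c1 : closed S p.1 by exact: closed_flag vS aE cE F1.
have [bad|nbad] := pselect (perp w p.1 = p.2); first by constructor 4.
have lay := layer_cases gF hw cp nbad.
have [h|] := pselect (F `&` p.2 `<=` p.1).
  have [u [up nup uu]] := layer_isotropic vS gF hw aE cE cp lay.
  have nFu : ~ F u by move=> Fu; apply: nup; exact: h.
  have [v ex] := exchange0_form vS hw iF cF Fv0 v00 nFu uu.
  have [g [psi [ex' _ _]]] := exchange_exchanged ex nFu.
  by constructor 1; exists g, psi, u; split.
move=> /existsNP[v /not_implyP[[Fv p2v] nv]].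
have cC := closedI cF c1.
have nCv : ~ (F `&` p.1) v by case.
have CF : F `&` p.1 `<=` F by move=> x [].
have [_ /(_ v nv)[phi [+ u0 uv]]] := c1.
rewrite (V_star_form hw) => -[u uE]; subst phi.
have nF x : w x v != 0 -> ~ F x.
  by move=> xv Fx; rewrite (iF x v) ?eqxx in xv.
have [coiso|iso] := lay.
  have pu : perp w p.1 u by move=> x p1x; exact: orthC heps (u0 x p1x).
  have p1u := coiso _ pu.
  have nFu : ~ F u by apply: nF; rewrite uv oner_eq0.
  have ex : exchange S F (F `&` p.1) v u.
    apply: (exchange_form vS hw) => //; first exact: u0.
    - by move=> x [_]; exact: u0.
    - by right; rewrite uv oner_eq0.
  have [g [psi [ex' l]]] := exchange_loss ex nFu Fv p2v.
  by constructor 2; exists g, psi, u; split.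
have [|c uu] := make_isotropic heps (iF v v Fv Fv) (u := u).
  by rewrite uv oner_eq0.
move: uu; set u' := u - _ => uu.
have u'v : w u' v = 1 by rewrite !form_linE (iF v v) // mulr0 subr0.
have nFu : ~ F u' by apply: nF; rewrite u'v oner_eq0.
have ex : exchange S F (F `&` p.1) v u'.
  apply: (exchange_form vS hw) => //.
  - move=> x [_ p1x]; rewrite !form_linE (u0 x) // sub0r.
    by rewrite (orthC heps (iso _ p2v x (p12 _ p1x))) mulr0 oppr0.
  - by right; rewrite u'v oner_eq0.
have [g [psi [ex' l]]] := exchange_loss ex nFu Fv p2v.
constructor 3; exists g, psi, u'; split=> //; split=> // f Ff h.
have := iso _ p2v _ h; rewrite wDl (iF f v) // u'v addr0 => /eqP.
by rewrite oner_eq0.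
Qed.

Lemma infinite_flag_orbits S E Fl Fl2 F v0 : valid_structure S ->
  generalized_flag S Fl -> admissible S E -> compatible E Fl ->
  generalized_flag S Fl2 -> Fl2 F -> exchangeable S F -> F v0 -> v0 != 0 ->
  (form_of S = None -> exists x, ~ F x) -> infinite_set Fl ->
  infinite_set (diag_orbits (ind_group S) (stabilizer S Fl) (stabilizer S Fl2)).
Proof.
move=> vS gF aE cE gF2 FF [cF iF] Fv0 v00 hA inf.
have [bad [bad1 cover]] : exists bad : set (set V * set V),
   (forall p q, cpair Fl p -> cpair Fl q -> bad p -> bad q -> p.2 `<=` q.1 -> False) /\
   forall p, cpair Fl p -> [\/ of_kind S F (kind_fresh F) p, of_kind S F (kind_up F) p,
     of_kind S F (kind_down F) p | bad p].
  case hw : (form_of S) iF => [w|] iF; first exact: (layer_kinds_form vS hw gF aE cE cF iF Fv0 v00).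
  by have [x0 nx0] := hA hw; exact: (layer_kinds_typeA vS hw gF aE cE cF Fv0 v00 nx0).
have ch : chain Fl by case: gF.
have finbad : finite_set [set p | cpair Fl p /\ bad p].
  have [[p0 [c0 b0]]|n] := pselect (exists p, cpair Fl p /\ bad p).
    apply: sub_finite_set (finite_set1 p0) => p [cp bp]; apply: contrapT => ne.
    by have [] := cpair_total ch cp c0 ne; [exact: bad1 bp b0|exact: bad1 b0 bp].
  by apply: sub_finite_set (finite_set0 _) => p h; apply: n; exists p.
move=> fin.
have kfin kd : kd = kind_fresh F \/ kd = kind_up F \/ kd = kind_down F ->
    finite_set [set p | cpair Fl p /\ of_kind S F kd p].
  move=> hk; apply: contrapT => kinf.
  exact: (kind_infinite vS gF gF2 FF hk kinf fin).
apply: (infinite_cpair gF inf).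
apply: (@sub_finite_set _ _ ([set p | cpair Fl p /\ of_kind S F (kind_fresh F) p] `|`
   [set p | cpair Fl p /\ of_kind S F (kind_up F) p] `|`
   [set p | cpair Fl p /\ of_kind S F (kind_down F) p] `|`
   [set p | cpair Fl p /\ bad p])).
  move=> p cp; case: (cover p cp) => h; [left;left;left|left;left;right|left;right|right]; by split.
rewrite !finite_setU; split=> //; split; [split|]; apply: kfin; tauto.
Qed.

Lemma proper_member S Fl : valid_structure S -> generalized_flag S Fl ->
  stabilizer S Fl `<` ind_group S ->
  exists F, [/\ Fl F, exists2 v, F v & v != 0 & exists x, ~ F x].
Proof.
move=> vS gF [_ n]; apply: contrapT => h; apply: n => g Gg.
apply: stabilizer_in => // F x FF Fx; have sF : is_subspace F by case: gF => + _ _ _ _; exact.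
apply: contrapT => nF; apply: h; exists F; split=> //; last by exists (g x).
exists x => //; apply/eqP => x0; apply: nF; rewrite x0 linear0; exact: subs0.
Qed.

(** Of F and F^perp one contains the other, and the smaller one is isotropic. *)
Lemma exchangeable_member S E Fl F : valid_structure S -> generalized_flag S Fl ->
  admissible S E -> compatible E Fl -> Fl F ->
  exists F', [/\ Fl F', exchangeable S F' & F' = F \/
    exists2 w, form_of S = Some w & F' = perp w F].
Proof.
move=> vS gF aE cE FF.
have cl F' : Fl F' -> closed S F' by exact: closed_flag vS aE cE.
have [_ ch _ _] := gF.
case hw : (form_of S) => [w|] hperp; last first.
  by exists F; split=> //; [split; [exact: cl|rewrite hw]|left].
have [P PP] := hperp _ FF.
have [[eps heps] _] := valid_eps vS hw.
have [h|h] := ch _ _ FF P.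
  exists F; split=> //; last by left.
  split; [exact: cl|rewrite hw => x y Fx Fy]; exact: (h _ Fy).
exists (perp w F); split=> //; last by right; exists w.
by split; [exact: cl|rewrite hw => x y /h Fx Fy; exact: (Fy x)].
Qed.

Lemma flag_finite_of_orbits S E Fl Fl2 : valid_structure S -> generalized_flag S Fl ->
  admissible S E -> compatible E Fl -> forall E2, generalized_flag S Fl2 ->
  admissible S E2 -> compatible E2 Fl2 ->
  stabilizer S Fl2 `<` ind_group S ->
  finite_set (diag_orbits (ind_group S) (stabilizer S Fl) (stabilizer S Fl2)) ->
  finite_set Fl.
Proof.
move=> vS gF aE cE E2 gF2 aE2 cE2 pr fin; apply: contrapT => inf; move: fin.
have [F [FF [v Fv v0] [x nx]]] := proper_member vS gF2 pr.
have [F' [FF' g' hF']] := exchangeable_member vS gF2 aE2 cE2 FF.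
have [v' F'v' v'0] : exists2 v', F' v' & v' != 0.
  case: hF' => [->|[w hw F'E]]; first by exists v.
  apply: contrapT => h; apply: nx.
  have : perp w (perp w F) = F by case: gF2 => _ _ _ _; rewrite hw => /(_ F FF)[].
  move=> <- u Pu; have -> : u = 0.
    by apply: contrapT => /eqP u0; apply: h; exists u => //; rewrite F'E.
  by rewrite w0l.
apply: (infinite_flag_orbits vS gF aE cE gF2 FF' g' F'v' v'0 _ inf).
move=> hw; case: hF' => [->|[w hw']]; first by exists x.
by rewrite hw in hw'.
Qed.

Lemma codim_perp_seq w (s : seq V) : finite_codim_in setT (perp w [set` s]).
Proof.
elim: s => [|a s IH].
  rewrite (_ : perp _ _ = setT); first exact: codim_refl (subspaceT V).
  by apply/seteqP; split.
have := codim_inter (codim_kernel (subspaceT V) (form_scalar w a)) IH.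
rewrite (_ : _ `&` _ = perp w [set` a :: s]) //.
apply/seteqP; split=> [x [[_ /= ax] sx] u|x hx].
  by rewrite /= inE => /orP[/eqP->//|]; exact: sx.
split; first by split=> //=; apply: hx; rewrite /= inE eqxx.
by move=> u us; apply: hx; rewrite /= inE us orbT.
Qed.

Lemma perp_span w A : perp w (span A) = perp w A.
Proof.
apply/seteqP; split=> [|x Ax]; first by apply: perpS; exact: span_incl.
apply: (@span_min _ _ A [set u | w u x = 0]) => //.
split=> /= [|u v hu hv|a u hu]; first by rewrite w0l.
- by rewrite wDl hu hv addr0.
- by rewrite wZl hu mulr0.
Qed.

Lemma fin_member S E Fl F : admissible S E -> compatible E Fl -> Fl F ->
  fin F -> finite_dim F.
Proof. by move=> [bE _] cE /cE[A AE ->]; move=> /(fin_span_finite bE AE); exact: span_finite_dim bE AE. Qed.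

(** If F^perp has finite dimension, F = F^perp^perp is cut out by finitely many
equations. *)
Lemma medium_member S E Fl F : valid_structure S -> generalized_flag S Fl ->
  admissible S E -> compatible E Fl -> Fl F -> ~ finite_dim F ->
  ~ finite_codim_in setT F ->
  exists F', [/\ Fl F', exchangeable S F', ~ fin F' & form_of S = None -> ~ cofin F'].
Proof.
move=> vS gF aE cE FF nf nc.
have [F' [FF' g' hF']] := exchangeable_member vS gF aE cE FF.
exists F'; split=> //.
  move=> f; case: hF' => [e|[w hw e]].
    by apply: nf; apply: (fin_member aE cE FF); rewrite -e.
  apply: nc; have [B [_ BF'] /finite_seqP[s sB]] := fin_member aE cE FF' f.
  have <- : perp w (perp w F) = F by case: gF => _ _ _ _; rewrite hw => /(_ F FF)[].
  by rewrite -e -BF' perp_span sB; exact: codim_perp_seq.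
move=> hw [s hs]; case: hF' => [e|[w hw']]; last by rewrite hw in hw'.
apply: nc; apply/codimP; split=> //; first by rewrite -e; exact: g'.1.1.
by exists s; apply/seteqP; split=> //; rewrite -e.
Qed.

Lemma one_large S E1 E2 Fl1 Fl2 : valid_structure S ->
  generalized_flag S Fl1 -> admissible S E1 -> compatible E1 Fl1 ->
  generalized_flag S Fl2 -> admissible S E2 -> compatible E2 Fl2 ->
  finite_set (diag_orbits (ind_group S) (stabilizer S Fl1) (stabilizer S Fl2)) ->
  (forall F, Fl1 F -> finite_dim F \/ finite_codim_in setT F) \/
  (forall F, Fl2 F -> finite_dim F \/ finite_codim_in setT F).
Proof.
move=> vS g1 a1 c1 g2 a2 c2 fin; apply: contrapT => /not_orP[].
move=> /existsNP[F1 /not_implyP[FF1 /not_orP[nf1 nc1]]].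
move=> /existsNP[F2 /not_implyP[FF2 /not_orP[nf2 nc2]]].
have [F1' [FF1' g1' f1 k1]] := medium_member vS g1 a1 c1 FF1 nf1 nc1.
have [F2' [FF2' g2' f2 k2]] := medium_member vS g2 a2 c2 FF2 nf2 nc2.
apply: (medium_members_infinite vS g1 g2 FF1' FF2' g1' g2' f1 f2) fin.
by move=> hw; split; [exact: k1|exact: k2].
Qed.
End Necessity.

(** * Invariant subspaces of the stabilizer of a finite flag *)
Section ElementsOfStabilizers.
Variables (R : realType) (V : lmodType R[i]).
Local Notation K := (R[i]).
Implicit Types (g h : gl V) (S : vstructure V) (A C E X Y F W : set V) (Fl : set (set V)).
Implicit Types (w : {biscalar V}) (psi : V -> K) (e f u v x y : V).

(** Isotropic vectors; the condition is empty in type A. *)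
Definition iso S u := match form_of S with None => True | Some w => w u u = 0 end.

Lemma involution_coord w E i e x : basis_of setT E -> involution_for w E i ->
  E e -> w e x = coord E (i e) x * w e (i e).
Proof.
move=> bE [iE _ wi] Ee; have [Ei ii] := iE _ Ee.
rewrite (coord_form bE iE wi Ei) ii wZl mulrAC mulVf ?mul1r //.
by apply/eqP; apply/(wi _ _ Ee Ei).
Qed.

Lemma compat_coord E Fl F e x : basis_of setT E -> compatible E Fl -> Fl F ->
  F x -> coord E e x != 0 -> F e.
Proof.
move=> bE cE FF Fx cx; have [A AE FA] := cE _ FF; rewrite FA in Fx *.
by apply: span_incl; exact: (coord_span bE AE Fx cx).
Qed.

(** The Siegel transformation: it fixes e', maps e to u and is the identity on the
orthogonal of e, e' and u. The term along u - e alone is a transvection; the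
term along e', again a transvection, restores the form. *)
Lemma siegel S w e e' u : valid_structure S -> form_of S = Some w ->
  w e' e = 1 -> w e' u = 1 -> w e e = 0 -> w u u = 0 -> w e' e' = 0 ->
  exists2 g, ind_group S g & forall x,
    g x = x + w e' x *: (u - e) + (w e u * w e' x - w x (u - e)) *: e'.
Proof.
move=> vS hw e'e e'u ee uu e'e'.
have [[eps heps] _] := valid_eps vS hw; have symw := heps.2.
have eps1 := eps_sqr heps.
pose a := u - e; pose la x := w e u * w e' x - w x a.
pose z := w e u *: e' - eps *: a - la a *: e'.
have zE x : w z x = la x - la a * w e' x.
  by rewrite /z !wBl !wZl (symw a x) mulrA eps1 mul1r.
have ae' : w e' a = 0 by rewrite wBr e'u e'e subrr.
have Vz : V_star S (w z) by rewrite (V_star_form hw); exists z.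
have Ve : V_star S (w e') by rewrite (V_star_form hw); exists e'.
have [|g Gg gE] := @transvection _ _ S a (w e') vS Ve.
  by rewrite ae' addr0 oner_eq0.
have [|h Gh hE] := @transvection _ _ S e' (w z) vS Vz.
  have la0 : la e' = 0 by rewrite /la e'e' mulr0 sub0r ae' oppr0.
  by rewrite zE la0 e'e' mulr0 subr0 addr0 oner_eq0.
have hgE x : (h * g)%g x = x + w e' x *: a + la x *: e'.
  rewrite glM hE gE; congr (_ + _ *: _).
  by rewrite wDr wZr !zE ae' mulr0 subr0 mulrC subrK.
have hgE' x : (h * g)%g x = x + w e' x *: a + (w e u * w e' x - w x a) *: e'.
  by rewrite hgE.
exists (h * g)%g; last by move=> x; rewrite hgE.
apply/(ind_group_form _ hw); split; first exact: GL_inftyM.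
have aa : w a a = - (1 + eps) * w e u.
  by rewrite /a !form_linE uu ee (symw u e); ring.
move=> x y; rewrite !hgE'.
have h1 t : w t e' = eps * w e' t by exact: symw.
have h2 : w a e' = 0 by rewrite h1 ae' mulr0.
clearbody a; clear zE Vz hE hgE hgE' gE.
rewrite !wDl !wDr !wZl !wZr e'e' h2 ae' (h1 x) aa (symw a y).
ring: eps1.
Qed.

(** A member F containing a vector with nonzero coordinate along e contains e,
hence u. With a form, the term along the partner e' of e matters only for members
F not containing e'; these are orthogonal to e, so e and therefore u are in
F^perp, and the term vanishes on F. *)
Lemma move_to S E Fl e u : valid_structure S -> generalized_flag S Fl ->
  admissible S E -> compatible E Fl -> E e -> iso S e -> iso S u ->
  coord E e u = 1 -> (forall F, Fl F -> F e -> F u) ->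
  exists g, [/\ stabilizer S Fl g, g e = u & forall x, coord E e x = 0 ->
    (forall w, form_of S = Some w -> w x u = 0 /\ w x e = 0) -> g x = x].
Proof.
move=> vS gF aE cE Ee ie iu eu hF; have bE := aE.1.
have lc := coord_scalar bE e.
have cee : coord E e e = 1 by rewrite coord_basis // eqxx.
have sFl F : Fl F -> is_subspace F by case: gF => + _ _ _ _; exact.
move: ie iu; rewrite /iso; case hw : (form_of S) => [w|] ee uu; last first.
  have Vc := coord_V_star vS aE Ee.
  have [|g Gg gE] := @transvection _ _ S (u - e) (coord E e) vS Vc.
    by rewrite (scB lc) eu cee subrr addr0 oner_eq0.
  exists g; split.
  - apply: stabilizer_in => //; first exact/ind_group_typeA.
    move=> F x FF Fx; rewrite gE; apply: subsD => //; first exact: sFl.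
    have [->|/eqP cx] := pselect (coord E e x = 0).
      by rewrite scale0r; exact: subs0 (sFl _ FF).
    have Fe := compat_coord bE cE FF Fx cx.
    apply: subsZ; first exact: sFl.
    by apply: subsB => //; [exact: sFl|exact: hF].
  - by rewrite gE cee scale1r addrC subrK.
  - by move=> x cx _; rewrite gE cx scale0r addr0.
have [i hi] := admissible_form hw aE; have [iE _ wi] := hi.
have [Ei ii] := iE _ Ee.
have [[eps heps] _] := valid_eps vS hw.
pose e' := (w (i e) e)^-1 *: i e.
have cE' x : coord E e x = w e' x by rewrite (coord_form bE iE wi Ee).
have e'e' : w e' e' = 0.
  rewrite /e' wZl wZr [w (i e) (i e)](_ : _ = 0) ?mulr0 //.
  apply: contrapT => /(wi _ _ Ei Ei); rewrite ii => h.
  have /(wi e e Ee Ee) : e = i e by [].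
  by rewrite ee.
have [||g Gg gE] := @siegel S w e e' u vS hw _ _ ee uu e'e'.
- by rewrite -cE'.
- by rewrite -cE'.
exists g; split.
- apply: stabilizer_in => // F x FF Fx; have sF := sFl _ FF.
  rewrite gE; apply: subsD => //.
    apply: subsD => //; have [h|/eqP h] := pselect (w e' x = 0).
      by rewrite h scale0r; exact: subs0.
    have Fe : F e by apply: (compat_coord bE cE FF Fx); rewrite cE'.
    by apply: subsZ => //; apply: subsB => //; exact: hF.
  have [Fe'|nFe'] := pselect (F (i e)); first by do 2! apply: subsZ => //.
  have oe : perp w F e.
    move=> y Fy; apply: (orthC heps); rewrite (involution_coord y bE hi Ee).
    rewrite [coord _ _ _](_ : _ = 0) ?mul0r //.
    by apply: contrapT => /eqP h; apply: nFe'; exact: compat_coord bE cE FF Fy h.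
  have FP : Fl (perp w F) by case: gF => _ _ _ _; rewrite hw => /(_ F FF)[].
  have ou : perp w F u by exact: hF.
  rewrite [X in X *: e'](_ : _ = 0) ?scale0r; first exact: subs0.
  rewrite wBr (oe x Fx) (ou x Fx) subr0 subr0.
  have [->|/eqP h] := pselect (w e' x = 0); first by rewrite mulr0.
  have Fe : F e by apply: (compat_coord bE cE FF Fx); rewrite cE'.
  by rewrite (ou e Fe) mul0r.
- rewrite gE -(cE' e) cee scale1r wBr ee subr0 mulr1 subrr scale0r addr0.
  by rewrite addrC subrK.
- move=> x cx /(_ _ erefl)[xu xe]; rewrite gE -cE' cx scale0r mulr0 wBr xu xe.
  by rewrite !subr0 scale0r !addr0.
Qed.
End ElementsOfStabilizers.

Lemma finite_subsets (T : eqType) (A : set T) :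
  finite_set A -> finite_set [set B | B `<=` A].
Proof.
move=> /finite_seqP[s ->] {A}; elim: s => [|a s IH].
  apply: sub_finite_set (finite_set1 set0) => B h /=.
  by apply/seteqP; split=> // x /h.
pose ad B := [set a] `|` B : set T.
apply: (@sub_finite_set _ _ ([set B | B `<=` [set` s]] `|` (ad @` [set B | B `<=` [set` s]]))).
  move=> B hB; have sub : B `\ a `<=` [set` s].
    move=> x [/hB /=]; rewrite inE => /orP[/eqP->|//] n; by exfalso; apply: n.
  have [Ba|nBa] := pselect (B a).
    right; exists (B `\ a) => //; apply/seteqP; split=> [x [->//|[]//]|x Bx].
    by have [->|xa] := pselect (x = a); [left|right].
  left=> x Bx; apply: sub; split=> // xa; apply: nBa; rewrite -xa //.
by rewrite finite_setU; split=> //; exact: finite_image.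
Qed.

Section InvariantSubspaces.
Variables (R : realType) (V : lmodType R[i]).
Local Notation K := (R[i]).
Implicit Types (g h : gl V) (S : vstructure V) (A C E X Y F W : set V) (Fl : set (set V)).
Implicit Types (w : {biscalar V}) (psi : V -> K) (e f u v x y : V).

Section Fixed.
Variables (S : vstructure V) (E : set V) (Fl : set (set V)).
Hypotheses (vS : valid_structure S) (gF : generalized_flag S Fl)
  (aE : admissible S E) (cE : compatible E Fl).
Let bE : basis_of setT E := aE.1.
Let sFl F : Fl F -> is_subspace F.
Proof. by case: gF => + _ _ _ _; exact. Qed.
Let lc e : scalar (coord E e) := coord_scalar bE e.

Lemma dilation e c : E e -> 1 + c != 0 -> exists2 g, GL_infty (V_star S) g &
  (forall x, g x = x + (c * coord E e x) *: e) /\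
  forall F x, Fl F -> F x -> F (g x).
Proof.
move=> Ee c1.
have Vc := coord_V_star vS aE Ee.
have [|g Gg gE] := @transvection _ _ S (c *: e) (coord E e) vS Vc.
  by rewrite (scZ (lc e)) coord_basis // eqxx mulr1.
exists g => //; split=> [x|F x FF Fx]; rewrite gE; first by rewrite scalerA mulrC.
apply: subsD => //; first exact: sFl.
have [->|/eqP cx] := pselect (coord E e x = 0).
  by rewrite scale0r; exact: subs0 (sFl FF).
by do 2! [apply: subsZ; first exact: sFl]; exact: (compat_coord bE cE FF Fx cx).
Qed.

Variable W : set V.
Hypothesis invW : invariant_subspace (stabilizer S Fl) W.
Let sW : is_subspace W := invW.1.
Let actW g x : stabilizer S Fl g -> W x -> W (g x).
Proof. by move=> Pg Wx; apply: (invW.2 g Pg); exists x. Qed.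

(** Elements diagonal in E split off the component along e: a dilation in type A, a
reflection if e is not isotropic, and otherwise the element with eigenvalue 2 on
e and 1/2 on its partner, applied twice. *)
Lemma invariant_coord e x : E e -> W x -> coord E e x != 0 -> W e.
Proof.
move=> Ee Wx cx; case hw : (form_of S) => [w|]; last first.
  have [|g Gg [gE gFl]] := @dilation e 1 Ee; first by rewrite -mulr2n pnatr_eq0.
  have Pg : stabilizer S Fl g by apply: stabilizer_in => //; exact/ind_group_typeA.
  have := subsB sW (actW Pg Wx) Wx; rewrite gE mul1r addrC addKr.
  exact: subsZE.
have [i hi] := admissible_form hw aE; have [iE _ wi] := hi.
have [Ei ii] := iE _ Ee; have [[eps heps] _] := valid_eps vS hw.
have symw := heps.2.
have we t := involution_coord t bE hi Ee.
have wie t := involution_coord t bE hi Ei; rewrite ii in wie.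
have we' t : w t e = coord E (i e) t * w (i e) e by rewrite symw we mulrCA -symw.
have wie' t : w t (i e) = coord E e t * w e (i e) by rewrite symw wie mulrCA -symw.
have [fe|nfe] := pselect (i e = e).
  have [|g Gg [gE gFl]] := @dilation e (-2) Ee.
    by rewrite (_ : 1 + -2 = -1) ?oppr_eq0 ?oner_eq0 //; ring.
  have Pg : stabilizer S Fl g.
    apply: stabilizer_in => //; apply/(ind_group_form _ hw); split=> // y z.
    by rewrite !gE !form_linE (we z) (we' y) fe; ring.
  have := subsB sW (actW Pg Wx) Wx; rewrite gE [_ - x]addrC addKr.
  by apply: subsZE => //; rewrite mulf_neq0 // oppr_eq0 pnatr_eq0.
have cee : coord E e e = 1 by rewrite coord_basis // eqxx.
have cii : coord E (i e) (i e) = 1 by rewrite coord_basis // eqxx.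
have cei : coord E e (i e) = 0.
  by rewrite coord_basis //; case: eqP => // h; case: nfe.
have cie : coord E (i e) e = 0.
  by rewrite coord_basis //; case: eqP => // h; case: nfe.
have [|g Gg [gE gFl]] := @dilation e 1 Ee; first by rewrite -mulr2n pnatr_eq0.
have [|h Gh [hE hFl]] := @dilation (i e) (- 2^-1) Ei.
  have -> : 1 - 2^-1 = 2^-1 :> K by field.
  by rewrite invr_eq0 pnatr_eq0.
have pE y : (h * g)%g y = y + coord E e y *: e - (2^-1 * coord E (i e) y) *: i e.
  rewrite glM hE gE mul1r (scD (lc _)) (scZ (lc _)) cie mulr0 addr0.
  by rewrite mulNr scaleNr.
have Pp : stabilizer S Fl (h * g)%g.
  apply: stabilizer_in => //; last by move=> F y FF Fy; exact: hFl FF (gFl _ _ FF Fy).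
  apply/(ind_group_form _ hw); split; first exact: GL_inftyM.
  move=> y z; rewrite !pE !wBl !wBr !wDl !wDr !wZl !wZr (we z) (wie z) (we' y) (wie' y).
  have ee0 : w e e = 0 by rewrite we cie mul0r.
  have ii0 : w (i e) (i e) = 0 by rewrite wie cei mul0r.
  by rewrite ee0 ii0; field.
pose y := (h * g)%g x - x.
have Wy : W y by apply: subsB => //; exact: actW.
have yE : y = coord E e x *: e - (2^-1 * coord E (i e) x) *: i e.
  by rewrite /y pE addrAC (addrAC x) subrr add0r.
have : W ((h * g)%g y - 2^-1 *: y) by apply: subsB; [|exact: actW|exact: subsZ].
have -> : (h * g)%g y - 2^-1 *: y = (3 / 2 * coord E e x) *: e.
  have e1 : coord E e y = coord E e x.
    by rewrite yE (scB (lc _)) !(scZ (lc _)) cee cei mulr0 subr0 mulr1.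
  have e2 : coord E (i e) y = - (2^-1 * coord E (i e) x).
    by rewrite yE (scB (lc _)) !(scZ (lc _)) cii cie mulr0 sub0r mulr1.
  rewrite pE e1 e2 yE scalerBr !scalerA mulrN scaleNr opprK.
  set a := coord E e x; set b := coord E (i e) x; set c := (2^-1 * (2^-1 * b)) *: i e.
  have -> : (2^-1 * b) *: i e = c + c by rewrite /c -scalerDl; congr (_ *: _); field.
  rewrite opprB addrA -(addrA _ c c) (addrAC (a *: e)) subrK -scalerDl -scalerBl.
  by congr (_ *: _); field.
apply: subsZE => //; rewrite mulf_neq0 // mulf_neq0 ?invr_eq0 ?pnatr_eq0 //.
Qed.

(** A root element maps e to e + f. If f is the partner of e, then e + f need not be
isotropic, and the swap of e and f is used instead. *)
Lemma invariant_move e f : E e -> E f -> (forall F, Fl F -> F e <-> F f) ->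
  iso S e -> iso S f -> W e -> W f.
Proof.
move=> Ee Ef eqF ie jf We.
have [<-//|/eqP nef] := pselect (e = f).
have cef : coord E e f = 0 by rewrite coord_basis // (negbTE nef).
have cee : coord E e e = 1 by rewrite coord_basis // eqxx.
have gen : iso S (e + f) -> W f.
  move=> iu.
  have [|F FF Fe|g [Pg ge _]] := move_to vS gF aE cE Ee ie iu.
  - by rewrite (scD (lc _)) cee cef addr0.
  - by apply: subsD => //; [exact: sFl|exact/(eqF F FF)].
  have := subsB sW (actW Pg We) We; by rewrite ge addrC addKr.
move: ie jf gen; rewrite /iso; case hw : (form_of S) => [w|] ee ff gen; last exact: gen.
have [[eps heps] _] := valid_eps vS hw.
have [ef|/eqP ef] := pselect (w f e = 0).
  by apply: gen; rewrite !form_linE ee ff ef (orthC heps ef) !addr0.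
have [i hi] := admissible_form hw aE; have [iE _ wi] := hi.
have fE : f = i e.
  by apply/(wi e f Ee Ef) => /(orthC heps) h; rewrite h eqxx in ef.
have [Ei ii] := iE _ Ee.
have [g [psi [Gg Vp psiE gE]]] := form_swap vS hw ee ff ef.
have Pg : stabilizer S Fl g.
  apply: stabilizer_in => // F x FF Fx; rewrite gE.
  have [->|/eqP px] := pselect (psi x = 0).
    by rewrite scale0r addr0.
  suff Fe : F e.
    apply: subsD => //; first exact: sFl.
    apply: subsZ; first exact: sFl.
    by apply: subsB => //; [exact: sFl|exact/(eqF F FF)].
  have [cx|/eqP cx] := pselect (coord E e x = 0); last exact: compat_coord bE cE FF Fx cx.
  have [dx|/eqP dx] := pselect (coord E f x = 0); last first.
    by apply/(eqF F FF); exact: compat_coord bE cE FF Fx dx.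
  exfalso; move/eqP: px; apply; rewrite psiE wBr.
  have wxe : w x e = 0.
    by apply: (orthC heps); rewrite (involution_coord x bE hi Ee) -fE dx mul0r.
  have wxf : w x f = 0.
    by apply: (orthC heps); rewrite fE (involution_coord x bE hi Ei) ii cx mul0r.
  by rewrite wxe wxf subrr mul0r.
have wfe0 := ef.
have wef0 : w e f != 0 by apply: contra_neq ef => h; exact: orthC heps h.
have := actW Pg We; rewrite gE psiE wBr ee subr0 divff // scale1r addrC subrK.
exact.
Qed.
End Fixed.

(** An invariant subspace is spanned by basis vectors, and contains with a basis
vector all those of the same layer, apart from the at most one basis vector that
is not isotropic. *)
Lemma finite_invariant S E Fl : valid_structure S -> generalized_flag S Fl ->
  admissible S E -> compatible E Fl -> finite_set Fl ->
  finite_set (invariant_subspace (stabilizer S Fl)).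
Proof.
move=> vS gF aE cE fFl; have bE := aE.1.
pose lab e : set (set V) * Prop := ([set F | Fl F /\ F e], iso S e).
pose D W := lab @` (W `&` E).
pose I : set (set V) := invariant_subspace (stabilizer S Fl).
have inj : {in I &, injective D}.
  move=> W W' /set_mem iW /set_mem iW' DW.
  have sub X Y : invariant_subspace (stabilizer S Fl) X ->
      invariant_subspace (stabilizer S Fl) Y -> D X = D Y -> X `<=` Y.
    move=> iX iY DXY x Xx; apply: (span_coord bE); first by case: iY.
    move=> e Ee ce; have Xe := invariant_coord vS gF aE cE iX Ee Xx ce.
    have : D X (lab e) by exists e.
    rewrite DXY => -[f [Yf Ef]] [lab1 lab2].
    have eqF F : Fl F -> F f <-> F e.
      move=> FF; have /seteqP[h1 h2] := lab1.
      by split=> h; [have [] := h1 F (conj FF h)|have [] := h2 F (conj FF h)].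
    have [ie|nie] := pselect (iso S e).
      by apply: (invariant_move vS gF aE cE iY Ef Ee eqF) => //; rewrite lab2.
    suff <- : f = e by [].
    have nif : ~ iso S f by rewrite lab2.
    move: nie nif; rewrite /iso; case hw : (form_of S) => [w|] // ne nf.
    have [i [_ i1 wi]] := admissible_form hw aE.
    by apply: i1 => //; apply/esym/wi.
  by apply/seteqP; split; exact: sub.
rewrite -/I -(eq_finite_set (inj_card_eq inj)).
apply: (@sub_finite_set _ _ [set B | B `<=` [set G | G `<=` Fl] `*` [set: Prop]]).
  by move=> _ [W _ <-] _ [e _ <-] /=; split=> // F [].
apply: finite_subsets; apply: finite_setX; first exact: finite_subsets.
apply: (@sub_finite_set _ _ [set True; False]); last exact: finite_set2.
by move=> P _; have [p|p] := pselect P; [left|right]; apply/propext.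
Qed.
End InvariantSubspaces.

(** * Normal forms of finite tuples *)
Lemma finite_reps (T U : Type) (x0 : T) (f : T -> U) (A : set T) :
  finite_set (f @` A) ->
  exists B, [/\ finite_set B, B `<=` A & forall e, A e -> exists2 r, B r & f r = f e].
Proof.
move=> fA; have /choice[c hc] : forall y, exists x, (f @` A) y -> A x /\ f x = y.
  by move=> y; have [[x Ax <-]|n] := pselect ((f @` A) y); [exists x|exists x0].
exists (c @` (f @` A)); split; first exact: finite_image.
  by move=> _ [y /hc[] ? _ <-].
move=> e Ae; have fe : (f @` A) (f e) by exists e.
by exists (c (f e)); [exists (f e)|exact: (hc _ fe).2].
Qed.

(** Gaussian elimination in abstract form. The space M is V or its dual, P is the
group of available elements, B is a finite set of possible pivots, and u extends
a tuple already consisting of pivots. Only the spans of the prefixes of a tuple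
are normalized, because only they matter for flags. *)
Section NormalForm.
Variables (K : fieldType) (V M : lmodType K) (act : gl V -> M -> M).
Hypotheses (actM : forall g h x, act (g * h)%g x = act g (act h x))
  (act1 : forall x, act 1%g x = x) (act_lin : forall g, linear (act g)).
Variable P : set (gl V).
Hypotheses (P1 : P 1%g) (PM : forall g h, P g -> P h -> P (g * h)%g).
Variables (valid : seq M -> Prop) (fit : set M -> M -> Prop).
Hypotheses (valid0 : valid [::])
  (fitP : forall p D u, P p -> fit D u -> fit (act p @` D) (act p u))
  (step : forall s, valid s -> exists B, finite_set B /\
     forall u, fit (span [set` s]) u -> exists p r, [/\ P p, B r,
       valid (rcons s r), {in s, forall x, act p x = x}
       & exists2 c : K, c != 0 & span [set` s] (act p u - c *: r)]).

Lemma normal_form d : exists N : set (seq M), [/\ finite_set N,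
  forall s, N s -> valid s /\ size s = d
  & forall us, size us = d ->
    (forall j, (j < d)%N -> fit (span [set` take j us]) us`_j) ->
    exists2 p, P p & exists2 s, N s & forall j,
      act p @` span [set` take j us] = span [set` take j s]].
Proof.
have act_im g h X : act (g * h)%g @` X = act g @` (act h @` X).
  apply/seteqP; split=> [_ [x Xx <-]|_ [_ [x Xx <-] <-]]; last by exists x.
  by exists (act h x) => //; exists x.
elim: d => [|d [N [fN Nv IH]]].
  exists [set [::]]; split; first exact: finite_set1.
    by move=> _ ->.
  move=> us /size0nil -> _; exists 1%g => //; exists [::] => // j.
  by apply/seteqP; split=> [_ [x h <-]|x h]; [rewrite act1|exists x].
have /choice[B hB] : forall s, exists B, valid s -> finite_set B /\
     forall u, fit (span [set` s]) u -> exists p r, [/\ P p, B r,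
       valid (rcons s r), {in s, forall x, act p x = x}
       & exists2 c : K, c != 0 & span [set` s] (act p u - c *: r)].
  move=> s; have [/step[B hB]|n] := pselect (valid s); first by exists B.
  by exists set0.
exists ((\bigcup_(s in N) (rcons s @` B s)) `&` valid); split.
- apply: finite_setIl; apply: bigcup_finite => // s Ns; apply: finite_image.
  exact: (hB s (Nv s Ns).1).1.
- by move=> _ [[s Ns [r _ <-]] vr]; split=> //; rewrite size_rcons (Nv _ Ns).2.
elim/last_ind => // us u _; rewrite size_rcons => -[sus] hus.
have [|p Pp [s Ns ps]] := IH us sus.
  move=> j jd; have := hus j (ltnW jd); rewrite nth_rcons sus jd -cats1 takel_cat //.
  by rewrite sus ltnW.
have [vs ss] := Nv s Ns.
have psT : act p @` span [set` us] = span [set` s].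
  by have := ps d; rewrite -{1}sus -ss !take_size.
have fu : fit (span [set` s]) (act p u).
  rewrite -psT; apply: fitP => //.
  have := hus d (ltnSn d); rewrite nth_rcons sus ltnn eqxx -cats1 takel_cat ?sus //.
  by rewrite -{1}sus take_size.
have [q [r [Pq Br vr qs [c c0 hc]]]] := (hB s vs).2 _ fu.
exists (q * p)%g; first exact: PM.
exists (rcons s r); first by split=> //; exists s => //; exists r.
have qfix X : X `<=` span [set` s] -> act q @` X = X.
  move=> Xs; have qx := linear_fix_span (act_lin q) qs.
  by apply/seteqP; split=> [_ [x Xx <-]|x Xx]; [rewrite qx //; exact: Xs|exists x; rewrite // qx //; exact: Xs].
move=> j; rewrite act_im; have [jd|jd] := leqP j d.
  rewrite -!cats1 !takel_cat ?sus ?ss // ps qfix //.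
  by apply: spanS => x /= /mem_take.
rewrite !take_oversize ?size_rcons ?sus ?ss // !span_rcons.
rewrite !linear_im_adj // psT qfix //.
apply: adj_eq c0 hc; exact: subspace_span.
Qed.
End NormalForm.

Section VectorStep.
Variables (R : realType) (V : lmodType R[i]).
Local Notation K := (R[i]).
Implicit Types (g h p : gl V) (A C D X Y F W : set V) (s : seq V).
Implicit Types (w : {biscalar V}) (psi : V -> K) (e f u v x y r : V).
Variables (S : vstructure V) (E : set V) (Fl : set (set V)).
Hypotheses (vS : valid_structure S) (gF : generalized_flag S Fl)
  (aE : admissible S E) (cE : compatible E Fl) (fFl : finite_set Fl).
Let bE : basis_of setT E := aE.1.
Let sFl F : Fl F -> is_subspace F.
Proof. by case: gF => + _ _ _ _; exact. Qed.
Let ch : chain Fl.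
Proof. by case: gF. Qed.
Let lc e : scalar (coord E e) := coord_scalar bE e.

(** The condition is empty in type A. *)
Definition orth S u v :=
  match form_of S with None => True | Some w => w u v = 0 end.
Definition fit_vector S D u := [/\ ~ D u, iso S u & forall x, D x -> orth S x u].
Definition candidate s e := [/\ E e, iso S e, e \notin s & {in s, forall x, orth S x e}].
Definition valid_vectors s := [/\ uniq s, {in s, forall e, E e /\ iso S e}
  & {in s &, forall e f, orth S e f}].
Definition label e := [set F | Fl F /\ F e].

Lemma finite_labels A : finite_set (label @` A).
Proof.
apply: sub_finite_set (finite_subsets fFl).
by move=> _ [e _ <-] F [].
Qed.

Lemma layer_up F1 F2 F e : consecutive Fl F1 F2 -> Fl F -> F e -> ~ F1 e ->
  F2 `<=` F.
Proof.
move=> [f1 f2 [h12 n12] hc] FF Fe ne.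
have [h|h] := ch FF f1; first by exfalso; apply: ne; exact: h.
have [h'|//] := ch FF f2.
apply: contrapT => n; apply: (hc F FF); split; split=> //.
by move=> h''; apply: ne; exact: h''.
Qed.

Lemma orthC_S u v : orth S u v -> orth S v u.
Proof.
rewrite /orth; case hw : (form_of S) => [w|] //.
by have [[eps heps] _] := valid_eps vS hw; exact: orthC heps.
Qed.

(** Let F1, F2 be the layer of u. Unless an isotropic basis vector of the layer
occurs in u, the layer is the middle one and u = z + c e, where e is the basis
vector that is not isotropic and z is in F1, hence orthogonal to F1 and to e; then
w u u = c^2 w e e is not 0. *)
Lemma leading_vector u : u != 0 -> iso S u ->
  exists e, [/\ E e, iso S e, coord E e u != 0
    & forall F, Fl F -> F e -> F u].
Proof.
move=> /eqP u0 uu.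
have [F1 [F2 [c12 [F2u nF1u]]]] : exists F1 F2, consecutive Fl F1 F2 /\ (F2 `\` F1) u.
  by case: gF => _ _ _ + _; exact.
have [f1 f2 [h12 n12] hc] := c12.
suff [e [Ee ie ce ne]] : exists e, [/\ E e, iso S e, coord E e u != 0 & ~ F1 e].
  by exists e; split=> // F FF Fe; exact: (layer_up c12 FF Fe ne).
apply: contrapT => hno.
have [e [Ee ce ne]] : exists e, [/\ E e, coord E e u != 0 & ~ F1 e].
  apply: contrapT => h; apply: nF1u; apply: (span_coord bE) => //; first exact: sFl.
  by move=> e Ee ce; apply: contrapT => ne; apply: h; exists e.
have nie f : E f -> coord E f u != 0 -> ~ F1 f -> ~ iso S f.
  by move=> Ef cf nf fi; apply: hno; exists f.
have := nie e Ee ce ne; move: nie uu; rewrite /iso.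
case hw : (form_of S) => [w|] // nie uu ee.
have [[eps heps] _] := valid_eps vS hw.
have [i hi] := admissible_form hw aE; have [iE i1 wi] := hi.
have fix_ f : E f -> w f f <> 0 -> i f = f by move=> Ef /(wi f f Ef Ef).
pose z := u - coord E e u *: e.
have F1z : F1 z.
  apply: (span_coord bE) => //; first exact: sFl.
  move=> f Ef; rewrite (scB (lc _)) (scZ (lc _)) (coord_basis bE f Ee).
  case: (f =P e) => [->|fe]; first by rewrite mulr1 subrr eqxx.
  rewrite mulr0 subr0 => cf; apply: contrapT => nf; apply: fe.
  by apply: i1 => //; apply: fix_ => //; exact: nie cf nf.
have [A1 A1E F1E] := cE f1.
have oe x : F1 x -> w e x = 0.
  rewrite F1E; apply: (compat_orth hi A1E Ee); rewrite (fix_ e Ee ee) => Ae.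
  by apply: ne; rewrite F1E; exact: span_incl.
have FP : Fl (perp w F1) by case: gF => _ _ _ _; rewrite hw => /(_ F1 f1)[].
have F2P : F2 `<=` perp w F1.
  by apply: (layer_up c12 FP _ ne) => x /oe; exact: (orthC heps).
have zz : w z z = 0 by apply: (F2P z (h12 _ F1z)).
apply: ee; have ez := oe z F1z; have ze := orthC heps ez.
have uE : u = z + coord E e u *: e by rewrite subrK.
clearbody z; move: uu; rewrite {1 2}uE.
rewrite wDl !wDr !wZl !wZr zz ez ze !mulr0 !add0r => /eqP.
by rewrite !mulf_eq0 (negbTE ce) /= => /eqP.
Qed.

Lemma iso_add e f : iso S e -> iso S f -> orth S e f -> iso S (e + f).
Proof.
move=> + + /[dup] /orthC_S; rewrite /iso /orth; case: (form_of S) => [w|] // ee ff fe ef.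
by rewrite wDl !wDr ee ff ef fe !addr0.
Qed.

Lemma move_back s e u : E e -> iso S e -> iso S u -> coord E e u = 1 ->
  (forall F, Fl F -> F e -> F u) ->
  {in s, forall x, [/\ coord E e x = 0, orth S x u & orth S x e]} ->
  exists g, [/\ stabilizer S Fl g, g e = u, {in s, forall x, g x = x} &
   stabilizer S Fl (g^-1)%g /\ ((g^-1)%g u = e /\ {in s, forall x, (g^-1)%g x = x})].
Proof.
move=> Ee ie iu cu hF hs.
have [g [Pg ge gx]] := move_to vS gF aE cE Ee ie iu cu hF.
have gs : {in s, forall x, g x = x}.
  move=> x /hs[cx xu xe]; apply: gx => // w hw.
  by move: xu xe; rewrite /orth hw.
exists g; split=> //; split; first exact: stabilizerV.
split; first by rewrite -ge glK.
by move=> x xs; rewrite -{1}(gs x xs) glK.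
Qed.

Lemma candidate_coord s e x : {in s, forall f, E f} -> candidate s e -> x \in s ->
  coord E e x = 0.
Proof.
move=> sE [_ _ es _] xs; rewrite (coord_basis bE e (sE _ xs)).
by case: eqP => // ex; rewrite ex xs in es.
Qed.

(** Both e and r can be moved to e + r. *)
Lemma candidate_swap s e r : {in s, forall f, E f} -> candidate s e -> candidate s r ->
  e != r -> orth S e r -> label e = label r ->
  exists p, [/\ stabilizer S Fl p, p e = r & {in s, forall x, p x = x}].
Proof.
move=> sE ce cr er oer /seteqP[l1 l2].
have [Ee ie _ ve] := ce; have [Er ir _ vr] := cr.
have iu : iso S (e + r) by exact: iso_add.
have ou x : x \in s -> orth S x (e + r).
  move=> xs; move: (ve x xs) (vr x xs); rewrite /orth; case: (form_of S) => // w a b.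
  by rewrite wDr a b addr0.
have [||x xs|g [Pg ge gs _]] := @move_back s e (e + r) Ee ie iu.
- by rewrite (scD (lc _)) !coord_basis // eqxx (negbTE er) addr0.
- move=> F FF Fe; apply: subsD => //; first exact: sFl.
  by have [] := l1 F (conj FF Fe).
- by split; [exact: candidate_coord sE ce xs|exact: ou|exact: ve].
have [||x xs|h [_ _ _ [Ph [hu hs]]]] := @move_back s r (e + r) Er ir iu.
- by rewrite (scD (lc _)) !coord_basis // eqxx eq_sym (negbTE er) add0r.
- move=> F FF Fr; apply: subsD => //; first exact: sFl.
  by have [] := l2 F (conj FF Fr).
- by split; [exact: candidate_coord sE cr xs|exact: ou|exact: vr].
exists (h^-1 * g)%g; split; first exact: stabilizerM.
  by rewrite glM ge.
by move=> x xs; rewrite glM gs // hs.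
Qed.

Lemma clear_coordinates s u : uniq s -> {in s, forall e, E e} ->
  exists u1, span [set` s] (u - u1) /\ {in s, forall e, coord E e u1 = 0}.
Proof.
move=> us sE; pose z := \sum_(e <- s) coord E e u *: e.
have zs : span [set` s] z.
  apply: subs_sum; first exact: subspace_span.
  by move=> e es; exact: subsZ (subspace_span [set` s]) (span_incl es).
have cz e : e \in s -> coord E e z = coord E e u.
  by move=> es; rewrite (@coordE _ _ _ bE z s (coord E ^~ u)) ?es.
exists (u - z); split; first by rewrite opprB addrC subrK.
by move=> e es; rewrite (scB (lc _)) cz // subrr.
Qed.

(** Once its coordinates along s are cleared, u can be moved to a multiple of its
leading basis vector e, and e to the chosen representative of its layer. The
latter fails only if the representative is the partner of e, which is why B
contains the partners of the representatives as well. *)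
Lemma vector_step s : valid_vectors s -> exists B, finite_set B /\
  forall u, fit_vector S (span [set` s]) u -> exists p r,
  [/\ stabilizer S Fl p, B r, valid_vectors (rcons s r), {in s, forall x, p x = x}
    & exists2 c : K, c != 0 & span [set` s] (p u - c *: r)].
Proof.
move=> [us sEi so]; have sE : {in s, forall e, E e} by move=> e /sEi[].
have [B0 [fB0 B0c hB0]] := finite_reps 0 (finite_labels (candidate s)).
pose B := B0 `|` [set e | E e /\ exists2 r, B0 r & ~ orth S r e].
exists B; split.
  rewrite finite_setU; split=> //; rewrite /orth; case hw : (form_of S) => [w|]; last first.
    by apply: sub_finite_set (finite_set0 _) => e [_ [r _]]; apply.
  have [i [iE _ wi]] := admissible_form hw aE.
  apply: sub_finite_set (finite_image i fB0) => e [Ee [r Br re]].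
  exists r => //; apply/esym/wi => //; by case: (B0c _ Br).
move=> u [nu iu ou].
have [u1 [hu1 cu1]] := clear_coordinates u us sE.
have ss := subspace_span [set` s].
have u1E : u = (u - u1) + u1 by rewrite subrK.
have ou1 x : span [set` s] x -> orth S x u1.
  move=> hx; move: (ou x hx); rewrite /orth; case hw : (form_of S) => [w|] // xu.
  suff xs : w x (u - u1) = 0 by move: xu; rewrite {1}u1E wDr xs add0r.
  move: x hx {xu}; apply: (@span_min _ _ _ [set x | w x (u - u1) = 0]).
    split=> /= [|a b ha hb|a b hb]; rewrite ?w0l ?wDl ?wZl ?ha ?hb ?mulr0 ?addr0 //.
  move=> e es; move: hu1; move: (u - u1); apply: span_min.
    exact: subspace_ker (form_scalar w e).
  by move=> f fs; have := so e f es fs; rewrite /orth hw.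
have iu1 : iso S u1.
  have ou' := ou1 _ hu1; have c := orthC_S ou'; have b := ou _ hu1.
  move: u1E b ou' c iu; move: (u - u1) => d ->.
  rewrite /iso /orth; case: (form_of S) => // w.
  rewrite wDl !wDr => b a c; rewrite a c addr0 add0r in b *.
  by rewrite b add0r.
have u10 : u1 != 0.
  by apply/eqP => u10; apply: nu; rewrite u10 subr0 in hu1.
have [e [Ee ie ce hF]] := leading_vector u10 iu1.
set c := coord E e u1 in ce.
have es : e \notin s by apply: contra_neqN ce => /cu1.
have ve : {in s, forall x, orth S x e}.
  move=> x xs; have := ou1 x (span_incl xs); rewrite /orth.
  case hw : (form_of S) => [w|] // xu1; apply: contrapT.
  have [i hi] := admissible_form hw aE; have [iE i1 wi] := hi.
  move=> /(wi _ _ (sE _ xs) Ee) eE; move/eqP: ce; apply.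
  move: xu1; rewrite (involution_coord u1 bE hi (sE _ xs)) -eE => /eqP.
  rewrite mulf_eq0 => /orP[/eqP //|/eqP xe]; exfalso.
  by apply: (proj2 (wi _ _ (sE _ xs) Ee) eE).
have cande : candidate s e by [].
pose u2 := c^-1 *: u1.
have iu2 : iso S u2.
  by move: iu1; rewrite /iso; case: (form_of S) => // w h; rewrite wZl wZr h !mulr0.
have [||x xs|g [_ _ _ [Pg [gu gs]]]] := @move_back s e u2 Ee ie iu2.
- by rewrite (scZ (lc _)) mulVf.
- by move=> F FF Fe; apply: subsZ; [exact: sFl|exact: hF].
- split; [exact: candidate_coord sE cande xs| |exact: ve].
  have := ou1 x (span_incl xs); rewrite /orth; case: (form_of S) => // w h.
  by rewrite wZr h mulr0.
have fin_ q r : stabilizer S Fl q -> q e = r -> {in s, forall x, q x = x} ->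
   candidate s r -> B r -> exists p r,
  [/\ stabilizer S Fl p, B r, valid_vectors (rcons s r), {in s, forall x, p x = x}
    & exists2 c : K, c != 0 & span [set` s] (p u - c *: r)].
  move=> Pq qe qs [Er ir rs vr] Br; exists (q * g^-1)%g, r.
  have qgs : {in s, forall x, (q * g^-1)%g x = x}.
    by move=> x xs; rewrite glM gs // qs.
  split=> //.
  - exact: stabilizerM.
  - split.
    + by rewrite rcons_uniq rs us.
    + by move=> x; rewrite mem_rcons inE => /orP[/eqP->|/sEi].
    + have rr : orth S r r by [].
      move=> x y; rewrite !mem_rcons !inE => /orP[/eqP->|xs] /orP[/eqP->|ys] //.
      * by apply: orthC_S; exact: vr.
      * exact: vr.
      * exact: so.
  - exists c => //.
    have -> : (q * g^-1)%g u - c *: r = u - u1.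
      have fd := linear_fix_span (gl_linear (q * g^-1)%g) qgs hu1.
      have fu1 : (q * g^-1)%g u1 = c *: r.
        have {1}-> : u1 = c *: u2 by rewrite scalerA divff // scale1r.
        by rewrite linearZ [X in _ *: X](_ : _ = q ((g^-1)%g u2)) // gu qe.
      have -> : (q * g^-1)%g u = (q * g^-1)%g (u - u1) + (q * g^-1)%g u1.
        by rewrite -linearD subrK.
      by rewrite fd fu1 addrK.
    exact: hu1.
have [r Br lr] := hB0 e cande.
have [er|er] := eqVneq e r.
  apply: (fin_ 1%g e) => //; first exact: stabilizer1.
  by left; rewrite er.
have [oer|noer] := pselect (orth S e r).
  have [p [Pp pe ps]] := candidate_swap sE cande (B0c _ Br) er oer (esym lr).
  by apply: (fin_ p r) => //; [exact: B0c|left].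
apply: (fin_ 1%g e) => //; first exact: stabilizer1.
right; split=> //; exists r => // h; apply: noer; exact: orthC_S.
Qed.
End VectorStep.

Lemma seq_least (T : eqType) (le : T -> T -> Prop) (L : seq T) :
  (forall a b c, le a b -> le b c -> le a c) ->
  {in L &, forall a b, le a b \/ le b a} -> L <> [::] ->
  exists2 m, m \in L & {in L, forall a, le m a}.
Proof.
move=> tr; elim: L => // a L IH tot _.
have aa : le a a by have [] := tot a a (mem_head _ _) (mem_head _ _).
have [L0|/eqP L0] := eqVneq L [::].
  by exists a; [exact: mem_head|move=> b; rewrite L0 inE => /eqP->].
have [|m mL hm] := IH _ L0.
  by move=> x y xL yL; apply: tot; rewrite inE ?xL ?yL orbT.
have maL : m \in a :: L by rewrite inE mL orbT.
have [am|ma] := tot a m (mem_head _ _) maL.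
  exists a; first exact: mem_head.
  by move=> b; rewrite inE => /orP[/eqP->//|/hm]; exact: tr.
exists m => //.
by move=> b; rewrite inE => /orP[/eqP->//|/hm].
Qed.

(** The largest set is completed last. *)
Lemma chain_prefixes (T : eqType) (L : seq (set T)) :
  {in L &, forall A B, A `<=` B \/ B `<=` A} ->
  {in L, forall A, finite_set A} ->
  exists us, [/\ uniq us, {in us, forall x, exists2 A, A \in L & A x}
    & {in L, forall A, exists j, A = [set` take j us]}].
Proof.
have [n] := ubnP (size L); elim: n L => // n IH L; rewrite ltnS => sL tot fin.
have [L0|/eqP L0] := eqVneq L [::]; first by exists [::]; rewrite L0.
have [||A0 A0L hA0] := @seq_least _ (fun A B : set T => B `<=` A) L _ _ L0.
- by move=> A B C AB BC; exact: subset_trans BC AB.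
- by move=> A B AL BL; have [] := tot A B AL BL; [right|left].
pose L' := [seq A <- L | A != A0].
have sub : {subset L' <= L} by move=> A; rewrite mem_filter => /andP[].
have [|||us [uus usL pre]] := IH L'.
- apply: leq_trans sL; rewrite size_filter -(count_predC (pred1 A0) L).
  rewrite -[X in (X < _)%N]add0n ltn_add2r -has_count; apply/hasP.
  by exists A0 => /=.
- by move=> A B /sub AL /sub BL; exact: tot.
- by move=> A /sub; exact: fin.
have /finite_seqP[s0 s0E] := fin _ A0L.
have usA0 x : x \in us -> A0 x.
  by move=> /usL[A /sub AL Ax]; exact: hA0 Ax.
exists (us ++ [seq x <- undup s0 | x \notin us]); split.
- rewrite cat_uniq uus filter_uniq ?undup_uniq // andbT /=.
  by apply/hasPn => x; rewrite mem_filter => /andP[].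
- move=> x; rewrite mem_cat => /orP[/usL[A /sub AL Ax]|]; first by exists A.
  rewrite mem_filter mem_undup => /andP[_ xs]; exists A0 => //.
  by rewrite s0E.
- move=> A AL; have [->|AA0] := eqVneq A A0.
    exists (size (us ++ [seq x <- undup s0 | x \notin us])); rewrite take_size.
    apply/seteqP; split=> x /=.
      move=> A0x; rewrite mem_cat mem_filter mem_undup.
      have -> : x \in s0 by move: A0x; rewrite s0E.
      by rewrite andbT orbN.
    rewrite mem_cat => /orP[/usA0//|]; rewrite mem_filter mem_undup s0E.
    by case/andP.
  have [|j jE] := pre A; first by rewrite mem_filter AA0.
  exists (minn j (size us)); rewrite takel_cat ?geq_minr // jE.
  by case: (leqP j (size us)) => // h; rewrite take_oversize ?take_size // ltnW.
Qed.

Lemma eval_sum (K : fieldType) (V : lmodType K) (t : seq V) (c : V -> K)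
  (F : V -> V -> K^o) x :
  (\sum_(e <- t) c e *: F e) x = \sum_(e <- t) c e * F e x.
Proof. by elim: t => [|a t IH]; rewrite ?big_nil // !big_cons -IH. Qed.

Section CovectorStep.
Variables (R : realType) (V : lmodType R[i]).
Local Notation K := (R[i]).
Implicit Types (g h p : gl V) (A C X Y F W : set V) (s t : seq V).
Implicit Types (phi psi om : V -> K^o) (e f u v x y r : V).
Variables (S : vstructure V) (E : set V) (Fl : set (set V)).
Hypotheses (vS : valid_structure S) (gF : generalized_flag S Fl)
  (aE : admissible S E) (cE : compatible E Fl) (fFl : finite_set Fl).
Hypothesis typeA : form_of S = None.
Let bE : basis_of setT E := aE.1.
Let sFl F : Fl F -> is_subspace F.
Proof. by case: gF => + _ _ _ _; exact. Qed.
Let lc e : scalar (coord E e) := coord_scalar bE e.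
Let Vc e : E e -> V_star S (coord E e) := coord_V_star vS aE.

(** The dual of leading_vector: the smallest member on which phi does not vanish
contains a basis vector at which phi does not vanish. *)
Lemma leading_covector phi : scalar phi -> phi != 0 ->
  exists f, [/\ E f, phi f != 0 &
    forall F, Fl F -> ~ F f -> forall x, F x -> phi x = 0].
Proof.
move=> lp phi0.
have [v pv] : exists v, phi v != 0.
  apply: contrapT => h; move/eqP: phi0; apply; apply/funext => x.
  by apply: contrapT => /eqP px; apply: h; exists x.
have v0 : v <> 0 by move=> v0; rewrite v0 (sc0 lp) eqxx in pv.
have [F1 [F2 [[_ FF2 _ _] [F2v _]]]] : exists F1 F2, consecutive Fl F1 F2 /\ (F2 `\` F1) v.
  by case: gF => _ _ _ + _; exact.
have /finite_seqP[L LE] : finite_set [set F | Fl F /\ exists2 x, F x & phi x != 0].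
  by apply: sub_finite_set fFl => F [].
have inL F : F \in L <-> Fl F /\ exists2 x, F x & phi x != 0.
  by have /seteqP[h1 h2] := LE; split=> [/h2|/h1].
have [|||F FL hF] := @seq_least _ (fun A B : set V => A `<=` B) L.
- by move=> A B C; exact: subset_trans.
- by case: gF => _ ch _ _ _ A B /inL[AF _] /inL[BF _]; exact: ch.
- move=> L0; suff : F2 \in L by rewrite L0.
  by apply/inL; split=> //; exists v.
have [FF [x Fx px]] := (inL F).1 FL.
have [A AE FA] := cE FF.
have [f [Af pf]] : exists f, A f /\ phi f != 0.
  apply: contrapT => h; move/eqP: px; apply.
  rewrite FA in Fx; move: x Fx; apply: (@span_min _ _ A [set x | phi x = 0]).
    exact: subspace_ker.
  by move=> f Af; apply: contrapT => /eqP pf; apply: h; exists f.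
exists f; split=> //; first exact: AE.
move=> F' FF' nf y F'y; apply: contrapT => /eqP py; apply: nf.
by apply: (hF F'); [apply/inL; split=> //; exists y|rewrite FA; exact: span_incl].
Qed.

(** The dual of move_to: g is id + (om - e_f) f, with e_f the coordinate along f,
so that e_f o g = om. *)
Lemma comove om f : V_star S om -> E f -> om f = 1 ->
  (forall F, Fl F -> ~ F f -> forall x, F x -> om x = 0) ->
  exists g, [/\ stabilizer S Fl g,
    dual_act g om = coord E f,
    forall x, om x = coord E f x -> g x = x
    & forall e, E e -> e != f -> dual_act g (coord E e : V -> K^o) = coord E e].
Proof.
move=> Vom Ef omf hF; have lo := V_star_scalar vS Vom.
have cff : coord E f f = 1 by rewrite coord_basis // eqxx.
have Vd : V_star S (om - (coord E f : V -> K^o)).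
  by apply: (subsB (V_star_subspace vS)) => //; exact: Vc.
have [|g Gg gE] := @transvection _ _ S f (om - (coord E f : V -> K^o)) vS Vd.
  by rewrite [X in 1 + X](_ : _ = om f - coord E f f) // omf cff subrr addr0 oner_eq0.
have gE' x : g x = x + (om x - coord E f x) *: f by exact: gE.
have fix_ phi : (forall x, phi (g x) = om x) -> dual_act g om = phi.
  by move=> h; apply/funext => x; rewrite /dual_act /= -h glVK.
exists g; split.
- apply: stabilizer_in => //; first exact/ind_group_typeA.
  move=> F x FF Fx; rewrite gE'; apply: subsD => //; first exact: sFl.
  have [Ff|nFf] := pselect (F f); first by apply: subsZ => //; exact: sFl.
  rewrite (hF F FF nFf x Fx) [coord _ _ _](_ : _ = 0).
    by rewrite subrr scale0r; exact: subs0 (sFl FF).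
  by apply: contrapT => /eqP cx; apply: nFf; exact: (compat_coord bE cE FF Fx cx).
- apply: fix_ => x; rewrite gE' (scD (lc _)) (scZ (lc _)) cff mulr1.
  by rewrite addrC subrK.
- by move=> x h; rewrite gE' h subrr scale0r addr0.
- move=> e Ee ef; apply/funext => x; rewrite /dual_act /=.
  rewrite -{2}(glVK g x) gE' (scD (lc _)) (scZ (lc _)) (coord_basis bE e Ef) (negbTE ef).
  by rewrite mulr0 addr0.
Qed.

Variable s0 : seq V.
Hypothesis s0E : {in s0, forall e, E e}.

Definition fix_stab : set (gl V) :=
  [set p | stabilizer S Fl p /\ {in s0, forall x, p x = x}].
Definition fit_covector (D : set (V -> K^o)) phi :=
  [/\ V_star S phi, ~ D phi & {in s0, forall x, phi x = 0}].
Definition covectors t : seq (V -> K^o) := [seq (coord E e : V -> K^o) | e <- t].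
Definition valid_covectors (q : seq (V -> K^o)) :=
  exists t, [/\ uniq t, {in t, forall e, E e /\ e \notin s0} & q = covectors t].

Lemma fix_stabV p : fix_stab p -> fix_stab (p^-1)%g.
Proof.
move=> [Pp ps]; split; first exact: stabilizerV.
by move=> x xs; rewrite -{1}(ps x xs) glK.
Qed.
Lemma fix_stabM p q : fix_stab p -> fix_stab q -> fix_stab (p * q)%g.
Proof.
move=> [Pp ps] [Pq qs]; split; first exact: stabilizerM.
by move=> x xs; rewrite glM qs // ps.
Qed.
Lemma fix_stab1 : fix_stab 1%g.
Proof. by split=> //; exact: stabilizer1. Qed.

Lemma coord_s0 e x : E e -> e \notin s0 -> x \in s0 -> coord E e x = 0.
Proof.
move=> Ee es xs; rewrite (coord_basis bE e (s0E xs)).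
by case: eqP => // ex; rewrite ex xs in es.
Qed.

Lemma dual_act_V_star g phi : GL_infty (V_star S) g -> V_star S phi ->
  V_star S (dual_act g phi).
Proof. by move=> [VE _ _] Vphi; rewrite -VE; exists phi. Qed.

Lemma fit_covectorP p D phi : fix_stab p -> fit_covector D phi ->
  fit_covector (dual_act p @` D) (dual_act p phi).
Proof.
move=> Pp [Vphi nD p0]; have [Pp' _] := Pp; have [[Gp _] _] := (Pp.1, I).
split.
- by apply: dual_act_V_star => //; exact: ind_group_GL Gp.
- move=> [psi Dpsi e]; apply: nD.
  by rewrite -(dual_actVK p phi) -e dual_actVK.
- move=> x xs; change (phi ((p^-1)%g x) = 0).
  by rewrite ((fix_stabV Pp).2 x xs) p0.
Qed.

Lemma dual_act_linear g : linear (dual_act g).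
Proof. by []. Qed.

(** Both coordinate functionals are images of their sum. *)
Lemma covector_swap t f r : {in t, forall e, E e} -> E f -> E r ->
  f \notin s0 -> r \notin s0 -> f \notin t -> r \notin t -> f != r ->
  label Fl f = label Fl r ->
  exists p, [/\ fix_stab p, dual_act p (coord E f : V -> K^o) = coord E r &
    {in covectors t, forall psi, dual_act p psi = psi}].
Proof.
move=> tE Ef Er fs rs ft rt fr /seteqP[l1 l2].
pose om : V -> K^o := (coord E f : V -> K^o) + (coord E r : V -> K^o).
have omE x : om x = coord E f x + coord E r x by [].
have Vom : V_star S om by apply: (subsD (V_star_subspace vS)); exact: Vc.
have hF F : Fl F -> ~ F f \/ ~ F r -> forall x, F x -> om x = 0.
  move=> FF nF x Fx.
  have [nf nr] : ~ F f /\ ~ F r.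
    case: nF => n; split=> // h; apply: n.
      by have [] := l2 F (conj FF h).
    by have [] := l1 F (conj FF h).
  have vanish e : ~ F e -> coord E e x = 0.
    move=> ne; apply: contrapT => /eqP cx; apply: ne.
    exact: (compat_coord bE cE FF Fx cx).
  by rewrite omE (vanish f nf) (vanish r nr) addr0.
have [||g [Pg ge gx gt]] := comove Vom Ef.
- by rewrite omE !coord_basis // eqxx eq_sym (negbTE fr) addr0.
- by move=> F FF nf; apply: hF => //; left.
have [||h [Ph he hx ht]] := comove Vom Er.
- by rewrite omE !coord_basis // eqxx (negbTE fr) add0r.
- by move=> F FF nr; apply: hF => //; right.
have fixg k e : (forall x, om x = coord E e x -> k x = x) -> E e -> e \notin s0 ->
    {in s0, forall x, k x = x}.
  move=> hk Ee es x xs; apply: hk.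
  by rewrite omE !coord_s0 // addr0.
have fg : fix_stab g by split=> //; exact: fixg gx Ef fs.
have fh : fix_stab h by split=> //; exact: fixg hx Er rs.
exists (h * g^-1)%g; split.
- by apply: fix_stabM => //; exact: fix_stabV.
- by rewrite dual_actM -ge dual_actVK.
- move=> _ /mapP[e et ->]; rewrite dual_actM.
  have Ee := tE _ et.
  have ef : e != f by apply: contraNneq ft => <-.
  have er : e != r by apply: contraNneq rt => <-.
  by rewrite -{1}(gt e Ee ef) dual_actVK ht.
Qed.

(** The elimination of vector_step for functionals, by elements that keep the vectors
s0 which are already normalized. *)
Lemma covector_step q : valid_covectors q -> exists B, finite_set B /\
  forall phi, fit_covector (span [set` q]) phi -> exists p psi,
  [/\ fix_stab p, B psi, valid_covectors (rcons q psi), {in q, forall om, dual_act p om = om}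
    & exists2 c : K, c != 0 & span [set` q] (dual_act p phi - c *: psi)].
Proof.
move=> [t [ut tE ->]]; set q' := covectors t.
pose cand := [set e | [/\ E e, e \notin s0 & e \notin t]].
have [B0 [fB0 B0c hB0]] := finite_reps 0 (finite_labels fFl cand).
exists ((fun e => coord E e : V -> K^o) @` B0); split; first exact: finite_image.
move=> phi [Vphi nD p0].
have sV := V_star_subspace vS; have sD := subspace_span [set` q'].
pose z := \sum_(e <- t) phi e *: (coord E e : V -> K^o).
pose phi1 := phi - z.
have zD : span [set` q'] z.
  apply: subs_sum => // e et; apply: (subsZ _ sD).
  by apply: span_incl; exact: map_f.
have zE x : z x = \sum_(e <- t) phi e * coord E e x.
  exact: eval_sum.
have zt e : e \in t -> z e = phi e.
  move=> et; rewrite zE (bigD1_seq e) //= (coord_basis bE e (tE e et).1) eqxx mulr1.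
  rewrite big1_seq ?addr0 // => f /andP[fe ft].
  by rewrite (coord_basis bE f (tE e et).1) (negbTE fe) mulr0.
have Vz : V_star S z.
  by apply: subs_sum => // e et; apply: (subsZ _ sV); apply: Vc; case: (tE e et).
have V1 : V_star S phi1 by exact: (subsB sV).
have l1 := V_star_scalar vS V1.
have p1E x : phi1 x = phi x - z x by [].
have p1t e : e \in t -> phi1 e = 0 by move=> et; rewrite p1E zt // subrr.
have p1s x : x \in s0 -> phi1 x = 0.
  move=> xs; rewrite p1E p0 // zE big1_seq ?subrr // => e /= et.
  by have [Ee es] := tE e et; rewrite coord_s0 // mulr0.
have p10 : phi1 != 0.
  apply/eqP => h; apply: nD; rewrite -(subrK z phi) -/phi1 h add0r //.
have [f [Ef pf hF]] := leading_covector l1 p10.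
set c := phi1 f in pf.
have fs : f \notin s0 by apply: contra_neqN pf => /p1s.
have ft : f \notin t by apply: contra_neqN pf => /p1t.
pose om := c^-1 *: phi1.
have omE x : om x = c^-1 * phi1 x by [].
have Vom : V_star S om by exact: (subsZ _ sV).
have [||g [Pg ge gx gt]] := comove Vom Ef.
- by rewrite omE mulVf.
- by move=> F FF nf x Fx; rewrite omE (hF F FF nf x Fx) mulr0.
have fg : fix_stab g.
  by split=> // x xs; apply: gx; rewrite omE p1s // mulr0 coord_s0.
have gq : {in q', forall psi, dual_act g psi = psi}.
  move=> _ /mapP[e et ->]; apply: gt; first by case: (tE e et).
  by apply: contraNneq ft => <-.
have [r Br lr] := hB0 f (And3 Ef fs ft).
have [Er rs rt] := B0c _ Br.
have [p [Pp pf' pq]] : exists p, [/\ fix_stab p, dual_act p (coord E f : V -> K^o) = coord E r &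
    {in q', forall psi, dual_act p psi = psi}].
  have [<-|fr] := eqVneq f r.
    by exists 1%g; split=> //; exact: fix_stab1.
  by apply: covector_swap => //; by move=> e /tE[].
have pgq : {in q', forall psi, dual_act (p * g)%g psi = psi}.
  by move=> psi hp; rewrite dual_actM gq // pq.
exists (p * g)%g, (coord E r : V -> K^o); split=> //.
- exact: fix_stabM.
- by exists r.
- exists (rcons t r); split.
  + by rewrite rcons_uniq rt.
  + by move=> e; rewrite mem_rcons inE => /orP[/eqP->|/tE].
  + by rewrite /covectors map_rcons.
- exists c => //.
  have fz := linear_fix_span (@dual_act_linear (p * g)%g) pgq zD.
  have e1 : dual_act (p * g)%g phi1 = c *: (coord E r : V -> K^o).
    have -> : phi1 = c *: om by rewrite scalerA divff // scale1r.
    by rewrite -pf' -ge.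
  have -> : dual_act (p * g)%g phi = dual_act (p * g)%g z + dual_act (p * g)%g phi1.
    by apply/funext => x; rewrite /dual_act /phi1 /= addrC subrK.
  by rewrite fz e1 addrK.
Qed.
End CovectorStep.

(** * A large flag and a finite flag *)
Section Sufficiency.
Variables (R : realType) (V : lmodType R[i]).
Local Notation K := (R[i]).
Implicit Types (g h k p : gl V) (A C E X Y F : set V) (Fl : set (set V)).
Implicit Types (S : vstructure V) (w : {biscalar V}) (e f u v x y : V).

(** Elements with a common normal form d differ by the stabilizer of Fl1 on the
right; the elimination multiplies by the stabilizer of Fl2 on the left. *)
Lemma finite_by_data S Fl1 Fl2 (T : Type) (D : set T) (Rk : gl V -> T -> Prop) :
  valid_structure S -> generalized_flag S Fl1 -> generalized_flag S Fl2 ->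
  finite_set D ->
  (forall g, ind_group S g -> exists2 q, stabilizer S Fl2 q &
     exists2 d, D d & Rk (q * g)%g d) ->
  (forall k k' d, ind_group S k -> ind_group S k' -> Rk k d -> Rk k' d ->
     forall F, Fl1 F -> k @` F = k' @` F) ->
  finite_set (diag_orbits (ind_group S) (stabilizer S Fl2) (stabilizer S Fl1)).
Proof.
move=> vS gF1 gF2 fD h1 h2.
have /choice[c hc] : forall d, exists k, ind_group S k /\
    ((exists k', ind_group S k' /\ Rk k' d) -> Rk k d).
  move=> d; have [[k [Gk Rkd]]|n] := pselect (exists k, ind_group S k /\ Rk k d).
    by exists k.
  by exists 1%g; split=> //; exact: ind_group1.
apply: (finite_orbits_intro (N := c @` D) (subgrp_ind vS) (subgrp_stab vS gF2)
  (subgrp_stab vS gF1)).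
- by move=> _ [d _ <-]; exact: (hc d).1.
- by move=> p [].
- exact: finite_image.
move=> g Gg; have [q Pq [d Dd Rd]] := h1 g Gg.
have Gq : ind_group S q by case: Pq.
have Gqg : ind_group S (q * g)%g by exact: ind_groupM.
have [Gc _] := hc d.
have Rcd : Rk (c d) d by apply: (hc d).2; exists (q * g)%g.
exists (q^-1)%g, (c d), ((c d)^-1 * (q * g))%g; split.
- exact: stabilizerV.
- by exists d.
- apply/stabilizerP => //; split; first by apply: ind_groupM => //; exact: ind_groupV.
  by move=> F FF; rewrite im_glM (h2 _ _ _ Gqg Gc Rd Rcd F FF) im_glK.
- by rewrite -!mulgA mulVKg mulKg.
Qed.

Lemma compat_basis E Fl F : compatible E Fl -> Fl F -> span (F `&` E) = F.
Proof.
move=> cE FF; have [A AE FA] := cE F FF; apply/seteqP; split.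
  apply: span_min; last by move=> x [].
  by rewrite FA; exact: subspace_span.
rewrite {1}FA; apply: spanS => x Ax; split; last exact: AE.
by rewrite FA; exact: span_incl.
Qed.

(** F^perp meets only in 0 the orthogonal of a finite set spanning V modulo F. *)
Lemma isotropic_fin S w F : valid_structure S -> form_of S = Some w ->
  isotropic w F -> finite_codim_in setT F -> fin F.
Proof.
move=> vS hw iF /codimP[sF _ [s sE]].
have [[eps heps] nd] := valid_eps vS hw.
have := codimI (codim_perp_seq w s) (subspace_perp w F) (@subsetT _ _).
move=> /codimP[_ _ [t tE]].
apply: (@finS _ _ _ (perp w F)); first by move=> x Fx u Fu; exact: iF.
exists t; rewrite tE span_seq; apply: adjsS => x [sx Fx] /=.
apply: nd => u; apply: (orthC heps).
have : adjs F s u by rewrite -sE.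
move: u; apply: (@adjs_min _ _ _ _ [set u | w u x = 0]) => //.
split=> /= [|a b ha hb|a b hb]; first by rewrite w0l.
- by rewrite wDl ha hb addr0.
- by rewrite wZl hb mulr0.
Qed.

Lemma finite_basis_of_fin E Fl F : basis_of setT E -> compatible E Fl -> Fl F ->
  fin F -> finite_set (F `&` E).
Proof.
move=> bE cE FF fF; apply: (fin_span_finite bE); first by move=> x [].
by rewrite (compat_basis cE FF).
Qed.

Lemma flag_bases_chain S Fl (Q : set (set V)) (B : set V -> set V) :
  generalized_flag S Fl ->
  (forall F F', F `<=` F' -> B F `<=` B F' \/ B F' `<=` B F) ->
  Q `<=` Fl -> forall L : seq (set V), B @` Q = [set` L] ->
  {in L &, forall A A', A `<=` A' \/ A' `<=` A}.
Proof.
move=> [_ ch _ _ _] hB QF L LE A A' AL A'L.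
have /seteqP[_ h] := LE.
have [F QF1 <-] := h A AL; have [F' QF2 <-] := h A' A'L.
by have [/hB|/hB] := ch _ _ (QF _ QF1) (QF _ QF2); tauto.
Qed.

Lemma adapted_list S E Fl (Q : set (set V)) : admissible S E ->
  generalized_flag S Fl -> compatible E Fl -> finite_set Fl -> Q `<=` Fl ->
  (forall F, Q F -> fin F) ->
  exists us : seq V, [/\ uniq us, {in us, forall e, E e /\ exists2 F, Q F & F e}
   & forall F, Q F -> exists j, F = span [set` take j us]].
Proof.
move=> aE gF cE fFl QF Qfin.
have /finite_seqP[L LE] : finite_set ((fun F => F `&` E) @` Q).
  by apply: finite_image; exact: sub_finite_set fFl.
have /seteqP[h1 h2] := LE.
have [||us [uus usL pre]] := @chain_prefixes _ L.
- apply: (flag_bases_chain gF _ QF LE) => F F' FF'; left.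
  by move=> x [Fx Ex]; split=> //; exact: FF'.
- move=> A AL; have [F QF1 <-] := h2 A AL.
  exact: (finite_basis_of_fin aE.1 cE (QF _ QF1) (Qfin _ QF1)).
exists us; split=> //.
- move=> e /usL[A AL Ae]; have [F QF1 FA] := h2 A AL.
  by move: Ae; rewrite -FA => -[Fe Ee]; split=> //; exists F.
- move=> F QF1; have FL : F `&` E \in L by apply: h1; exists F.
  by have [j jE] := pre _ FL; exists j; rewrite -jE (compat_basis cE (QF _ QF1)).
Qed.

Lemma nth_notin_span_take E (us : seq V) j : basis_of setT E -> uniq us ->
  {in us, forall e, E e} -> (j < size us)%N -> ~ span [set` take j us] us`_j.
Proof.
move=> bE uus usE jus.
have tE : [set` take j us] `<=` E by move=> e /= /mem_take; exact: usE.
have ju : us`_j \in us by exact: mem_nth.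
move=> /(coord_span bE tE (e := us`_j)) /=.
rewrite (coord_basis bE _ (usE _ ju)) eqxx oner_eq0.
move=> /(_ isT); rewrite -{1}(cat_take_drop j us) in uus.
move: uus; rewrite cat_uniq => /and3P[_ /hasPn h _]; apply/negP; apply: h.
by rewrite (drop_nth 0 jus) mem_head.
Qed.

Lemma map_take_span g (us : seq V) j :
  span [set` take j (map g us)] = g @` span [set` take j us].
Proof. by rewrite (seq_im_span _ (gl_linear g)) map_take. Qed.

Lemma orth_im S g u v : ind_group S g -> orth S u v -> orth S (g u) (g v).
Proof.
rewrite /orth; case hw : (form_of S) => [w|] //.
by move=> /(ind_group_form _ hw)[_ pg]; rewrite pg.
Qed.
Lemma iso_im S g u : ind_group S g -> iso S u -> iso S (g u).
Proof. exact: orth_im. Qed.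

Lemma fit_vector_im S g D u : ind_group S g -> fit_vector S D u ->
  fit_vector S (g @` D) (g u).
Proof.
move=> Gg [nD iu ou]; split; first by move/im_glE.
- exact: iso_im.
- by move=> _ [x Dx <-]; apply: orth_im => //; exact: ou.
Qed.

Lemma vector_normal_form S E Fl (us : seq V) E1 : valid_structure S ->
  generalized_flag S Fl -> admissible S E -> compatible E Fl -> finite_set Fl ->
  admissible S E1 -> valid_vectors S E1 us ->
  exists N : set (seq V), [/\ finite_set N, forall s, N s -> valid_vectors S E s
   & forall g, ind_group S g -> exists2 p, stabilizer S Fl p & exists2 s, N s &
     forall j, (p * g)%g @` span [set` take j us] = span [set` take j s]].
Proof.
move=> vS gF aE cE fFl aE1 [uus usE uso].
have [|||||||N [fN Nv hN]] := @normal_form _ V V (fun g => gl_fun g) _ _ _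
  (stabilizer S Fl) _ _ (valid_vectors S E) (fit_vector S) _ _
  (vector_step vS gF aE cE fFl) (size us).
- by [].
- by [].
- by move=> g; exact: gl_linear.
- exact: stabilizer1.
- by move=> g h; exact: stabilizerM.
- by [].
- by move=> p D u [Gp _]; exact: fit_vector_im.
exists N; split=> //; first by move=> s /Nv[].
move=> g Gg; have [||p Pp [s Ns ps]] := hN (map g us); first by rewrite size_map.
  move=> j jus; rewrite (nth_map 0) // map_take_span; apply: fit_vector_im => //.
  have ju : us`_j \in us by exact: mem_nth.
  split.
  - by apply: (nth_notin_span_take aE1.1) => // e /usE[].
  - by case: (usE _ ju).
  - move=> x; rewrite /orth; case hw : (form_of S) => [w|] // hx.
    have [[eps heps] _] := valid_eps vS hw.
    apply: (orthC heps); move: x hx.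
    apply: (@span_min _ _ _ [set x | w us`_j x = 0]).
      exact: subspace_ker (form_scalar w _).
    move=> y /= /mem_take yus; have := uso _ _ ju yus.
    by rewrite /orth hw.
exists p => //; exists s => // j.
by rewrite im_glM -map_take_span ps.
Qed.

Definition large_members Fl := forall F, Fl F -> finite_dim F \/ finite_codim_in setT F.

(** The isotropic members have finite dimension and are spanned by prefixes of one
list of basis vectors; the other members are orthogonals of isotropic ones. *)
Lemma sufficient_form S w E1 Fl1 E2 Fl2 : valid_structure S ->
  form_of S = Some w -> generalized_flag S Fl1 -> admissible S E1 ->
  compatible E1 Fl1 -> generalized_flag S Fl2 -> admissible S E2 ->
  compatible E2 Fl2 -> finite_set Fl1 -> finite_set Fl2 -> large_members Fl1 ->
  finite_set (diag_orbits (ind_group S) (stabilizer S Fl2) (stabilizer S Fl1)).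
Proof.
move=> vS hw gF1 aE1 cE1 gF2 aE2 cE2 fFl1 fFl2 tF1.
have [[eps heps] _] := valid_eps vS hw.
have ch : chain Fl1 by case: gF1.
pose Q : set (set V) := [set F | Fl1 F /\ isotropic w F].
have [||us [uus usE pre]] := @adapted_list S E1 Fl1 Q aE1 gF1 cE1 fFl1.
- by move=> F [].
- move=> F [FF iF]; case: (tF1 F FF) => [|h]; first exact: fin_finite_dim.
  exact: (isotropic_fin vS hw iF h).
have vus : valid_vectors S E1 us.
  split=> //.
    move=> e /usE[Ee [F [_ iF] Fe]]; split=> //.
    by rewrite /iso hw; exact: iF.
  move=> e f /usE[_ [F [FF iF] Fe]] /usE[_ [F' [FF' iF'] F'f]].
  by rewrite /orth hw; have [h|h] := ch _ _ FF FF'; [apply: iF' => //; exact: h|apply: iF => //; exact: h].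
have [N [fN _ hN]] := vector_normal_form vS gF2 aE2 cE2 fFl2 aE1 vus.
apply: (@finite_by_data S Fl1 Fl2 _ N (fun k s => forall j,
   k @` span [set` take j us] = span [set` take j s])) => //.
move=> k k' s Gk Gk' Rk Rk'.
have iso_eq F : Q F -> k @` F = k' @` F.
  by move=> /pre[j ->]; rewrite Rk Rk'.
move=> F FF.
have [P PP] : Fl1 (perp w F) /\ perp w (perp w F) = F.
  by case: gF1 => _ _ _ _; rewrite hw => /(_ F FF).
have [h|h] := ch _ _ FF P.
  by apply: iso_eq; split=> // x y Fx Fy; exact: (h _ Fy).
have perp_im g X : ind_group S g -> g @` perp w X = perp w (g @` X).
  move=> /(ind_group_form _ hw)[_ pg]; apply/seteqP; split.
    by move=> _ [x Px <-] _ [y Xy <-]; rewrite pg; exact: Px.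
  move=> x Px; apply/im_glVE => y Xy.
  by rewrite -pg glVK; apply: Px; exists y.
rewrite -PP (perp_im k) // (perp_im k') // iso_eq //; split=> // x y /h Fx Py.
exact: (Py x).
Qed.

(** Members of finite dimension are spanned by prefixes of a list us of basis
vectors; the others are annihilators of prefixes of a list ws of coordinate
functionals, which vanish on us. The vectors are normalized first, then the
functionals by elements fixing the normalized vectors. *)
Lemma sufficient_typeA S E1 Fl1 E2 Fl2 : valid_structure S ->
  form_of S = None -> generalized_flag S Fl1 -> admissible S E1 ->
  compatible E1 Fl1 -> generalized_flag S Fl2 -> admissible S E2 ->
  compatible E2 Fl2 -> finite_set Fl1 -> finite_set Fl2 -> large_members Fl1 ->
  finite_set (diag_orbits (ind_group S) (stabilizer S Fl2) (stabilizer S Fl1)).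
Proof.
move=> vS hw gF1 aE1 cE1 gF2 aE2 cE2 fFl1 fFl2 tF1.
have ch : chain Fl1 by case: gF1.
have bE := aE1.1.
pose Q : set (set V) := [set F | Fl1 F /\ fin F].
have [||us [uus usE pre]] := @adapted_list S E1 Fl1 Q aE1 gF1 cE1 fFl1.
- by move=> F [].
- by move=> F [].
pose Q' : set (set V) := [set F | Fl1 F /\ ~ fin F].
have /finite_seqP[L LE] : finite_set ((fun F => E1 `\` F) @` Q').
  by apply: finite_image; apply: sub_finite_set fFl1 => F [].
have /seteqP[h1 h2] := LE.
have [||fs [ufs fsL fpre]] := @chain_prefixes _ L.
- apply: (flag_bases_chain gF1 _ _ LE); last by move=> F [].
  by move=> F F' FF'; right=> x [Ex nx]; split=> // /FF'.
- move=> A AL; have [F [FF nF] <-] := h2 A AL.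
  case: (tF1 F FF) => [/fin_finite_dim //|/codimP[_ _ [s sE]]].
  have AE1 : F `&` E1 `<=` E1 by move=> x [].
  apply: sub_finite_set (finite_new_basis s bE AE1) => e [Ee nFe].
  by split=> //; [case|rewrite (compat_basis cE1 FF) -sE].
have fsE : {in fs, forall f, E1 f /\ exists2 F, Q' F & ~ F f}.
  move=> f /fsL[A AL Af]; have [F QF FA] := h2 A AL.
  by move: Af; rewrite -FA => -[Ef nf]; split=> //; exists F.
have disj : {in fs, forall f, f \notin us}.
  move=> f /fsE[_ [F' [FF' nf'] nF'f]]; apply/negP => /usE[_ [F [FF fF] Ff]].
  have [h|h] := ch _ _ FF FF'; first by apply: nF'f; exact: h.
  by apply: nf'; exact: finS h fF.
pose ws := covectors E1 fs.
have vus : valid_vectors S E1 us.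
  split=> //; last by move=> e f _ _; rewrite /orth hw.
  by move=> e /usE[Ee _]; split=> //; rewrite /iso hw.
have [N [fN Nv hN]] := vector_normal_form vS gF2 aE2 cE2 fFl2 aE1 vus.
have /choice[N' hN'] : forall s, exists N' : set (seq (V -> K^o)), N s ->
   finite_set N' /\ forall k, ind_group S k ->
     (forall j, k @` span [set` take j us] = span [set` take j s]) ->
     exists2 p, fix_stab S Fl2 s p & exists2 t, N' t & forall j,
       dual_act (p * k)%g @` span [set` take j ws] = span [set` take j t].
  move=> s; have [Ns|ns] := pselect (N s); last by exists set0.
  have [us' sE _] := Nv s Ns.
  have sE2 : {in s, forall e, E2 e} by move=> e /sE[].
  have [||||N' [fN' _ hN']] := @normal_form _ V _ (@dual_act _ V) (@dual_actM _ V)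
    (@dual_act1 _ V) (@dual_act_linear _ V) (fix_stab S Fl2 s) _ _
    (valid_covectors E2 s) (fit_covector S s) _ _
    (covector_step vS gF2 aE2 cE2 fFl2 hw sE2) (size ws).
  - exact: fix_stab1.
  - by move=> p q; exact: fix_stabM.
  - by exists [::].
  - by move=> p D phi; exact: fit_covectorP.
  exists N' => _; split=> // k Gk ks.
  have im_span j : span [set` take j (map (dual_act k) ws)] =
      dual_act k @` span [set` take j ws].
    by rewrite (seq_im_span _ (@dual_act_linear _ V k)) map_take.
  have [||p Pp [t Nt pt]] := hN' (map (dual_act k) ws); first by rewrite size_map.
    move=> j jws; have jfs : (j < size fs)%N by rewrite size_map in jws.
    rewrite (nth_map 0) // (nth_map 0) //; set f := fs`_j.
    have ffs : f \in fs by exact: mem_nth.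
    have [Ef _] := fsE _ ffs.
    split.
    - apply: dual_act_V_star (ind_group_GL Gk) _; exact: coord_V_star.
    - suff vanish : span [set` take j (map (dual_act k) ws)] `<=`
          [set phi : V -> K^o | phi (k f) = 0].
        move=> /vanish /=; rewrite /dual_act /= gl_funK coord_basis // eqxx => /eqP.
        by rewrite oner_eq0.
      apply: span_min.
        split=> //= [a b ha hb|a b hb].
          by rewrite [LHS](_ : _ = a (k f) + b (k f)) // ha hb addr0.
        by rewrite [LHS](_ : _ = a * b (k f)) // hb mulr0.
      move=> phi /=; rewrite -map_take -map_take => /mapP[_ /mapP[f' f'j ->] ->] /=.
      rewrite /dual_act /= gl_funK (coord_basis bE f' Ef); case: eqP => // ff'.
      have := ufs; rewrite -(cat_take_drop j fs) cat_uniq => /and3P[_ /hasPn h _].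
      have := h f; rewrite (drop_nth 0 jfs) mem_head => /(_ isT) /=.
      by rewrite -/f -ff' f'j.
    - move=> x xs; have : span [set` s] x by exact: span_incl.
      have -> : span [set` s] = k @` span [set` us].
        have := ks (maxn (size us) (size s)).
        by rewrite !take_oversize ?leq_maxl ?leq_maxr.
      move=> [y ySp <-]; rewrite /dual_act /= gl_funK.
      apply: contrapT => /eqP cy.
      have usE1 : [set` us] `<=` E1 by move=> e /usE[].
      by have := coord_span bE usE1 ySp cy; apply/negP; exact: disj.
  exists p => //; exists t => // j.
  rewrite -pt im_span; apply/seteqP; split=> [_ [x h <-]|_ [_ [x h <-] <-]].
    by exists (dual_act k x) => //; exists x.
  by exists x.
pose D := \bigcup_(s in N) (pair s @` N' s).
apply: (@finite_by_data S Fl1 Fl2 _ D (fun k d =>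
  (forall j, k @` span [set` take j us] = span [set` take j d.1]) /\
  (forall j, dual_act k @` span [set` take j ws] = span [set` take j d.2]))) => //.
- by apply: bigcup_finite => // s Ns; apply: finite_image; exact: (hN' s Ns).1.
- move=> g Gg; have [p Pp [s Ns ps]] := hN g Gg.
  have Gpg : ind_group S (p * g)%g by apply: ind_groupM => //; case: Pp.
  have [q [Pq qs] [t Nt qt]] := (hN' s Ns).2 _ Gpg ps.
  exists (q * p)%g; first exact: stabilizerM.
  exists (s, t); first by exists s => //; exists t.
  split=> j; rewrite -mulgA ?qt // im_glM ps.
  have qx := linear_fix_span (gl_linear q) qs.
  have sub : span [set` take j s] `<=` span [set` s].
    by apply: spanS => x /= /mem_take.
  apply/seteqP; split=> [_ [x h <-]|x h]; first by rewrite qx //; exact: sub.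
  by exists x => //; rewrite qx //; exact: sub.
- move=> k k' d Gk Gk' [Rk1 Rk2] [Rk'1 Rk'2] F FF.
  have [fF|nfF] := pselect (fin F).
    by have [j ->] := pre F (conj FF fF); rewrite Rk1 Rk'1.
  have FL : E1 `\` F \in L by apply: h1; exists F.
  have [j jE] := fpre _ FL.
  have FE : F = [set x | forall phi, span [set` take j ws] phi -> phi x = 0].
    have inF f : f \in take j fs <-> E1 f /\ ~ F f.
      by have /seteqP[a b] := jE; split=> [/b|/a].
    apply/seteqP; split=> [x Fx|x hx].
      apply: (@span_min _ _ _ [set phi : V -> K^o | phi x = 0]).
        split=> //= [a b ha hb|a b hb].
          by rewrite [LHS](_ : _ = a x + b x) // ha hb addr0.
        by rewrite [LHS](_ : _ = a * b x) // hb mulr0.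
      move=> phi /=; rewrite -map_take => /mapP[f /inF[Ef nf] ->] /=.
      apply: contrapT => /eqP cx; apply: nf.
      exact: (compat_coord bE cE1 FF Fx cx).
    apply: (span_coord bE); first by case: gF1 => + _ _ _ _; exact.
    move=> e Ee ce; apply: contrapT => ne; move/eqP: ce; apply.
    apply: hx; apply: span_incl; rewrite /= -map_take; apply: map_f.
    by apply/inF.
  have im_ann g : g @` F =
      [set x | forall phi, (dual_act g @` span [set` take j ws]) phi -> phi x = 0].
    apply/seteqP; split=> x.
      move=> [y Fy <-] _ [phi h <-]; rewrite /dual_act /= gl_funK.
      by move: Fy; rewrite FE; exact.
    move=> hx; apply/im_glVE; rewrite FE => phi h.
    by apply: (hx (dual_act g phi)); exists phi.
  by rewrite !im_ann Rk2 Rk'2.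
Qed.

Lemma sufficient S E1 Fl1 E2 Fl2 : valid_structure S ->
  generalized_flag S Fl1 -> admissible S E1 ->
  compatible E1 Fl1 -> generalized_flag S Fl2 -> admissible S E2 ->
  compatible E2 Fl2 -> finite_set Fl1 -> finite_set Fl2 -> large_members Fl1 ->
  finite_set (diag_orbits (ind_group S) (stabilizer S Fl1) (stabilizer S Fl2)).
Proof.
move=> *; apply: finite_orbits_sym.
case hw : (form_of S) => [w|]; first by apply: (@sufficient_form S w E1 Fl1 E2 Fl2).
by apply: (@sufficient_typeA S E1 Fl1 E2 Fl2).
Qed.

Lemma semilarge_finite S P Fl : valid_structure S -> is_stabilizer_of S P Fl ->
  semilarge S P -> finite_set Fl.
Proof.
move=> vS [gF _ ->] [_ fin]; apply: sub_finite_set fin => F FF.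
split; first by case: gF => + _ _ _ _; exact.
by move=> g /(stabilizerP _ gF)[_ /(_ F FF) ->].
Qed.
End Sufficiency.

Theorem theorem1p4 (R : realType) (V : lmodType R[i]) (S : vstructure V)
    (P1 P2 : set (gl V)) :
  countably_infinite_dim [set: V] ->
  valid_structure S ->
  splitting_parabolic S P1 -> P1 `<` ind_group S ->
  splitting_parabolic S P2 -> P2 `<` ind_group S ->
  (finite_set (diag_orbits (ind_group S) P1 P2) <->
   (large S P1 /\ semilarge S P2) \/ (large S P2 /\ semilarge S P1)).
Proof.
move=> _ vS sp1 pr1 sp2 pr2.
have [Fl1 st1] := sp1; have [Fl2 st2] := sp2.
have [gF1 [E1 aE1 cE1] P1E] := st1; have [gF2 [E2 aE2 cE2] P2E] := st2.
split.
  move=> fin; rewrite P1E P2E in fin pr1 pr2.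
  have f1 := flag_finite_of_orbits vS gF1 aE1 cE1 gF2 aE2 cE2 pr2 fin.
  have f2 := flag_finite_of_orbits vS gF2 aE2 cE2 gF1 aE1 cE1 pr1 (finite_orbits_sym fin).
  have s1 : semilarge S P1 by split=> //; rewrite P1E; exact: (finite_invariant vS gF1 aE1 cE1 f1).
  have s2 : semilarge S P2 by split=> //; rewrite P2E; exact: (finite_invariant vS gF2 aE2 cE2 f2).
  have [l|l] := one_large vS gF1 aE1 cE1 gF2 aE2 cE2 fin.
    by left; split=> //; split=> //; exists Fl1.
  by right; split=> //; split=> //; exists Fl2.
case=> -[[_ [Fl [st fFl tF]]] sl].
  have [gF [E aE cE] PE] := st; rewrite PE P2E.
  exact: (sufficient vS gF aE cE gF2 aE2 cE2 fFl (semilarge_finite vS st2 sl) tF).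
have [gF [E aE cE] PE] := st; rewrite PE P1E; apply: finite_orbits_sym.
exact: (sufficient vS gF aE cE gF1 aE1 cE1 fFl (semilarge_finite vS st1 sl) tF).
Qed.
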